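(* Martin's conjecture holds for almost $\aleph_0$-categorical weakly quasi-o-minimal theories. That is: let $T$ be a countable, complete, almost $\aleph_0$-categorical, weakly quasi-o-minimal theory. If $I(T,\aleph_0)<2^{\aleph_0}$, then for every countable $M\models T$ the $L_1(T)$-theory $T_1(M)$ of $M$ is $\aleph_0$-categorical.
   Context: $I(T,\aleph_0)$ is the number of countable models of $T$ up to isomorphism. $\mathfrak C$ is a monster model of $T$. $T$ (one-sorted) is weakly quasi-o-minimal if there is a $0$-definable linear order $<$ on $\mathfrak C$ such that every parametrically definable subset of $\mathfrak C$ is a finite Boolean combination of $0$-definable sets and $<$-convex sets. $T$ is almost $\aleph_0$-categorical if for all $n$ and all types $p_1(x_1),\dots,p_n(x_n)\in S_1(T)$ the type $\bigcup_{1\leqslant i\leqslant n}p_i(x_i)$ has only finitely many extensions in $S_n(T)$. If $I(T,\aleph_0)<2^{\aleph_0}$ then $T$ is small, i.e. $S(T)=\bigcup_n S_n(T)$ is countable. For small $T$, $L_1(T)$ is the smallest countable fragment of $L_{\omega_1,\omega}$ that contains all first-order formulae and all formulae $\bigwedge_{\phi(x)\in p}\phi(x)$ for $p\in S(T)$. For a countable $M\models T$, $T_1(M)$ denotes the set of $L_1(T)$-sentences true in $M$; it is $\aleph_0$-categorical if every countable model of $T_1(M)$ is isomorphic to $M$. *)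

(* Defs.v *)
From mathcomp Require Import all_boot.
From mathcomp Require Import boolp classical_sets functions cardinality.

Set Implicit Arguments.
Unset Strict Implicit.
Unset Printing Implicit Defensive.

Local Open Scope classical_set_scope.
Local Open Scope card_scope.

Definition card_lt (T U : Type) (A : set T) (B : set U) : Prop :=
  A #<= B /\ ~ (B #<= A).

Inductive boolean_combination (X : Type) (G : set (set X)) : set X -> Prop :=
| BCbase A : G A -> boolean_combination G A
| BCcompl A : boolean_combination G A -> boolean_combination G (~` A)
| BCinter A B : boolean_combination G A -> boolean_combination G B ->
    boolean_combination G (A `&` B).

Definition strict_linear_order (X : Type) (lt : X -> X -> Prop) : Prop :=
  [/\ forall x, ~ lt x x,
      forall x y z, lt x y -> lt y z -> lt x z
    & forall x y, [\/ lt x y, x = y | lt y x]].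

Definition convex_set (X : Type) (lt : X -> X -> Prop) (A : set X) : Prop :=
  forall x y z, A x -> A z -> lt x y -> lt y z -> A y.

(** * First-order logic *)

Record language : Type := Language {
  funsym : Type;
  relsym : Type;
  farity : funsym -> nat;
  rarity : relsym -> nat }.

Definition countable_language (L : language) : Prop :=
  countable [set: funsym L] /\ countable [set: relsym L].

(* The set {0, ..., n-1}, with 0 = None and i + 1 = Some i.  The type of
   ordinals would not do: its universe is that of [predArgType], which is too
   large for sets of formulas to index the conjunctions of L_(omega_1, omega)
   below. *)
Fixpoint fin (n : nat) : Set := if n is m.+1 then option (fin m) else void.

(* [term L n] and [form L n] have their free variables among x_0, ..., x_(n-1);
   a quantifier binds x_0 and shifts the other variables by one. *)
Inductive term (L : language) (n : nat) : Type :=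
| Var of fin n
| App (f : funsym L) of (fin (farity f) -> term L n).
Arguments Var {L n}.
Arguments App {L n}.

Inductive form (L : language) (n : nat) : Type :=
| Eq of term L n & term L n
| Rel (r : relsym L) of (fin (rarity r) -> term L n)
| Not of form L n
| And of form L n & form L n
| Ex of form L n.+1.
Arguments Eq {L n}.
Arguments Rel {L n}.
Arguments Not {L n}.
Arguments And {L n}.
Arguments Ex {L n}.

Definition scons (X : Type) (n : nat) (a : X) (e : fin n -> X) : fin n.+1 -> X :=
  fun i => match i with Some j => e j | None => a end.

Definition env0 (X : Type) : fin 0 -> X := fun i => match i with end.
Arguments env0 {X}.

Definition env1 (X : Type) (a : X) : fin 1 -> X := fun _ => a.

Definition env2 (X : Type) (a b : X) : fin 2 -> X := scons a (env1 b).

Fixpoint tsubst (L : language) (n m : nat) (s : fin n -> term L m)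
    (t : term L n) : term L m :=
  match t with
  | Var i => s i
  | App f ts => App f (fun j => tsubst s (ts j))
  end.

Definition up (L : language) (n m : nat) (s : fin n -> term L m) :
    fin n.+1 -> term L m.+1 :=
  scons (Var (None : fin m.+1))
    (fun i => tsubst (fun j => Var (Some j : fin m.+1)) (s i)).

Fixpoint fsubst (L : language) (n : nat) (phi : form L n) :
    forall m, (fin n -> term L m) -> form L m :=
  match phi with
  | Eq t u => fun m s => Eq (tsubst s t) (tsubst s u)
  | Rel r ts => fun m s => Rel r (fun j => tsubst s (ts j))
  | Not phi => fun m s => Not (fsubst phi s)
  | And phi psi => fun m s => And (fsubst phi s) (fsubst psi s)
  | Ex phi => fun m s => Ex (fsubst phi (up s))
  end.

Record structure (L : language) : Type := Structure {
  carrier :> Type;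
  carrier_inhabited : inhabited carrier;
  finterp : forall f : funsym L, (fin (farity f) -> carrier) -> carrier;
  rinterp : forall r : relsym L, (fin (rarity r) -> carrier) -> Prop }.
Arguments finterp {L} s f.
Arguments rinterp {L} s r.

Fixpoint teval (L : language) (M : structure L) (n : nat) (e : fin n -> M)
    (t : term L n) : M :=
  match t with
  | Var i => e i
  | App f ts => finterp M f (fun j => teval e (ts j))
  end.

Fixpoint sat (L : language) (M : structure L) (n : nat) (phi : form L n) :
    (fin n -> M) -> Prop :=
  match phi with
  | Eq t u => fun e => teval e t = teval e u
  | Rel r ts => fun e => rinterp M r (fun j => teval e (ts j))
  | Not phi => fun e => ~ sat phi e
  | And phi psi => fun e => sat phi e /\ sat psi e
  | Ex phi => fun e => exists a : M, sat phi (scons a e)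
  end.

Definition isomorphism (L : language) (M N : structure L) (h : M -> N) : Prop :=
  [/\ bijective h,
      forall (f : funsym L) (a : fin (farity f) -> M),
        h (finterp M f a) = finterp N f (h \o a)
    & forall (r : relsym L) (a : fin (rarity r) -> M),
        rinterp M r a <-> rinterp N r (h \o a)].

Definition isomorphic (L : language) (M N : structure L) : Prop :=
  exists h : M -> N, isomorphism h.

(** * Theories and types *)

Definition theory (L : language) : Type := set (form L 0).

Definition model (L : language) (T : theory L) (M : structure L) : Prop :=
  forall phi, T phi -> sat (M := M) phi env0.

Definition entails (L : language) (T : theory L) (phi : form L 0) : Prop :=
  forall M : structure L, model T M -> sat (M := M) phi env0.

Definition complete_theory (L : language) (T : theory L) : Prop :=
  (exists M : structure L, model T M) /\
  forall phi, entails T phi \/ entails T (Not phi).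

(* S_n(T) *)
Definition types (L : language) (T : theory L) (n : nat) : set (set (form L n)) :=
  [set p | (exists (M : structure L) (a : fin n -> M),
               model T M /\ forall phi, p phi -> sat phi a) /\
           forall phi, p phi \/ p (Not phi)].
Arguments types {L} T n.

(* The union of the p_i(x_i), for i < n *)
Definition type_union (L : language) (n : nat) (p : fin n -> set (form L 1)) :
    set (form L n) :=
  [set psi | exists (i : fin n) (phi : form L 1),
      p i phi /\ psi = fsubst phi (fun _ => Var i)].

Definition almost_aleph0_categorical (L : language) (T : theory L) : Prop :=
  forall (n : nat) (p : fin n -> set (form L 1)),
    (forall i, types T 1 (p i)) ->
    finite_set [set q | types T n q /\ type_union p `<=` q].

Definition countable_structure (L : language) (M : structure L) : Prop :=
  countable [set: M].

(* The set of isomorphism classes of countable models; its cardinal is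
   I(T, aleph_0). *)
Definition countable_model_classes (L : language) (T : theory L) :
    set (set (structure L)) :=
  [set X | exists M : structure L,
      [/\ model T M, countable_structure M
        & X = [set N | countable_structure N /\ isomorphic M N]]].

(** * Monster models *)

(* A formula in x_0 with parameters substituted for the other variables *)
Record pform (L : language) (C : structure L) : Type := PForm {
  pform_arity : nat;
  pform_form : form L pform_arity.+1;
  pform_par : fin pform_arity -> C }.
Arguments pform_par {L C} p.

Definition psat (L : language) (C : structure L) (phi : pform C) (c : C) : Prop :=
  sat (pform_form phi) (scons c (pform_par phi)).

Definition pform_over (L : language) (C : structure L) (A : set C) :
    set (pform C) :=
  [set phi | forall i, A (pform_par phi i)].

(* Cardinals are represented by types: kappa = |K|. *)
Definition kappa_saturated (K : Type) (L : language) (C : structure L) : Prop :=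
  forall A : set C, card_lt A [set: K] ->
  forall p : set (pform C), p `<=` pform_over A ->
    (forall q : set (pform C), finite_set q -> q `<=` p ->
       exists c, forall phi, q phi -> psat phi c) ->
    exists c, forall phi, p phi -> psat phi c.

Definition partial_elementary (L : language) (C : structure L) (A : set C)
    (f : C -> C) : Prop :=
  forall (n : nat) (phi : form L n) (a : fin n -> C),
    (forall i, A (a i)) -> (sat phi a <-> sat phi (f \o a)).

Definition strongly_kappa_homogeneous (K : Type) (L : language) (C : structure L) :
    Prop :=
  forall A : set C, card_lt A [set: K] ->
  forall f : C -> C, partial_elementary A f ->
    exists2 g : C -> C, isomorphism g & forall a, A a -> g a = f a.

(* How large kappa should be is a matter of convention; for a theory in a
   countable language, every uncountable kappa is allowed here. *)
Definition monster_model (L : language) (T : theory L) (C : structure L) : Prop :=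
  model T C /\
  exists K : Type,
    [/\ ~ countable [set: K], kappa_saturated K C & strongly_kappa_homogeneous K C].

Definition zero_definable (L : language) (C : structure L) : set (set C) :=
  [set D | exists phi : form L 1, D = [set c | sat phi (env1 c)]].

Definition par_definable (L : language) (C : structure L) : set (set C) :=
  [set D | exists phi : pform C, D = [set c | psat phi c]].

(* To be read with C the monster model of the theory *)
Definition weakly_quasi_o_minimal (L : language) (C : structure L) : Prop :=
  exists theta : form L 2,
    let lt := fun a b : C => sat theta (env2 a b) in
    strict_linear_order lt /\
    forall D : set C, par_definable D ->
      boolean_combination (@zero_definable L C `|` convex_set lt) D.

(** * The logic L_(omega_1, omega) *)

(* Formulas with finitely many free variables.  Countable conjunctions are
   indexed by countable types, so that the conjunction over a countable set of
   formulas needs no enumeration; disjunctions and universal quantifiers are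
   expressed by negation. *)
Inductive iform (L : language) (n : nat) : Type :=
| IEq of term L n & term L n
| IRel (r : relsym L) of (fin (rarity r) -> term L n)
| INot of iform L n
| IAnd of iform L n & iform L n
| IEx of iform L n.+1
| IBigAnd (J : Type) of countable [set: J] & (J -> iform L n).
Arguments IEq {L n}.
Arguments IRel {L n}.
Arguments INot {L n}.
Arguments IAnd {L n}.
Arguments IEx {L n}.
Arguments IBigAnd {L n} J.

Fixpoint isat (L : language) (M : structure L) (n : nat) (phi : iform L n) :
    (fin n -> M) -> Prop :=
  match phi with
  | IEq t u => fun e => teval e t = teval e u
  | IRel r ts => fun e => rinterp M r (fun j => teval e (ts j))
  | INot phi => fun e => ~ isat phi e
  | IAnd phi psi => fun e => isat phi e /\ isat psi e
  | IEx phi => fun e => exists a : M, isat phi (scons a e)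
  | IBigAnd J _ F => fun e => forall i : J, isat (F i) e
  end.

Fixpoint isubst (L : language) (n : nat) (phi : iform L n) :
    forall m, (fin n -> term L m) -> iform L m :=
  match phi with
  | IEq t u => fun m s => IEq (tsubst s t) (tsubst s u)
  | IRel r ts => fun m s => IRel r (fun j => tsubst s (ts j))
  | INot phi => fun m s => INot (isubst phi s)
  | IAnd phi psi => fun m s => IAnd (isubst phi s) (isubst psi s)
  | IEx phi => fun m s => IEx (isubst phi (up s))
  | IBigAnd J cJ F => fun m s => IBigAnd J cJ (fun i => isubst (F i) s)
  end.

Fixpoint fo (L : language) (n : nat) (phi : form L n) : iform L n :=
  match phi with
  | Eq t u => IEq t u
  | Rel r ts => IRel r ts
  | Not phi => INot (fo phi)
  | And phi psi => IAnd (fo phi) (fo psi)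
  | Ex phi => IEx (fo phi)
  end.

(* A fragment contains the atomic formulas and is closed under finitary
   connectives, quantifiers, substitution of terms, and subformulas. *)
Record fragment (L : language) (F : forall n, set (iform L n)) : Prop := Fragment {
  fragment_eq : forall n (t u : term L n), F n (IEq t u);
  fragment_rel : forall n (r : relsym L) (ts : fin (rarity r) -> term L n),
    F n (IRel r ts);
  fragment_not : forall n (phi : iform L n), F n (INot phi) <-> F n phi;
  fragment_and : forall n (phi psi : iform L n),
    F n (IAnd phi psi) <-> F n phi /\ F n psi;
  fragment_ex : forall n (phi : iform L n.+1), F n (IEx phi) <-> F n.+1 phi;
  fragment_bigand : forall n (J : Type) (cJ : countable [set: J])
      (G : J -> iform L n), F n (IBigAnd J cJ G) -> forall i, F n (G i);
  fragment_subst : forall n m (phi : iform L n) (s : fin n -> term L m),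
    F n phi -> F m (isubst phi s) }.

Definition type_conjunction (L : language) (n : nat) (p : set (form L n))
    (cp : countable [set: {phi | p phi}]) : iform L n :=
  IBigAnd {phi | p phi} cp (fun phi => fo (proj1_sig phi)).

(* The intersection of all countable fragments containing the first-order
   formulas and the conjunctions of the types in S(T).  When the language is
   countable and T is small, this is itself such a fragment, the smallest one;
   moreover [cp] below exists for each p, and is unique. *)
Definition L1 (L : language) (T : theory L) (n : nat) : set (iform L n) :=
  [set phi | forall F : forall n, set (iform L n),
      fragment F -> (forall k, countable (F k)) ->
      (forall k (psi : form L k), F k (fo psi)) ->
      (forall k (p : set (form L k)) (cp : countable [set: {psi | p psi}]),
          types T k p -> F k (type_conjunction cp)) ->
      F n phi].

Definition imodel (L : language) (S : set (iform L 0)) (M : structure L) : Prop :=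
  forall phi, S phi -> isat (M := M) phi env0.

(* T_1(M) *)
Definition T1 (L : language) (T : theory L) (M : structure L) : set (iform L 0) :=
  [set phi | L1 T phi /\ isat (M := M) phi env0].

Definition T1_aleph0_categorical (L : language) (T : theory L)
    (M : structure L) : Prop :=
  forall N : structure L,
    countable_structure N -> imodel (T1 T M) N -> isomorphic N M.

(* Main.v *)
(* Types are orbits of the automorphism group of the monster model.  By almost
   aleph_0-categoricity a 1-type splits into finitely many orbits over any finite
   set, and by weak quasi-o-minimality these are convex within the 1-type.

   Suppose first that every 1-type is convex within some 0-definable set.  Then an
   elementary submodel M meets each orbit over a finite part of M that is bounded
   on both sides in its 1-type, so only the extreme orbits can be omitted.  Call
   tp(y/s) open if all its extensions over finite parts of M are realized in M.
   Adding finitely many elements to s makes all elements of finitely many given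
   1-types open over s, and tuples that are conjugate over such an s are
   back-and-forth equivalent.  Hence M realizes finitely many L_1(T)-types in each
   product of 1-types, each of them is isolated by a single formula of L_1(T),
   and a back-and-forth between M and any countable model of T_1(M) yields an
   isomorphism.

   Suppose next that some 1-type is not convex, and that there are countably many
   1-types.  For realizations x and y let E(x, y) hold if some formula of the type
   has no other realizations between x and y.  A Morley sequence at the right end
   of the type, indexed by a countable linear order I with a least but no greatest
   element, has an atomic model over it, where the elements of the type that are
   not below the sequence lie in the E-classes of its members.  So the model,
   together with the first element of the sequence, determines I, and there are
   2^aleph_0 countable models.

   If there are uncountably many 1-types, then no countable fragment contains all
   their conjunctions, L_1(T) consists of all formulas, and Scott's isomorphism
   theorem applies. *)

Require Import Defs.
From mathcomp Require Import all_boot.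
From mathcomp Require Import boolp classical_sets functions cardinality.
From Stdlib Require List.
From mathcomp Require Import zify.

Set Implicit Arguments.
Unset Strict Implicit.
Unset Printing Implicit Defensive.

Local Open Scope classical_set_scope.
Local Open Scope card_scope.

(** * Lists and sequences *)

Definition incl (X : Type) (s t : seq X) : Prop :=
  forall x, List.In x s -> List.In x t.

Lemma In_cat (X : Type) (x : X) s t :
  List.In x (s ++ t) <-> List.In x s \/ List.In x t.
Proof. by elim: s => [|y s IH] /=; [split; [right|case]|rewrite IH; tauto]. Qed.

Lemma In_map (X Y : Type) (f : X -> Y) y s :
  List.In y (map f s) <-> exists2 x, List.In x s & f x = y.
Proof.
elim: s => [|x s IH] /=; first by split => // -[].
rewrite IH; split=> [[<-|[z zs <-]]|[z [->|zs] <-]].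
- by exists x; [left|].
- by exists z; [right|].
- by left.
- by right; exists z.
Qed.

Lemma inclxx (X : Type) (s : seq X) : incl s s. Proof. by []. Qed.

Lemma incl_trans (X : Type) (s t u : seq X) : incl s t -> incl t u -> incl s u.
Proof. by move=> st tu x /st /tu. Qed.

Lemma incl_cons (X : Type) (x : X) s : incl s (x :: s).
Proof. by move=> y; right. Qed.

Lemma incl_cons2 (X : Type) (x : X) s t : incl s t -> incl (x :: s) (x :: t).
Proof. by move=> st y [->|/st]; [left|right]. Qed.

Lemma incl_consl (X : Type) (x : X) s t : List.In x t -> incl s t -> incl (x :: s) t.
Proof. by move=> xt st y [<-|/st]. Qed.

Lemma incl_catr (X : Type) (s t : seq X) : incl t (s ++ t).
Proof. by move=> x xt; apply/In_cat; right. Qed.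

Lemma incl_catl (X : Type) (s t : seq X) : incl s (s ++ t).
Proof. by move=> x xt; apply/In_cat; left. Qed.

Lemma incl_cat (X : Type) (s t u : seq X) : incl s u -> incl t u -> incl (s ++ t) u.
Proof. by move=> su tu x /In_cat [/su|/tu]. Qed.

Lemma incl_cat2 (X : Type) (s s' t t' : seq X) :
  incl s s' -> incl t t' -> incl (s ++ t) (s' ++ t').
Proof.
move=> ss tt; apply: incl_cat => x xs; apply/In_cat; [left|right]; auto.
Qed.

Lemma incl0 (X : Type) (s : seq X) : incl [::] s. Proof. by []. Qed.

Lemma map_idIn (X : Type) (f : X -> X) s :
  map f s = s <-> forall x, List.In x s -> f x = x.
Proof.
elim: s => [|x s IH] //=; split=> [[fx /IH fs] y [<-|]//|fs]; first exact: fs.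
by rewrite fs; [congr (_ :: _); apply/IH => y ys; apply: fs; right|left].
Qed.

Lemma eq_mapIn (X Y : Type) (f g : X -> Y) s :
  (forall x, List.In x s -> f x = g x) -> map f s = map g s.
Proof.
elim: s => //= x s IH fg; rewrite fg ?IH//; first by move=> y ys; apply: fg; right.
by left.
Qed.

(** The newest element is the head, so that sequences grow by [cons]; chains and generic sequences
    below follow the same convention. *)
Fixpoint prefix_of (X : Type) (u : nat -> X) (k : nat) : seq X :=
  if k is k'.+1 then u k' :: prefix_of u k' else [::].

Lemma size_prefix_of (X : Type) (u : nat -> X) k : size (prefix_of u k) = k.
Proof. by elim: k => //= k ->. Qed.

Lemma In_prefix_of (X : Type) (u : nat -> X) k x :
  List.In x (prefix_of u k) <-> exists2 i, i < k & u i = x.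
Proof.
elim: k => [|k IH] /=; first by split => // -[].
rewrite IH; split=> [[<-|[i ik <-]]|[i]].
- by exists k.
- by exists i => //; apply: ltnW.
- rewrite ltnS leq_eqVlt => /orP[/eqP->|ik] <-; first by left.
  by right; exists i.
Qed.

(** Dependent choice with the whole history at hand: [P] is the invariant of the finite stages and
    [Q] constrains the next element in terms of all earlier ones. *)
Lemma build_sequence (X : Type) (P : seq X -> Prop) (Q : seq X -> X -> Prop) :
  P [::] -> (forall l, P l -> exists x, P (x :: l) /\ Q l x) ->
  exists u : nat -> X,
    forall k, P (prefix_of u k) /\ Q (prefix_of u k) (u k).
Proof.
move=> P0 PS.
have [f fP] : {f : {l | P l} -> X & forall l : {l | P l}, P (f l :: sval l) /\ Q (sval l) (f l)}.
  by apply: (choice (P := fun l : {l | P l} => fun x => P (x :: sval l) /\ Q (sval l) x)) => -[l Pl]; exact: PS.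
pose step (l : {l | P l}) : {l | P l} := exist _ (f l :: sval l) (fP l).1.
pose st k := iter k step (exist _ [::] P0).
exists (fun k => f (st k)) => k.
have -> : prefix_of (fun k => f (st k)) k = sval (st k) by elim: k => //= k ->.
by split; [exact: svalP|exact: (fP _).2].
Qed.

Lemma finite_setIn (X : Type) (A : set X) : finite_set A ->
  exists l : seq X, forall x, A x -> List.In x l.
Proof.
elim/Pchoice: X A => X A /finite_seqP [l ->]; exists l => x /=.
elim: l => //= y l IH; rewrite inE => /orP[/eqP->|/IH]; tauto.
Qed.

Lemma pigeonhole (X Y : Type) (R : X -> Y -> Prop) (l : seq Y) (u : nat -> X) :
  (forall n, exists2 y, List.In y l & R (u n) y) ->
  exists m n y, [/\ m < n, R (u m) y & R (u n) y].
Proof.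
move=> H.
suff [m [n [y [y' [mn [<-]]]]]] : exists m n y y', m < n /\ y = y' /\ R (u m) y /\ R (u n) y'.
  by move=> [? ?]; exists m, n, y.
elim: l u H => [|y l IH] u H; first by have [] := H 0.
have [[N hN]|hN] := pselect (exists N, forall n, N <= n -> ~ R (u n) y).
  have [n|m [n [z [z' [mn [zz [Rm Rn]]]]]]] := IH (fun n => u (N + n)).
    have [z [<-|zl] Rz] := H (N + n); last by exists z.
    by have := hN (N + n) (leq_addr _ _).
  by exists (N + m), (N + n), z, z'; rewrite ltn_add2l.
have big N : exists2 n, N <= n & R (u n) y.
  apply: contrapT => hn; apply: hN; exists N => n Nn Rn; apply: hn.
  by exists n.
have [m _ Rm] := big 0; have [n mn Rn] := big m.+1.
by exists m, n, y, y.
Qed.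

Fixpoint lenv (X : Type) (s : seq X) : fin (size s) -> X :=
  match s return fin (size s) -> X with
  | [::] => env0
  | x :: s' => scons x (@lenv X s')
  end.
Arguments lenv {X} s _.

Lemma lenv_In (X : Type) (s : seq X) i : List.In (lenv s i) s.
Proof. by elim: s i => [[]|x s IH [i|]] /=; [right|left]. Qed.

Lemma In_lenv (X : Type) (s : seq X) x : List.In x s -> exists i, lenv s i = x.
Proof.
elim: s => //= y s IH [<-|/IH[i <-]]; first by exists None.
by exists (Some i).
Qed.

Fixpoint fin_enum n : seq (fin n) :=
  match n return seq (fin n) with
  | 0 => [::]
  | m.+1 => None :: map Some (fin_enum m)
  end.

Lemma fin_enumP n (i : fin n) : List.In i (fin_enum n).
Proof. by elim: n i => [[]|n IH [i|]] /=; [right; apply/In_map; exists i|left]. Qed.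

Lemma mem_In (X : eqType) (x : X) s : x \in s <-> List.In x s.
Proof.
by elim: s => //= y s <-; rewrite inE; split=> [/orP[/eqP->|]|[->|->]]; rewrite ?eqxx ?orbT; auto.
Qed.

Lemma prefix_of_drop (X : Type) (u : nat -> X) i k : i <= k ->
  drop (k - i) (prefix_of u k) = prefix_of u i.
Proof.
elim: k => [|k IH]; first by rewrite leqn0 => /eqP->.
rewrite leq_eqVlt => /orP[/eqP->|]; first by rewrite subnn drop0.
by rewrite ltnS => ik; rewrite subSn//= IH.
Qed.

Lemma nth_prefix_of (X : Type) (x0 : X) (u : nat -> X) k i : i < k ->
  nth x0 (prefix_of u k) (k - i.+1) = u i.
Proof.
elim: k => // k IH; rewrite ltnS leq_eqVlt => /orP[/eqP->|ik]; first by rewrite subnn.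
by rewrite subSS -(subnSK ik) /= IH.
Qed.

Lemma cat_inj (X : Type) (a b c d : seq X) : a ++ c = b ++ d -> size a = size b ->
  a = b /\ c = d.
Proof.
by elim: a b => [|x a IH] [|y b] //= [-> /IH H] [/H[-> ->]].
Qed.

Lemma injective_unbounded (f : nat -> nat) i : injective f -> exists m, i <= f m.
Proof.
move=> fi; apply: contrapT => H.
have sub : {subset map f (iota 0 i.+1) <= iota 0 i}.
  move=> _ /mapP[m _ ->]; rewrite mem_iota add0n /= ltnNge.
  by apply/negP => im; apply: H; exists m.
have un : uniq (map f (iota 0 i.+1)) by rewrite (map_inj_uniq fi) iota_uniq.
by have := uniq_leq_size un sub; rewrite size_map !size_iota ltnn.
Qed.

(** * Syntax and semantics *)

Section Logic.
Variable L : language.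
Implicit Types M N : structure L.

Lemma teval_tsubst M n m (s : fin n -> term L m) (e : fin m -> M) t :
  teval e (tsubst s t) = teval (fun i => teval e (s i)) t.
Proof. by elim: t => //= f ts IH; congr finterp; apply/funext. Qed.

Lemma teval_up M n m (s : fin n -> term L m) (e : fin m -> M) a :
  (fun i => teval (scons a e) (up s i)) = scons a (fun i => teval e (s i)).
Proof.
by apply/funext => -[i|] //=; rewrite teval_tsubst.
Qed.

Lemma sat_fsubst M n (phi : form L n) :
  forall m (s : fin n -> term L m) (e : fin m -> M),
  sat (fsubst phi s) e <-> sat phi (fun i => teval e (s i)).
Proof.
elim: n / phi => [n t u|n r ts|n phi IH|n phi IH psi IH'|n phi IH] m s e /=.
- by rewrite !teval_tsubst.
- suff -> : (fun j => teval e (tsubst s (ts j))) =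
    (fun j => teval (fun i => teval e (s i)) (ts j)) by [].
  by apply/funext => j; rewrite teval_tsubst.
- by rewrite IH.
- by rewrite IH IH'.
- by split=> -[a]; [rewrite IH teval_up|rewrite -teval_up -IH] => ?; exists a.
Qed.

Lemma isat_isubst M n (phi : iform L n) :
  forall m (s : fin n -> term L m) (e : fin m -> M),
  isat (isubst phi s) e <-> isat phi (fun i => teval e (s i)).
Proof.
elim: n / phi => [n t u|n r ts|n phi IH|n phi IH psi IH'|n phi IH|n J cJ F IH] m s e /=.
- by rewrite !teval_tsubst.
- suff -> : (fun j => teval e (tsubst s (ts j))) =
    (fun j => teval (fun i => teval e (s i)) (ts j)) by [].
  by apply/funext => j; rewrite teval_tsubst.
- by rewrite IH.
- by rewrite IH IH'.
- by split=> -[a]; [rewrite IH teval_up|rewrite -teval_up -IH] => ?; exists a.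
- by split=> H i; apply/IH.
Qed.

Definition fren n m (r : fin n -> fin m) (phi : form L n) : form L m :=
  fsubst phi (fun i => Var (r i)).

Lemma sat_fren M n m (r : fin n -> fin m) (phi : form L n) (e : fin m -> M) :
  sat (fren r phi) e <-> sat phi (e \o r).
Proof. exact: sat_fsubst. Qed.

Lemma isat_fo M n (phi : form L n) (e : fin n -> M) : isat (fo phi) e <-> sat phi e.
Proof.
elim: n / phi e => [//|//|n phi IH|n phi IH psi IH'|n phi IH] e /=.
- by rewrite IH.
- by rewrite IH IH'.
- by split=> -[a H]; exists a; move: H; rewrite IH.
Qed.

Lemma teval_iso M N (h : M -> N) n (e : fin n -> M) t :
  isomorphism h -> h (teval e t) = teval (h \o e) t.
Proof.
move=> [_ hf _]; elim: t => //= f ts IH; rewrite hf; congr finterp.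
by apply/funext.
Qed.

Lemma comp_scons (X Y : Type) (h : X -> Y) n a (e : fin n -> X) :
  h \o scons a e = scons (h a) (h \o e).
Proof. by apply/funext => -[]. Qed.

Lemma sat_iso M N (h : M -> N) n (phi : form L n) (e : fin n -> M) :
  isomorphism h -> sat phi e <-> sat phi (h \o e).
Proof.
move=> iso; have [bij _ hr] := iso; have [g hK gK] := bij.
elim: n / phi e => [n t u|n r ts|n phi IH|n phi IH psi IH'|n phi IH] e /=.
- by rewrite -!teval_iso//; split=> [->//|/(bij_inj bij)].
- rewrite hr; suff -> : h \o (fun j => teval e (ts j)) =
    (fun j => teval (h \o e) (ts j)) by [].
  by apply/funext => j /=; rewrite teval_iso.
- by rewrite IH.
- by rewrite IH IH'.
- split=> -[a]; first by rewrite IH comp_scons; exists (h a).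
  by move=> ?; exists (g a); rewrite IH comp_scons gK.
Qed.

Lemma isomorphism_id M : isomorphism (@id M).
Proof. by split=> //; exists id. Qed.

Lemma isomorphism_comp M N (P : structure L) (h : M -> N) (k : N -> P) :
  isomorphism h -> isomorphism k -> isomorphism (k \o h).
Proof.
move=> [bh hf hr] [bk kf kr]; split; first exact: bij_comp.
- by move=> f a /=; rewrite hf kf.
- by move=> r a; rewrite hr kr.
Qed.

Lemma isomorphism_inv M N (h : M -> N) : isomorphism h ->
  exists k : N -> M, [/\ isomorphism k, cancel h k & cancel k h].
Proof.
move=> [bh hf hr]; have [k hK kK] := bh; exists k.
have hkE n (a : fin n -> N) : h \o (k \o a) = a by apply/funext => i /=.
split=> //; split; first by exists h.
- by move=> f a; rewrite -{1}[a]hkE -hf hK.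
- by move=> r a; rewrite hr hkE.
Qed.

Definition type_of M n (e : fin n -> M) : set (form L n) := [set phi | sat phi e].

Definition same_type M N n (e : fin n -> M) (e' : fin n -> N) : Prop :=
  forall phi : form L n, sat phi e <-> sat phi e'.

Lemma same_typeP M N n (e : fin n -> M) (e' : fin n -> N) :
  same_type e e' <-> type_of e = type_of e'.
Proof.
split=> [H|H phi]; first by apply/seteqP; split=> phi /H.
by change (type_of e phi <-> type_of e' phi); rewrite H.
Qed.

Lemma same_type_le M N n (e : fin n -> M) (e' : fin n -> N) :
  (forall phi : form L n, sat phi e -> sat phi e') -> same_type e e'.
Proof.
move=> H phi; split; first exact: H.
by move=> s'; apply: contrapT => /(H (Not phi)).
Qed.

End Logic.

(** * Automorphisms and definable sets *)

Section Automorphisms.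
Variables (L : language) (C : structure L).
Implicit Types (s t : seq C) (D : set C).

Definition fixes s (f : C -> C) : Prop := forall x, List.In x s -> f x = x.

(** Orbits stand for types throughout: by homogeneity, [orb s x y] in the monster model means that
    [x] and [y] have the same type over [s]. *)
Definition orb s (x y : C) : Prop :=
  exists f : C -> C, [/\ isomorphism f, fixes s f & f x = y].

Lemma orb_refl s x : orb s x x.
Proof. by exists id; split => //; exact: isomorphism_id. Qed.

Lemma fixes_inv s f g : fixes s f -> cancel f g -> fixes s g.
Proof. by move=> fs fK x /fs {1}<-; rewrite fK. Qed.

Lemma orb_sym s x y : orb s x y -> orb s y x.
Proof.
move=> [f [/isomorphism_inv[g [ig fK gK]] fs <-]].
by exists g; split; [|exact: fixes_inv fs fK|rewrite fK].
Qed.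

Lemma fixes_comp s f g : fixes s f -> fixes s g -> fixes s (g \o f).
Proof. by move=> fs gs x xs /=; rewrite fs// gs. Qed.

Lemma orb_trans s y x z : orb s x y -> orb s y z -> orb s x z.
Proof.
move=> [f [fi fs <-]] [g [gi gs <-]]; exists (g \o f); split => //.
  exact: isomorphism_comp.
exact: fixes_comp.
Qed.

Lemma fixes_incl s t f : incl s t -> fixes t f -> fixes s f.
Proof. by move=> st ft x /st /ft. Qed.

Lemma orb_incl s t x y : incl s t -> orb t x y -> orb s x y.
Proof. by move=> st [f [fi ft fx]]; exists f; split => //; exact: fixes_incl ft. Qed.

Lemma orb0 s x y : orb s x y -> orb [::] x y.
Proof. exact/orb_incl/incl0. Qed.

Lemma orb_image f s x y : isomorphism f -> orb s x y -> orb (map f s) (f x) (f y).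
Proof.
move=> fi; have [g [gi fK gK]] := isomorphism_inv fi.
move=> [h [hi hs <-]]; exists (f \o (h \o g)); split.
- by apply: isomorphism_comp => //; exact: isomorphism_comp.
- by move=> _ /In_map[z zs <-] /=; rewrite fK hs.
- by rewrite /= fK.
Qed.

Lemma fixes_orb s f x : isomorphism f -> fixes s f -> orb s x (f x).
Proof. by move=> fi fs; exists f. Qed.

Lemma orb_In s x y : List.In x s -> orb s x y -> x = y.
Proof. by move=> xs [f [_ /(_ _ xs) -> ->]]. Qed.

Definition definable_over s D : Prop :=
  exists phi : form L (size s).+1, forall x, D x <-> sat phi (scons x (lenv s)).

Definition definable2_over s (R : C -> C -> Prop) : Prop :=
  exists phi : form L (size s).+2,
    forall x y, R x y <-> sat phi (scons x (scons y (lenv s))).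

Lemma eq_definable s D D' :
  (forall x, D x <-> D' x) -> definable_over s D -> definable_over s D'.
Proof. by move=> DD [phi Dphi]; exists phi => x; rewrite -DD. Qed.

Lemma definable_true s : definable_over s (fun _ => True).
Proof. by exists (Eq (Var (None : fin (size s).+1)) (Var (None : fin (size s).+1))). Qed.

Lemma definable_not s D : definable_over s D -> definable_over s (fun x => ~ D x).
Proof. by move=> [phi Dphi]; exists (Not phi) => x; rewrite Dphi. Qed.

Lemma definable_and s D D' : definable_over s D -> definable_over s D' ->
  definable_over s (fun x => D x /\ D' x).
Proof.
by move=> [phi Dphi] [psi Dpsi]; exists (And phi psi) => x; rewrite Dphi Dpsi.
Qed.

Lemma definable2_not s R :
  definable2_over s R -> definable2_over s (fun x y => ~ R x y).
Proof. by move=> [phi Dphi]; exists (Not phi) => x y; rewrite Dphi. Qed.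

Lemma definable2_and s R R' : definable2_over s R -> definable2_over s R' ->
  definable2_over s (fun x y => R x y /\ R' x y).
Proof.
by move=> [phi Dphi] [psi Dpsi]; exists (And phi psi) => x y; rewrite Dphi Dpsi.
Qed.

Lemma definable_ex s R : definable2_over s R ->
  definable_over s (fun y => exists x, R x y).
Proof.
by move=> [phi Dphi]; exists (Ex phi) => y /=; split=> -[x] /Dphi; exists x.
Qed.

Definition finlift n m (r : fin n -> fin m) : fin n.+1 -> fin m.+1 :=
  fun i => if i is Some j then Some (r j) else None.

Lemma scons_finlift (X : Type) n m (r : fin n -> fin m) x (e : fin m -> X) :
  scons x e \o finlift r = scons x (e \o r).
Proof. by apply/funext => -[]. Qed.

Lemma lenv_incl s t : incl s t -> exists r : fin (size s) -> fin (size t),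
  lenv s = lenv t \o r.
Proof.
move=> st.
have [r rP] : {r : fin (size s) -> fin (size t) & forall i, lenv t (r i) = lenv s i}.
  apply: (choice (P := fun i j => lenv t j = lenv s i)) => i.
  by apply: In_lenv; apply: st; exact: lenv_In.
by exists r; apply/funext => i /=; rewrite rP.
Qed.

Lemma definable_incl s t D : incl s t -> definable_over s D -> definable_over t D.
Proof.
move=> /lenv_incl[r rE] [phi Dphi]; exists (fren (finlift r) phi) => x.
by rewrite sat_fren scons_finlift -rE.
Qed.

Lemma definable2_incl s t R : incl s t -> definable2_over s R -> definable2_over t R.
Proof.
move=> /lenv_incl[r rE] [phi Dphi]; exists (fren (finlift (finlift r)) phi) => x y.
by rewrite sat_fren !scons_finlift -rE.
Qed.

Lemma definable2_sec s R y :
  definable2_over s R -> definable_over (y :: s) (R ^~ y).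
Proof. by move=> [phi Dphi]; exists phi => x; rewrite Dphi. Qed.

Lemma definable_cons s y D : definable_over (y :: s) D ->
  exists2 R, definable2_over s R & forall x, D x <-> R x y.
Proof.
move=> [phi Dphi].
by exists (fun x y => sat (M := C) phi (scons x (scons y (lenv s)))); first exists phi.
Qed.

Lemma definable2_swap s R : definable2_over s R -> definable2_over s (fun x y => R y x).
Proof.
move=> [phi Dphi].
pose r (i : fin (size s).+2) : fin (size s).+2 :=
  match i with None => Some None | Some None => None | Some (Some i) => Some (Some i) end.
exists (fren r phi) => x y; rewrite sat_fren Dphi.
suff -> : scons x (scons y (lenv s)) \o r = scons y (scons x (lenv s)) by [].
by apply/funext => -[[]|].
Qed.

Lemma definable2_right s D : definable_over s D -> definable2_over s (fun _ y => D y).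
Proof.
move=> [phi Dphi]; pose r (i : fin (size s).+1) : fin (size s).+2 := Some i.
exists (fren r phi) => x y; rewrite sat_fren Dphi.
by suff -> : scons x (scons y (lenv s)) \o r = scons y (lenv s) by [].
Qed.

Lemma definable2_left s D : definable_over s D -> definable2_over s (fun x _ => D x).
Proof. by move=> /definable2_right /definable2_swap. Qed.

Lemma definable_eq s (a : C) : List.In a s -> definable_over s (fun x => x = a).
Proof.
move=> sa; have [i ia] := In_lenv sa.
exists (Eq (Var (None : fin (size s).+1)) (Var (Some i : fin (size s).+1))).
by move=> x /=; rewrite ia.
Qed.

Lemma definable2_form s (phi : form L 2) :
  definable2_over s (fun x y => sat phi (env2 x y)).
Proof.
pose r (i : fin 2) : fin (size s).+2 := if i is Some _ then Some None else None.
exists (fren r phi) => x y; rewrite sat_fren.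
suff -> : scons x (scons y (lenv s)) \o r = env2 x y by [].
by apply/funext => -[[]|].
Qed.

Lemma definable2_fixr s R a : List.In a s -> definable2_over s R ->
  definable_over s (fun x => R x a).
Proof.
move=> as_ Rs; apply: (@definable_incl (a :: s)); last exact: definable2_sec.
exact: incl_consl.
Qed.

Lemma definable2_fixl s R a : List.In a s -> definable2_over s R ->
  definable_over s (R a).
Proof. by move=> as_ /definable2_swap; exact: definable2_fixr. Qed.

Lemma definable_fixes s D f x : definable_over s D -> isomorphism f -> fixes s f ->
  D x <-> D (f x).
Proof.
move=> [phi Dphi] fi fs; rewrite !Dphi (sat_iso _ _ fi) comp_scons.
suff -> : f \o lenv s = lenv s by [].
by apply/funext => i; exact: (fs _ (lenv_In i)).
Qed.

Lemma definable_orb s D x y : definable_over s D -> orb s x y -> D x <-> D y.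
Proof. by move=> Ds [f [fi fs <-]]; exact: (definable_fixes _ Ds fi fs). Qed.

Lemma definable2_fixes s R f x y : definable2_over s R -> isomorphism f -> fixes s f ->
  R x y <-> R (f x) (f y).
Proof.
move=> [phi Dphi] fi fs; rewrite !Dphi (sat_iso _ _ fi) !comp_scons.
suff -> : f \o lenv s = lenv s by [].
by apply/funext => i; exact: (fs _ (lenv_In i)).
Qed.

Lemma definable_par s D : definable_over s D -> par_definable D.
Proof.
move=> [phi Dphi]; exists (PForm phi (lenv s)).
by apply/seteqP; split=> x; rewrite /psat /=; move/Dphi.
Qed.

End Automorphisms.

(** * Saturation and homogeneity of the monster model *)

Section Monster.
Variables (L : language) (T : theory L) (C : structure L).
Hypothesis HC : monster_model T C.
Hypothesis Hcat : almost_aleph0_categorical T.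
Implicit Types (s t : seq C) (D : set C).

Local Notation orb := (@orb L C).

Lemma monster_theory : model T C. Proof. by case: HC. Qed.

Lemma countable_card_lt (K : Type) (A : set C) :
  ~ countable [set: K] -> countable A -> card_lt A [set: K].
Proof.
move=> ncK cA; split; last by move=> /sub_countable /(_ cA).
apply: card_le_trans cA _; apply/infiniteP => /finite_set_countable; exact: ncK.
Qed.

Lemma finite_In s : finite_set [set x | List.In x s].
Proof.
elim: s => [|x s IH]; first by rewrite (_ : mkset _ = set0)//; apply/seteqP; split.
rewrite (_ : mkset _ = [set x] `|` [set x | List.In x s]).
  by rewrite finite_setU; split.
by apply/seteqP; split=> y /= [->|]; [left|right|left|right].
Qed.

(** Compactness over a finite set of parameters, for families of definable sets rather than of
    formulas. *)
Lemma saturation s (F : set (set C)) :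
  (forall D, F D -> definable_over s D) ->
  (forall l : seq (set C), (forall D, List.In D l -> F D) ->
     exists x, forall D, List.In D l -> D x) ->
  exists x, forall D, F D -> D x.
Proof.
have [_ [K [ncK satK _]]] := HC => Fs Fl.
pose Q D (phi : form L (size s).+1) := forall x, D x <-> sat phi (scons x (lenv s)).
pose p : set (pform C) := [set f | exists D phi, [/\ F D, Q D phi & f = PForm phi (lenv s)]].
have [||q fq qp|x xp] := satK [set x | List.In x s] _ p.
- exact/(countable_card_lt ncK)/finite_set_countable/finite_In.
- by move=> _ [D [phi [_ _ ->]]] i; exact: lenv_In.
- have [l ql] := finite_setIn fq.
  have [lD [lDF lDP]] : exists lD : seq (set C), (forall D, List.In D lD -> F D) /\
      (forall f, List.In f l -> p f -> exists2 D, List.In D lD & forall x, D x -> psat f x).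
    elim: l {ql} => [|f l [lD [H1 H2]]]; first by exists [::].
    have [[D [phi [FD DQ fE]]]|npf] := pselect (p f).
      exists (D :: lD); split=> [D' [<-//|/H1//]|f' [<- _|/H2 fl /fl[D' D'l D'f]]].
        by exists D; [left|move=> x /DQ; rewrite fE].
      by exists D' => //; right.
    by exists lD; split => // f' [<-//|]; exact: H2.
  have [c cP] := Fl lD lDF; exists c => f qf.
  by have [D DlD Df] := lDP f (ql _ qf) (qp _ qf); apply: Df; exact: cP.
- exists x => D FD; have [phi Dphi] := Fs _ FD.
  by apply/Dphi; apply: (xp (PForm phi (lenv s))); exists D, phi.
Qed.

Lemma homogeneity n (e e' : fin n -> C) : same_type e e' ->
  exists2 f : C -> C, isomorphism f & forall i, f (e i) = e' i.
Proof.
move=> ee'; have [_ [K [ncK _ hom]]] := HC.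
have eqe i j : e i = e j -> e' i = e' j.
  by move=> eij; apply/(ee' (Eq (Var i) (Var j))).
pose A : set C := [set x | exists i, e i = x].
have [f fP] : {f : C -> C & forall x, forall i, e i = x -> f x = e' i}.
  apply: (choice (P := fun x y => forall i, e i = x -> y = e' i)) => x.
  have [[i <-]|nx] := pselect (A x); last by exists x => i ix; case: nx; exists i.
  by exists (e' i) => j /eqe.
have cA : countable A.
  rewrite (_ : A = [set x | List.In x (map e (fin_enum n))]).
    by apply: finite_set_countable; exact: finite_In.
  apply/seteqP; split=> x /=; last by move=> /In_map[i _ <-]; exists i.
  by move=> [i <-]; apply/In_map; exists i => //; exact: fin_enumP.
have [|g gi gP] := hom A (countable_card_lt ncK cA) f.
  move=> m phi a aA; have [r rP] : {r : fin m -> fin n & forall i, e (r i) = a i}.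
    exact: (choice (P := fun i j => e j = a i)).
  have -> : a = e \o r by apply/funext => i /=; rewrite rP.
  have -> : f \o (e \o r) = e' \o r by apply/funext => i /=; exact: fP.
  by rewrite -(sat_fren r phi e) -(sat_fren r phi e'); exact: ee'.
by exists g => // i; rewrite gP; [exact: fP|exists i].
Qed.

Lemma separation s x y : ~ orb s x y -> exists D, [/\ definable_over s D, D x & ~ D y].
Proof.
move=> nxy; apply: contrapT => nD; apply: nxy.
have [phi|f fi fP] := @homogeneity _ (scons x (lenv s)) (scons y (lenv s)).
  have [H|H] := pselect (sat phi (scons x (lenv s))); last first.
    split=> // H'; case: nD; exists (fun z => ~ sat phi (scons z (lenv s))).
    by split; [exists (Not phi)| |move=> /(_ H')].
  split=> // _; apply: contrapT => H'; case: nD.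
  by exists (fun z => sat phi (scons z (lenv s))); split; [exists phi| |].
exists f; split=> //; last exact: (fP None).
by move=> z zs; have [i <-] := In_lenv zs; exact: (fP (Some i)).
Qed.

(** [eext e s] prepends the elements of [s] to the tuple [e]. Its length is computed by recursion on
    [s], so that [scons] types without casts. *)
Fixpoint exts n s : nat := if s is _ :: s' then (exts n s').+1 else n.

Fixpoint eext n (e : fin n -> C) s : fin (exts n s) -> C :=
  match s return fin (exts n s) -> C with
  | [::] => e
  | x :: s' => scons x (@eext n e s')
  end.
Arguments eext {n} e s _.

Lemma eext_old n s : exists r : fin n -> fin (exts n s),
  forall (e : fin n -> C) i, eext e s (r i) = e i.
Proof.
elim: s => [|x s [r rP]] /=; first by exists id.
by exists (fun i => Some (r i)).
Qed.

Lemma eext_new n s x : List.In x s ->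
  exists j, forall e : fin n -> C, eext e s j = x.
Proof.
elim: s => //= y s IH [->|/IH[j jP]]; first by exists None.
by exists (Some j).
Qed.

Lemma orb_eext n (e e' : fin n -> C) s : (forall i, orb [::] (e i) (e' i)) ->
  forall i, orb [::] (eext e s i) (eext e' s i).
Proof. by move=> ee; elim: s => [|x s IH] //= -[i|] //=; exact: orb_refl. Qed.

(** Almost aleph_0-categoricity in terms of orbits. Applied to [e] extended by [s], it leaves
    finitely many completions of the 1-types of the coordinates, and by homogeneity a completion
    determines the tuple up to automorphisms fixing [s]. *)
Lemma finite_orbits_tuple n (e : fin n -> C) s :
  exists l : seq (fin n -> C), forall e', (forall i, orb [::] (e i) (e' i)) ->
    exists t : fin n -> C, [/\ List.In t l, forall i, orb [::] (e i) (t i)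
      & exists f, [/\ isomorphism f, fixes s f & forall i, f (e' i) = t i]].
Proof.
pose m := exts n s.
pose p (i : fin m) := type_of (env1 (eext e s i)).
have pT i : types T 1 (p i).
  split; first by exists C, (env1 (eext e s i)); split => //; exact: monster_theory.
  by move=> phi; exact: EM.
have [lq lqP] := finite_setIn (Hcat pT).
pose good (e' : fin n -> C) := forall i, orb [::] (e i) (e' i).
have goodP e' : good e' -> List.In (type_of (eext e' s)) lq.
  move=> ge; apply: lqP; split.
    split; first by exists C, (eext e' s); split => //; exact: monster_theory.
    by move=> phi; exact: EM.
  move=> _ [i [phi [piphi ->]]]; apply/sat_fsubst.
  have [f [fi _ fx]] := orb_eext (s := s) ge i; move: piphi; rewrite /p /type_of /= (sat_iso _ _ fi).
  by congr (sat phi _); apply/funext => j /=; rewrite -fx.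
have [l lP] : exists l : seq (fin n -> C), forall e', good e' ->
    List.In (type_of (eext e' s)) lq ->
    exists t : fin n -> C, [/\ List.In t l, good t & type_of (eext e' s) = type_of (eext t s)].
  elim: lq {lqP goodP} => [|q lq [l lP]]; first by exists [::].
  have [[t [gt tq]]|nt] := pselect (exists t : fin n -> C, good t /\ type_of (eext t s) = q).
    exists (t :: l) => e' ge [qe|/(lP _ ge)[t' [tl gt' tt']]].
      by exists t; split => //; [left|rewrite tq -qe].
    by exists t'; split => //; right.
  exists l => e' ge [qe|/(lP _ ge)//].
  by case: nt; exists e'.
exists l => e' ge; have [t [tl gt tt]] := lP _ ge (goodP _ ge).
exists t; split => //; have [f fi fP] := homogeneity (iffRL (same_typeP _ _) tt).
exists f; split=> // [x|i].
  by move=> /(@eext_new n)[j jP]; have := fP j; rewrite !jP.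
by have [r rP] := eext_old n s; have := fP (r i); rewrite !rP.
Qed.

Lemma finite_orbits s y : exists l : seq C, forall z, orb [::] y z ->
  exists2 t, List.In t l & orb s z t.
Proof.
have [l lP] := finite_orbits_tuple (env1 y) s.
exists (map (fun e : fin 1 -> C => e None) l) => z yz.
have [|t [tl _ [f [fi fs fz]]]] := lP (env1 z); first by [].
exists (t None); first by apply/In_map; exists t.
by exists f; split => //; exact: (fz None).
Qed.

(** The 1-type of [y] splits into finitely many orbits over [s], and finitely many formulas separate
    the orbit of [y] from the others. *)
Lemma relatively_definable s y :
  exists2 D, definable_over s D & forall z, orb [::] y z -> D z <-> orb s y z.
Proof.
have [l lP] := finite_orbits s y.
suff [D Ds [Dy DlP]] : exists2 D, definable_over s D &
    D y /\ forall z, List.In z l -> D z -> orb s y z.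
  exists D => // z yz; split=> [Dz|H]; last exact/(definable_orb Ds H).
  have [t tl zt] := lP z yz.
  by apply: orb_trans (orb_sym zt); apply: DlP => //; exact/(definable_orb Ds zt).
elim: l {lP} => [|t l [D Ds [Dy DP]]].
  by exists (fun _ => True); first exact: definable_true.
have [yt|nyt] := pselect (orb s y t).
  by exists D => //; split=> // t' [<-|/DP].
have [D' [Ds' Dy' Dt']] := separation nyt.
exists (fun x => D x /\ D' x); first exact: definable_and.
by split=> // t' [<- [_ /Dt']//|t'l [Dt _]]; exact: DP.
Qed.

(** By compactness, some formula of the type of [v] over [s] ensures that every [w] satisfying it
    defines [O] in the way [v] does; quantifying over such [w] removes the parameter. *)
Lemma definable_descent s v (O : set C) : definable_over (v :: s) O ->
  (forall x y, orb s x y -> O x -> O y) -> definable_over s O.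
Proof.
move=> Ov Oinv; have [R Rs RP] := definable_cons Ov.
pose bad w := exists x, ~ (R x w <-> O x).
have badv : definable_over (v :: s) bad.
  apply: definable_ex; have H1 := definable2_incl (@incl_cons _ v s) Rs.
  have H2 : definable2_over (v :: s) (fun x _ => O x) := definable2_left Ov.
  have H := definable2_and (definable2_not (definable2_and H1 (definable2_not H2)))
    (definable2_not (definable2_and (definable2_not H1) H2)).
  have [phi phiP] := definable2_not H; exists phi => x y; rewrite -phiP.
  by have [a|a] := pselect (R x y); have [b|b] := pselect (O x); tauto.
pose F : set (set C) := [set D | D = bad \/ (definable_over s D /\ D v)].
have [[w wF]|nF] := pselect (exists w, forall D, F D -> D w).
  have /= [x] := wF bad (or_introl erefl); case.
  (* A bad [w] with the type of [v] over [s] is impossible: an automorphism over [s] moving [v] to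
     [w] preserves [O]. *)
  have [f [fi fs fv]] : orb s v w.
    apply: contrapT => /separation[D [Ds Dv]]; apply; apply: wF; by right.
  have [g [gi fK gK]] := isomorphism_inv fi.
  rewrite -fv -[x]gK -(definable2_fixes _ _ Rs fi fs) -RP.
  split; apply: Oinv; first exact: fixes_orb.
  exact/orb_sym/fixes_orb.
have [l lF lP] : exists2 l : seq (set C), (forall D, List.In D l -> F D) &
    forall x, ~ forall D, List.In D l -> D x.
  apply: contrapT => H; apply: nF; apply: (@saturation (v :: s)).
    by move=> D [->//|[Ds _]]; apply: definable_incl Ds; exact: incl_cons.
  move=> l lF; apply: contrapT => H'; apply: H; exists l => // x xP.
  by apply: H'; exists x.
have [D0 [Ds0 D0v] D0P] : exists2 D0, definable_over s D0 /\ D0 v &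
    forall w, D0 w -> ~ bad w.
  have [D0 [Ds0 D0v] D0P] : exists2 D0, definable_over s D0 /\ D0 v &
      forall w, D0 w -> bad w -> forall D, List.In D l -> D w.
    elim: l lF {lP} => [|D l IH] lF.
      by exists (fun _ => True) => //; split=> //; exact: definable_true.
    have [|D0 [Ds0 D0v] D0P] := IH; first by move=> E El; apply: lF; right.
    have [->|[Ds Dv]] := lF D (or_introl erefl).
      by exists D0 => // w Dw bw E [<-//|]; exact: D0P.
    exists (fun w => D0 w /\ D w); first by split => //; exact: definable_and.
    by move=> w [D0w Dw] bw E [<-//|]; exact: D0P.
  exists D0 => // w D0w bw; exact: (lP w (D0P w D0w bw)).
have : definable_over s (fun x => exists w, D0 w /\ R x w).
  apply: (@definable_ex _ _ s (fun w x => D0 w /\ R x w)).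
  apply: definable2_and; first exact: definable2_left.
  exact: definable2_swap.
apply: eq_definable => x; split=> [[w [/D0P nb Rw]]|Ox].
  by have [H|nR] := pselect (R x w <-> O x); [apply/H|case: nb; exists x].
by exists v; rewrite -RP.
Qed.

End Monster.

(** * Linear orders with convex orbits *)

Lemma strict_linear_order_flip (X : Type) (r : X -> X -> Prop) :
  strict_linear_order r -> strict_linear_order (fun x y => r y x).
Proof.
move=> [rI rT rC]; split=> // [x y z|x y].
  by move=> yx zy; exact: rT yx.
by case: (rC x y); [constructor 3|constructor 2|constructor 1].
Qed.

Section OrderedOrbits.
Variables (L : language) (C : structure L).
Implicit Types (s t : seq C).

Local Notation orb := (@orb L C).

Definition convex_orbits (r : C -> C -> Prop) : Prop :=
  forall s x y z, orb s x z -> orb [::] x y -> r x y -> r y z -> orb s x y.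

Definition invariant_order (r : C -> C -> Prop) : Prop :=
  forall f x y, isomorphism f -> r x y -> r (f x) (f y).

Lemma convex_orbits_flip r :
  convex_orbits r -> convex_orbits (fun x y => r y x).
Proof.
move=> rc s x y z xz xy ryx rzy; apply: orb_trans (xz) _.
apply: rc (orb_sym xz) _ rzy ryx; exact: orb_trans (orb0 (orb_sym xz)) xy.
Qed.

(** The orbit of [w] over [s] is the last one in its 1-type; with the flipped order it is the first
    one. *)
Definition cofinal_orbit (r : C -> C -> Prop) s w : Prop :=
  forall v, orb [::] w v -> exists2 w', orb s w w' & ~ r w' v.

Section Order.
Variable r : C -> C -> Prop.
Hypothesis rlin : strict_linear_order r.
Hypothesis rconv : convex_orbits r.

Lemma order_irr x : ~ r x x. Proof. by case: rlin. Qed.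

Lemma order_trans y x z : r x y -> r y z -> r x z.
Proof. by case: rlin => _ + _; exact. Qed.

Lemma order_total x y : [\/ r x y, x = y | r y x]. Proof. by case: rlin. Qed.

(** Some conjugate of [w] over [s] lies at or above [y], and convexity puts [y] into the orbit. *)
Lemma cofinal_final s w x y : cofinal_orbit r s w -> orb s w x ->
  orb [::] w y -> r x y -> orb s w y.
Proof.
move=> cof wx wy xy; have [z wz nzy] := cof y wy.
have [yz|->//|//] := order_total y z.
apply: orb_trans (wx) _; apply: rconv xy yz; first exact: orb_trans (orb_sym wx) wz.
exact: orb_trans (orb0 (orb_sym wx)) wy.
Qed.

Lemma cofinal_orb s w w' : cofinal_orbit r s w -> orb s w w' -> cofinal_orbit r s w'.
Proof.
move=> cof ww' v w'v; have [x wx nxv] := cof v (orb_trans (orb0 ww') w'v).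
by exists x => //; exact: orb_trans (orb_sym ww') wx.
Qed.

Lemma cofinal_unique s w w' : cofinal_orbit r s w -> cofinal_orbit r s w' ->
  orb [::] w w' -> orb s w w'.
Proof.
move=> cof cof' ww'; have [r1|->|r1] := order_total w w'.
- by apply: (cofinal_final cof (orb_refl _ _)).
- exact: orb_refl.
- apply: orb_sym; apply: (cofinal_final cof' (orb_refl _ _)) r1.
  exact: orb_sym.
Qed.

Lemma cofinal_incl s t w : incl s t -> cofinal_orbit r t w -> cofinal_orbit r s w.
Proof.
by move=> st cof v /cof[x wx nxv]; exists x => //; exact: orb_incl wx.
Qed.

End Order.

(** * Open types *)

Section Open.
Variable Mem : C -> Prop.

Definition listin s : Prop := forall x, List.In x s -> Mem x.

Lemma listin_cons x s : Mem x -> listin s -> listin (x :: s).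
Proof. by move=> Mx Ms y [<-|/Ms]. Qed.

Lemma listin_cat s t : listin s -> listin t -> listin (s ++ t).
Proof. by move=> Ms Mt y /In_cat [/Ms|/Mt]. Qed.

Definition realized s z : Prop := exists2 m, Mem m & orb s z m.

Definition open_over s y : Prop :=
  forall t, listin t -> incl s t -> forall z, orb s y z -> realized t z.

Lemma open_incl s t y : incl s t -> open_over s y -> open_over t y.
Proof.
move=> st os u Mu tu z yz; apply: os => //; first exact: incl_trans tu.
exact: orb_incl yz.
Qed.

Lemma open_orb s y z : orb s y z -> open_over s y -> open_over s z.
Proof. by move=> yz os t Mt st w zw; apply: os => //; exact: orb_trans zw. Qed.

(** This is how convexity of the 1-types enters: only extreme types over finite parts can be
    omitted. It is derived from the definability of bounded orbits in [image_convex_types]. *)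
Definition convex_types (r : C -> C -> Prop) : Prop :=
  forall y s z u v, Mem y -> listin s -> orb [::] y z -> orb [::] y u -> orb [::] y v ->
    (forall w, orb s z w -> r u w /\ r w v) -> realized s z.

Lemma convex_types_flip r : convex_types r -> convex_types (fun x y => r y x).
Proof.
move=> ct y s z u v My Ms yz yu yv H; apply: (ct y s z v u) => // w /H [] //.
Qed.

Section KeyLemma.
Variable r : C -> C -> Prop.
Hypothesis rlin : strict_linear_order r.
Hypothesis rconv : convex_orbits r.
Hypothesis rinv : invariant_order r.
Hypothesis rcvx : convex_types r.

(* The orbit of [k] over [x :: s] is bounded above by [b].  Move it by an
   automorphism so as to meet the orbit of [w]; if the image of [x] is in [Mem], as
   it may be assumed, this gives a bounded type inside the type of [w] over [t]. *)
Lemma open_realizes_cofinal s t x y k b w :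
  listin t -> incl s t -> Mem x -> Mem y -> open_over s x ->
  orb s y k -> orb s y b -> (forall k', orb (x :: s) k k' -> r k' b) ->
  orb s y w -> cofinal_orbit r t w -> realized t w.
Proof.
move=> Mt st Mx My ox yk yb kb yw cof.
(* [f] brings [k] to [w] over [s]; openness of the type of [x] then moves [f x] into [Mem] by some
   [g] fixing [t]. *)
have [f [fi fs fk]] : orb s k w := orb_trans (orb_sym yk) yw.
have [m Mm [g [gi gt gm]]] := ox t Mt st (f x) (fixes_orb _ fi fs).
have gs := fixes_incl st gt.
have gfi : isomorphism (g \o f) := isomorphism_comp fi gi.
have gfs : fixes s (g \o f) := fixes_comp fs gs.
have [h [hi hK Kh]] := isomorphism_inv gfi.
pose w' := g w.
have ww' : orb t w w' by exists g.
have bound v : orb (m :: t) w' v -> r v (g (f b)).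
  move=> w'v; rewrite -[v]Kh; apply: (rinv gfi); apply: kb.
  have -> : k = h w' by rewrite -[k]hK /= fk.
  have -> : x :: s = map h (m :: s).
    rewrite /= -gm -{1}[x]hK; congr (_ :: _).
    by rewrite (iffRL (map_idIn _ _))//; exact: fixes_inv gfs hK.
  by apply: orb_image => //; apply: orb_incl w'v; exact: incl_cons2.
have [ySt|] := pselect (orb t w y); first by exists y.
move=> nwy; have wy : orb [::] w y := orb0 (orb_sym yw).
have low v : orb t w v -> r y v.
  move=> wv; have [//|yv|vy] := order_total rlin y v.
    by case: nwy; rewrite yv.
  by case: nwy; exact: (cofinal_final rlin rconv cof wv).
have [|||||m' Mm' w'm'] := rcvx (y := y) (s := m :: t) (z := w') (u := y) (v := g (f b)) My.
- exact: listin_cons.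
- exact: orb_trans (orb_sym wy) (orb0 ww').
- exact: orb_refl.
- apply: orb_trans (orb0 yb) _; exact: (orb0 (fixes_orb b gfi gfs)).
- move=> v w'v; split; last exact: bound.
  apply: low; apply: orb_trans ww' _; apply: orb_incl w'v; exact: incl_cons.
- exists m' => //; apply: orb_trans ww' _; apply: orb_incl w'm'; exact: incl_cons.
Qed.

(** By convexity the orbit over [x :: s] of the lower one of [y] and [z] cannot pass the other one,
    which becomes the bound [b]. *)
Lemma split_bounded s x y z : orb s y z -> ~ orb (x :: s) y z ->
  exists k b, [/\ orb s y k, orb s y b & forall k', orb (x :: s) k k' -> r k' b].
Proof.
move=> yz nyz.
have aux k b : orb s k b -> ~ orb (x :: s) k b -> r k b ->
    forall k', orb (x :: s) k k' -> r k' b.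
  move=> kb nkb rkb k' kk'; have [//|E|bk'] := order_total rlin k' b.
    by case: nkb; rewrite -E.
  by case: nkb; apply: rconv kk' _ rkb bk'; exact: orb0 kb.
have [ryz|E|rzy] := order_total rlin y z.
- exists y, z; split => //; [exact: orb_refl|exact: aux].
- by case: nyz; rewrite E; exact: orb_refl.
- exists z, y; split => //; first exact: orb_refl.
  by apply: aux => //; [exact: orb_sym|move=> /orb_sym].
Qed.

End KeyLemma.

Variable r : C -> C -> Prop.
Hypothesis rlin : strict_linear_order r.
Hypothesis rconv : convex_orbits r.
Hypothesis rinv : invariant_order r.
Hypothesis rcvx : convex_types r.

Let flin := strict_linear_order_flip rlin.
Let fconv := convex_orbits_flip rconv.
Let finv : invariant_order (fun x y => r y x).
Proof. by move=> f x y fi; exact: rinv. Qed.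
Let fcvx := convex_types_flip rcvx.

(** An orbit that is extreme on neither side has bounds on both sides within its 1-type, so that
    [rcvx] applies. *)
Lemma omitted_extreme y t w : Mem y -> orb [::] y w -> listin t -> ~ realized t w ->
  cofinal_orbit r t w \/ cofinal_orbit (fun x y => r y x) t w.
Proof.
move=> My yw Mt nr; apply: contrapT => /not_orP[nc nf]; apply: nr.
have [v wv vP] : exists2 v, orb [::] w v & forall w', orb t w w' -> r w' v.
  apply: contrapT => H; apply: nc => v wv; apply: contrapT => H'; apply: H.
  exists v => // w' ww'; apply: contrapT => n; apply: H'; by exists w'.
have [u wu uP] : exists2 u, orb [::] w u & forall w', orb t w w' -> r u w'.
  apply: contrapT => H; apply: nf => u wu; apply: contrapT => H'; apply: H.
  exists u => // w' ww'; apply: contrapT => n; apply: H'; by exists w'.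
apply: (rcvx (y := y) (u := u) (v := v)) => //.
- exact: orb_trans wu.
- exact: orb_trans wv.
- by move=> w' ww'; split; [exact: uP|exact: vP].
Qed.

(** If [x] split the type of [y] over [s], one piece would be bounded above and another below, and
    [open_realizes_cofinal], used for the order or its reverse, would realize every extreme
    extension: the type of [y] would be open. *)
Lemma open_orthogonal s x y : listin s -> Mem x -> Mem y -> open_over s x ->
  ~ open_over s y -> forall z, orb s y z -> orb (x :: s) y z.
Proof.
move=> Ms Mx My ox noy z yz; apply: contrapT => nyz; apply: noy.
move=> t Mt st w yw; apply: contrapT => nr; apply: (nr).
have [cof|cof] := omitted_extreme My (orb0 yw) Mt nr.
  have [k [b [yk yb kb]]] := split_bounded rlin rconv yz nyz.
  exact: (open_realizes_cofinal rlin rconv rinv rcvx Mt st Mx My ox yk yb kb yw).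
have [k [b [yk yb kb]]] := split_bounded flin fconv yz nyz.
exact: (open_realizes_cofinal flin fconv finv fcvx Mt st Mx My ox yk yb kb yw).
Qed.

Lemma closed_orthogonal s b z : listin s -> listin b -> Mem z ->
  (forall x, List.In x b -> open_over s x) -> ~ open_over s z ->
  forall w, orb s z w -> orb (b ++ s) z w.
Proof.
move=> Ms; elim: b => [|x b IH]//= Mb Mz ob noz w zw.
have {}IH : forall w, orb s z w -> orb (b ++ s) z w.
  apply: IH => //; first by move=> y yb; apply: Mb; right.
  by move=> y yb; apply: ob; right.
apply: (open_orthogonal (s := b ++ s)) => //.
- by apply: listin_cat => // y yb; apply: Mb; right.
- by apply: Mb; left.
- by apply: open_incl (ob x (or_introl erefl)); exact: incl_catr.
(* The type of [z] stays closed over [b ++ s]: by induction it does not split there, so openness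
   over [b ++ s] would give openness over [s]. *)
- move=> obz; apply: noz => t Mt st v zv.
  have [||m Mm vm] := obz (b ++ t) _ _ v (IH _ zv).
  + by apply: listin_cat => // y yb; apply: Mb; right.
  + by apply: incl_cat2.
  + by exists m => //; apply: orb_incl vm; exact: incl_catr.
- exact: IH.
Qed.

(** By orthogonality such elements can be adjoined to the parameters without restricting the
    conjugacy of tuples whose elements are open over the old ones. *)
Fixpoint closed_chain s : Prop :=
  if s is z :: s' then [/\ Mem z, ~ open_over s' z & closed_chain s'] else True.

Lemma closed_chain_listin s : closed_chain s -> listin s.
Proof. elim: s => [|z s IH] /=; first by move=> _ x [].
by move=> [Mz _ /IH Ms]; exact: listin_cons. Qed.

(** When [z] joins the chain, its type does not split over [b], so some [k] fixes [b] and the chain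
    so far and takes [z] to its preimage [h z] under the map [g] found so far. Then [g \o k] also
    fixes [z] and agrees with [g] on [b]. *)
Lemma closed_chain_extend s t b f : closed_chain (t ++ s) -> listin b ->
  (forall x, List.In x b -> open_over s x) -> isomorphism f -> fixes s f ->
  exists g, [/\ isomorphism g, fixes (t ++ s) g & map g b = map f b].
Proof.
move=> ct Mb ob fi fs; elim: t ct => [|z t IH] /=; first by exists f.
move=> [Mz noz ct]; have [g [gi gs gb]] := IH ct.
have [h [hi hK Kh]] := isomorphism_inv gi.
have Mts := closed_chain_listin ct.
have obt x : List.In x b -> open_over (t ++ s) x.
  by move=> /ob; apply: open_incl; exact: incl_catr.
have [k [ki ks kz]] : orb (b ++ (t ++ s)) z (h z).
  apply: closed_orthogonal => //; apply: fixes_orb => //; exact: fixes_inv gs hK.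
exists (g \o k); split; first exact: isomorphism_comp.
- move=> x [<-|xts] /=; first by rewrite kz Kh.
  by rewrite ks ?gs//; apply: incl_catr.
- by rewrite -gb; apply: eq_mapIn => x xb /=; rewrite ks//; apply: incl_catl.
Qed.

(** Run through [l], adding an element to the chain if its type over the current chain is closed,
    and to [b] otherwise; open types remain open over larger parameter sets. *)
Lemma split_open_closed l s : closed_chain s -> listin l ->
  exists t b, [/\ closed_chain (t ++ s), listin b,
    forall x, List.In x b -> open_over (t ++ s) x & incl l (b ++ (t ++ s))].
Proof.
move=> cs; elim: l => [|c l IH] Ml; first by exists [::], [::]; split=> // x [].
have [|t [b [ct Mb ob lb]]] := IH; first by move=> x xl; apply: Ml; right.
have Mc : Mem c by apply: Ml; left.
have [oc|noc] := pselect (open_over (t ++ s) c).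
  exists t, (c :: b); split => //.
  - exact: listin_cons.
  - by move=> x [<-//|/ob].
  - exact: incl_cons2.
exists (c :: t), b; split => //.
- by move=> x /ob; apply: open_incl; exact: incl_cons.
- move=> x [<-|/lb /In_cat[xb|xts]]; apply/In_cat.
  + by right; left.
  + by left.
  + by right; right.
Qed.

(** The parameters of an omitted extension are split into a closed chain and open elements [b]. A
    realization [m] over the chain alone would have an open type, which gives a realization over [b]
    too, or a closed one, which does not split over [b]; either way nothing would be omitted. *)
Lemma closed_omitted s y : closed_chain s -> Mem y -> ~ open_over s y ->
  exists t w, [/\ closed_chain (t ++ s), orb s y w & ~ realized (t ++ s) w].
Proof.
move=> cs My noy.
have [u [Mu su [w yw nr]]] : exists u, [/\ listin u, incl s u &
    exists2 w, orb s y w & ~ realized u w].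
  apply: contrapT => H; apply: noy => u Mu su w yw; apply: contrapT => nr.
  by apply: H; exists u; split=> //; exists w.
have [t [b [ct Mb ob ub]]] := split_open_closed cs Mu.
exists t, w; split => // -[m Mm wm].
have Mts := closed_chain_listin ct.
have nrb : ~ realized (b ++ (t ++ s)) w.
  by move=> [n Mn wn]; apply: nr; exists n => //; exact: orb_incl wn.
have nom : ~ open_over (t ++ s) m.
  move=> om; apply: nrb; apply: (om) (orb_sym wm); first exact: listin_cat.
  exact: incl_catr.
apply: nrb; exists m => //; apply: orb_sym.
by apply: closed_orthogonal => //; exact: orb_sym.
Qed.

Definition bounds (q : C -> C -> Prop) y s : Prop :=
  exists2 w, orb [::] y w & cofinal_orbit q s w /\ ~ realized s w.

(** The conjugates of [w] over [s] form the last orbit, and [y], which lies in [Mem], is among them;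
    but [bounds] says that this orbit is omitted. *)
Lemma bounds_omitted q y s u t w : strict_linear_order q -> convex_orbits q ->
  Mem y -> incl s u -> incl s t -> bounds q y s ->
  orb u y w -> cofinal_orbit q t w -> False.
Proof.
move=> qlin qconv My su st [v yv [cof nr]] yw cofw; apply: nr; exists y => //.
have cofy : cofinal_orbit q s y.
  apply: cofinal_orb (cofinal_incl st cofw) _; apply: orb_sym; exact: orb_incl yw.
by apply: (cofinal_unique qlin qconv) => //; exact: orb_sym.
Qed.

(* A closed type over a chain is bounded in its 1-type on the left or on the right;
   one bound from each side suffices to make all of the 1-type open. *)
Lemma open_extension y0 s : closed_chain s ->
  exists t, closed_chain (t ++ s) /\
    forall y, Mem y -> orb [::] y0 y -> open_over (t ++ s) y.
Proof.
move=> cs.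
(* An extension that bounds the 1-type in direction [q] is taken if there is one; this is done first
   for [r] and then for the opposite order. *)
have choose q u : closed_chain u -> exists t, closed_chain (t ++ u) /\
    ((exists t', closed_chain (t' ++ u) /\ bounds q y0 (t' ++ u)) -> bounds q y0 (t ++ u)).
  move=> cu; have [[t [ct bt]]|n] := pselect (exists t, closed_chain (t ++ u) /\ bounds q y0 (t ++ u)).
    by exists t.
  by exists [::]; split=> // -[t H]; case: n; exists t.
have [t1 [c1 b1]] := choose r s cs.
have [t2 [c2 b2]] := choose (fun x y => r y x) (t1 ++ s) c1.
exists (t2 ++ t1); rewrite -catA; split=> // y My y0y; apply: contrapT => no.
have [t3 [w [c3 yw nr]]] := closed_omitted c2 My no.
have bnd q : cofinal_orbit q (t3 ++ t2 ++ t1 ++ s) w -> bounds q y0 (t3 ++ t2 ++ t1 ++ s).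
  by move=> cof; exists w => //; exact: orb_trans y0y (orb0 yw).
have chg q u : bounds q y0 u -> bounds q y u.
  by move=> [v y0v H]; exists v => //; exact: orb_trans (orb_sym y0y) y0v.
(* An element that is still closed yields an omitted extreme type over a longer chain. So a bound on
   that side was already chosen, and the element would lie in the end omitted there. *)
have [cof|cof] := omitted_extreme My (orb0 yw) (closed_chain_listin c3) nr.
- apply: (bounds_omitted rlin rconv My _ _ (chg _ _ (b1 _)) yw cof).
  + exact: incl_catr.
  + by rewrite catA; exact: incl_catr.
  + by exists (t3 ++ t2 ++ t1); rewrite -!catA; split=> //; exact: bnd.
- apply: (bounds_omitted flin fconv My _ _ (chg _ _ (b2 _)) yw cof).
  + exact: inclxx.
  + exact: incl_catr.
  + by exists (t3 ++ t2); rewrite -!catA; split=> //; exact: bnd.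
Qed.

End Open.
End OrderedOrbits.

(** * Weak quasi-o-minimality *)

Section WeaklyQuasiOMinimal.
Variables (L : language) (T : theory L) (C : structure L).
Hypothesis HC : monster_model T C.
Hypothesis Hcat : almost_aleph0_categorical T.
Variable theta : form L 2.
Definition theta_lt (a b : C) : Prop := sat theta (env2 a b).
Local Notation lt := theta_lt.
Hypothesis lt_lin : strict_linear_order lt.
Hypothesis Hwqom : forall D : set C, par_definable D ->
  boolean_combination (@zero_definable L C `|` convex_set lt) D.
Implicit Types (s t : seq C) (D : set C).

Local Notation orb := (@orb L C).

Lemma lt_invariant : invariant_order lt.
Proof.
move=> f x y fi; rewrite /theta_lt (sat_iso _ _ fi) comp_scons.
by have -> : f \o env1 y = env1 (f y) by [].
Qed.

Lemma increasing_lt (u : nat -> C) : (forall n, lt (u n) (u n.+1)) ->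
  forall m n, m < n -> lt (u m) (u n).
Proof.
move=> uS m; elim=> // n IH; rewrite ltnS leq_eqVlt => /orP[/eqP->//|/IH um].
exact: (order_trans lt_lin um).
Qed.

(** Along an increasing sequence in a single 1-type a 0-definable set is constant and a convex set
    changes at most twice; this passes to finite Boolean combinations. *)
Lemma eventually_constant (u : nat -> C) D : (forall n, lt (u n) (u n.+1)) ->
  (forall n, orb [::] (u 0) (u n)) -> par_definable D ->
  exists N, forall n, N <= n -> D (u n) <-> D (u N).
Proof.
move=> uS u0 /Hwqom; elim=> {D} [D|D _ [N NP]|D D' _ [N NP] _ [N' NP']].
- case=> [[phi ->]|Dc].
    exists 0 => n _ /=; have [f [fi _ <-]] := u0 n.
    by rewrite [X in _ <-> X](sat_iso _ _ fi).
  have [[N DN]|nD] := pselect (exists N, D (u N)); last first.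
    by exists 0 => n _; split=> Dn; case: nD; [exists n|exists 0].
  have [[N' [NN' DN']]|all] := pselect (exists N', N <= N' /\ ~ D (u N')); last first.
    exists N => n Nn; split=> // _; apply: contrapT => nDn; apply: all.
    by exists n.
  exists N' => n N'n; split=> // Dn; case: DN'.
  have [->//|nN'] := eqVneq N' n.
  have [<-//|nN] := eqVneq N N'.
  apply: (Dc (u N) _ (u n)) => //; apply: increasing_lt => //.
    by rewrite ltn_neqAle nN.
  by rewrite ltn_neqAle nN'.
- by exists N => n /NP H; split=> nD /H.
- exists (maxn N N') => n; rewrite geq_max => /andP[Nn Nn'].
  have H := NP _ Nn; have H' := NP' _ Nn'.
  have H1 := NP _ (leq_maxl N N'); have H1' := NP' _ (leq_maxr N N').
  by rewrite /setI /=; tauto.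
Qed.

Lemma wqom_convex_orbits : convex_orbits lt.
Proof.
move=> s a b c [f [fi fs fa]] ab rab rbc; apply: contrapT => nab.
have [D Ds DP] := relatively_definable HC Hcat s a.
(* The sequence is [a], [b], [f a], [f b], [f (f a)] and so on. It increases because [b] lies
   between [a] and [f a = c]; its even terms lie in [D] and its odd terms do not. *)
pose u n := iter n./2 f (if odd n then b else a).
have fis k : isomorphism (iter k f) /\ fixes s (iter k f).
  elim: k => [|k [IH1 IH2]] /=; first by split; [exact: isomorphism_id|].
  by split; [exact: isomorphism_comp|move=> x xs /=; rewrite IH2 ?fs].
have ue k : u k.*2 = iter k f a by rewrite /u odd_double doubleK.
have uo k : u k.*2.+1 = iter k f b by rewrite /u /= odd_double uphalf_double.
have itS k x : iter k.+1 f x = iter k f (f x) by rewrite iterSr.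
have parity n : exists k, n = k.*2 \/ n = k.*2.+1.
  by exists n./2; rewrite -{1 3}(odd_double_half n); case: odd; [right|left].
have uS n : lt (u n) (u n.+1).
  have [k [->|->]] := parity n.
    by rewrite ue uo; apply: lt_invariant => //; exact: (fis k).1.
  rewrite uo -doubleS ue itS fa; apply: lt_invariant => //; exact: (fis k).1.
have orbf k x : orb s x (iter k f x).
  by have [? ?] := fis k; exact: fixes_orb.
have uP n : orb [::] a (u n).
  have [k [->|->]] := parity n; rewrite ?ue ?uo.
    exact: orb0 (orbf _ _).
  exact: orb_trans ab (orb0 (orbf _ _)).
have De k : D (u k.*2).
  apply/DP => //; by rewrite ue.
have Do k : ~ D (u k.*2.+1).
  move=> /DP => /(_ (uP _)); rewrite uo => ak; apply: nab; apply: orb_trans ak _.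
  exact: orb_sym.
have [|N NP] := eventually_constant uS _ (definable_par Ds); first by rewrite (ue 0).
have := NP N.*2; rewrite -addnn leq_addr addnn => /(_ isT) [/(_ (De _)) DN _].
have := NP N.*2.+1; rewrite -addnn leqW ?leq_addr// addnn => /(_ isT) [_ /(_ DN)].
exact: Do.
Qed.

(** * Convex types *)

Definition convex_type (y : C) : Prop :=
  exists2 D, definable_over [::] D /\ (forall z, orb [::] y z -> D z) &
    forall u d v, orb [::] y u -> orb [::] y v -> lt u d -> lt d v -> D d -> orb [::] y d.

Lemma lt_definable s a : List.In a s ->
  definable_over s (lt ^~ a) /\ definable_over s (lt a).
Proof.
move=> sa; have H : definable2_over s lt := definable2_form s theta.
by split; [exact: definable2_fixr H|exact: definable2_fixl H].
Qed.

(** Between [u] and [v] the formula [D0] cuts out the 1-type and [D] the orbit inside it, so the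
    orbit is definable over [u], [v] and [s]. As it is invariant over [s], [definable_descent]
    removes [u] and [v]. *)
Lemma bounded_isolated s y z u v : convex_type y -> orb [::] y z ->
  orb [::] y u -> orb [::] y v -> (forall w, orb s z w -> lt u w /\ lt w v) ->
  definable_over s (orb s z).
Proof.
move=> [D0 [D0d D0y] D0c] yz yu yv bnd.
have [D Ds DP] := relatively_definable HC Hcat s z.
have inv f : isomorphism f -> fixes s f -> forall x y, orb s x y -> orb s z x -> orb s z y.
  by move=> _ _ x w xw zx; exact: orb_trans xw.
have us : incl s (u :: v :: s) by move=> x xs; right; right.
apply: (definable_descent HC (v := v)); last by move=> x w xw zx; exact: orb_trans xw.
apply: (definable_descent HC (v := u)); last first.
  move=> x w xw zx; apply: orb_trans zx _; apply: orb_incl xw; exact: incl_cons.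
suff : definable_over (u :: v :: s) (fun x => (D0 x /\ D x) /\ (lt u x /\ lt x v)).
  apply: eq_definable => x; split=> [[[D0x Dx] [ux xv]]|zx].
    apply/DP => //; apply: orb_trans (orb_sym yz) _; exact: (D0c u x v).
  have yx : orb [::] y x := orb_trans yz (orb0 zx).
  by split; [split; [exact: D0y|apply/DP => //; exact: orb0 zx]|exact: bnd].
apply: definable_and.
  by apply: definable_and; [apply: definable_incl D0d|apply: definable_incl Ds].
by apply: definable_and; [apply: (lt_definable _).2; left|apply: (lt_definable _).1; right; left].
Qed.

End WeaklyQuasiOMinimal.

(** * Countability *)

Lemma countable_codeP (X : Type) :
  countable [set: X] <-> exists f : X -> nat, injective f.
Proof.
split=> [/countable_injP[f fi]|[f fi]]; last first.
  by apply/countable_injP; exists f => x y _ _; exact: fi.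
by exists f => x y; apply: fi; rewrite in_setE.
Qed.

Lemma countable_sig (X : Type) (p : set X) :
  countable [set: X] -> countable [set: {x | p x}].
Proof.
move=> /countable_codeP[f fi]; apply/countable_codeP; exists (fun x => f (sval x)).
move=> [x px] [y py] /= /fi xy; rewrite xy in px *; congr exist.
exact: Prop_irrelevance.
Qed.

Lemma countable_enum (X : Type) : countable [set: X] -> inhabited X ->
  exists e : nat -> X, forall x, exists n, e n = x.
Proof.
move=> /countable_codeP[f fi] [x0].
have [e eP] : {e : nat -> X & forall n, forall x, f x = n -> e n = x}.
  apply: (choice (P := fun n y => forall x, f x = n -> y = x)) => n.
  have [[x <-]|nx] := pselect (exists x, f x = n); first by exists x => y /fi.
  by exists x0 => x xn; case: nx; exists x.
by exists e => x; exists (f x); exact: eP.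
Qed.

Fixpoint fincode n : fin n -> nat :=
  match n return fin n -> nat with
  | 0 => fun i => 0
  | m.+1 => fun i => if i is Some j then (@fincode m j).+1 else 0
  end.

Lemma fincode_inj n : injective (@fincode n).
Proof. by elim: n => [[]|n IH] [i|] [j|] //= [] /IH ->. Qed.

Lemma map_fin_enum_inj (X : Type) n (f g : fin n -> X) :
  map f (fin_enum n) = map g (fin_enum n) -> f = g.
Proof.
move=> fg; apply/funext; elim: n f g fg => [|n IH] f g; first by move=> _ [].
move=> /= [fN]; rewrite -!map_comp => /IH fS [i|] //; exact: fS.
Qed.

Section CountableSyntax.
Variable L : language.
Variables (fc : funsym L -> nat) (rc : relsym L -> nat).
Hypotheses (fci : injective fc) (rci : injective rc).

Fixpoint term_code n (t : term L n) : GenTree.tree nat :=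
  match t with
  | Var i => GenTree.Leaf (fincode i)
  | App f ts =>
      GenTree.Node (fc f) (map (fun j => term_code (ts j)) (fin_enum (farity f)))
  end.

Lemma term_code_inj n : injective (@term_code n).
Proof.
elim=> [i|f ts IH] [j|g us] //= []; first by move/fincode_inj ->.
move=> /fci fg; case: g / fg us => us /map_fin_enum_inj H.
by congr App; apply/funext => j; apply: IH; exact: (congr1 (@^~ j) H).
Qed.

Fixpoint form_code n (phi : form L n) : GenTree.tree nat :=
  match phi with
  | Eq t u => GenTree.Node 0 [:: term_code t; term_code u]
  | Rel r ts => GenTree.Node 1
      (GenTree.Leaf (rc r) :: map (fun j => term_code (ts j)) (fin_enum (rarity r)))
  | Not phi => GenTree.Node 2 [:: form_code phi]
  | And phi psi => GenTree.Node 3 [:: form_code phi; form_code psi]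
  | Ex phi => GenTree.Node 4 [:: form_code phi]
  end.

Lemma form_code_inj n : injective (@form_code n).
Proof.
move=> phi; elim: n / phi => [n t u|n r ts|n phi IH|n phi IH psi IH'|n phi IH]
  [t' u'|r' ts'|phi'|phi' psi'|phi'] //= [].
- by move=> /term_code_inj -> /term_code_inj ->.
- move=> /rci rr; case: r' / rr ts' => ts' /map_fin_enum_inj H.
  by congr Rel; apply/funext => j; apply: term_code_inj; exact: (congr1 (@^~ j) H).
- by move=> /IH ->.
- by move=> /IH -> /IH' ->.
- by move=> /IH ->.
Qed.

End CountableSyntax.

Lemma countable_formulas (L : language) n : countable_language L ->
  countable [set: form L n].
Proof.
move=> [/countable_codeP[fc fci] /countable_codeP[rc rci]].
apply/countable_codeP; exists (fun phi => pickle (form_code fc rc phi)).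
apply: inj_comp; first exact: (pcan_inj pickleK).
exact: form_code_inj.
Qed.

(** * Back and forth *)

Section BackAndForth.
Variable L : language.
Implicit Types M N K : structure L.

Definition left_env (A B : Type) (l : seq (A * B)) : fin (size l) -> A :=
  fun i => (lenv l i).1.
Definition right_env (A B : Type) (l : seq (A * B)) : fin (size l) -> B :=
  fun i => (lenv l i).2.
Arguments left_env {A B} l _.
Arguments right_env {A B} l _.

Lemma left_env_cons (A B : Type) (x : A * B) l :
  left_env (x :: l) = scons x.1 (left_env l).
Proof. by apply/funext => -[]. Qed.

Lemma right_env_cons (A B : Type) (x : A * B) l :
  right_env (x :: l) = scons x.2 (right_env l).
Proof. by apply/funext => -[]. Qed.

Lemma env_eta (X : Type) n (e : fin n.+1 -> X) :
  e = scons (e None) (fun i => e (Some i)).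
Proof. by apply/funext => -[]. Qed.

Lemma env0E (X : Type) (e : fin 0 -> X) : e = env0.
Proof. by apply/funext => -[]. Qed.

Lemma left_env0 (A B : Type) : left_env ([::] : seq (A * B)) = env0.
Proof. exact: env0E. Qed.

Lemma right_env0 (A B : Type) : right_env ([::] : seq (A * B)) = env0.
Proof. exact: env0E. Qed.

Lemma prefix_elementary M N (u : nat -> M * N) :
  (forall k, same_type (left_env (prefix_of u k)) (right_env (prefix_of u k))) ->
  forall n (phi : form L n) (e : fin n -> M * N), (forall i, exists k, u k = e i) ->
    sat phi (fun i => (e i).1) <-> sat phi (fun i => (e i).2).
Proof.
move=> H n phi e eu.
have [k kP] : {k : fin n -> nat & forall i, u (k i) = e i}.
  exact: (choice (P := fun i k => u k = e i)).
have [b bP] : exists b, forall i, k i < b.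
  clear -k; elim: n k => [|n IH] k; first by exists 0 => -[].
  have [b bP] := IH (fun i => k (Some i)); exists (maxn b (k None).+1) => -[i|].
    by rewrite (leq_trans (bP i))// leq_maxl.
  by rewrite leq_maxr.
have [r rP] : {r : fin n -> fin (size (prefix_of u b)) & forall i, lenv (prefix_of u b) (r i) = e i}.
  apply: (choice (P := fun i j => lenv (prefix_of u b) j = e i)) => i.
  by apply: In_lenv; apply/In_prefix_of; exists (k i).
have -> : (fun i => (e i).1) = left_env (prefix_of u b) \o r.
  by apply/funext => i /=; rewrite /left_env rP.
have -> : (fun i => (e i).2) = right_env (prefix_of u b) \o r.
  by apply/funext => i /=; rewrite /right_env rP.
rewrite -(sat_fren r phi (left_env _)) -(sat_fren r phi (right_env _)).
exact: H.
Qed.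

Lemma elementary_embedding M (C : structure L) : countable_structure M ->
  same_type (@env0 M) (@env0 C) ->
  (forall n (e : fin n -> M) (e' : fin n -> C) a, same_type e e' ->
     exists b, same_type (scons a e) (scons b e')) ->
  exists j : M -> C, forall n (phi : form L n) (e : fin n -> M), sat phi e <-> sat phi (j \o e).
Proof.
move=> cM H0 HS; have [en enP] := countable_enum cM (carrier_inhabited M).
have [||u uP] := build_sequence
  (P := fun l : seq (M * C) => same_type (left_env l) (right_env l))
  (Q := fun l x => x.1 = en (size l)).
- by rewrite left_env0 right_env0.
- move=> l Pl; have [b bP] := HS _ _ _ (en (size l)) Pl.
  exists (en (size l), b); split=> //.
  by rewrite left_env_cons right_env_cons.
have [idx idxP] : {idx : M -> nat & forall m, en (idx m) = m}.
  exact: (choice (P := fun m k => en k = m)).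
exists (fun m => (u (idx m)).2) => n phi e.
apply: (prefix_elementary (fun k => (uP k).1) phi (e := fun i => (e i, (u (idx (e i))).2))).
move=> i; exists (idx (e i)); rewrite [LHS]surjective_pairing; congr pair.
by rewrite (uP _).2 size_prefix_of idxP.
Qed.

Lemma back_and_forth M N (W : seq (M * N) -> Prop) :
  countable_structure M -> countable_structure N -> W [::] ->
  (forall l a, W l -> exists b, W ((a, b) :: l)) ->
  (forall l b, W l -> exists a, W ((a, b) :: l)) ->
  (forall l, W l -> same_type (left_env l) (right_env l)) ->
  isomorphic M N.
Proof.
move=> cM cN W0 forth back WT.
have [eM eMP] := countable_enum cM (carrier_inhabited M).
have [eN eNP] := countable_enum cN (carrier_inhabited N).
(* Even stages take care of the elements of [M], odd stages of those of [N]. *)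
have [||u uP] := build_sequence (P := W) (Q := fun l x =>
  if odd (size l) then x.2 = eN (size l)./2 else x.1 = eM (size l)./2) => //.
  move=> l Wl; case: (odd _).
    by have [a aP] := back l (eN (size l)./2) Wl; exists (a, eN (size l)./2).
  by have [b bP] := forth l (eM (size l)./2) Wl; exists (eM (size l)./2, b).
have el := prefix_elementary (fun k => WT _ (uP k).1).
have totM m : exists k, (u k).1 = m.
  have [i <-] := eMP m; exists i.*2.
  by have := (uP i.*2).2; rewrite size_prefix_of odd_double doubleK.
have totN n : exists k, (u k).2 = n.
  have [i <-] := eNP n; exists i.*2.+1.
  by have := (uP i.*2.+1).2; rewrite size_prefix_of /= odd_double/= uphalf_double.
have [kM kMP] : {k : M -> nat & forall m, (u (k m)).1 = m}.
  exact: (choice (P := fun m k => (u k).1 = m)).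
have [kN kNP] : {k : N -> nat & forall n, (u (k n)).2 = n}.
  exact: (choice (P := fun n k => (u k).2 = n)).
have pairP i j : (u i).1 = (u j).1 <-> (u i).2 = (u j).2.
  have := el 2 (Eq (Var (None : fin 2)) (Var (Some None : fin 2)))
    (fun x : fin 2 => if x is None then u i else u j).
  by apply=> -[x|]; [exists j|exists i].
pose h m := (u (kM m)).2.
exists h; split.
- exists (fun n => (u (kN n)).1) => [m|n].
    by rewrite -[RHS]kMP; apply/pairP; rewrite kNP.
  by rewrite /h -[RHS]kNP; apply/pairP; rewrite kMP.
- move=> f a.
  pose e (i : fin (farity f).+1) := u (kM (if i is Some j then a j else finterp M f a)).
  have := el _ (Eq (Var (None : fin (farity f).+1)) (App f (fun j => Var (Some j : fin (farity f).+1)))) e.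
  move=> /(_ (fun i => ex_intro _ _ erefl)) /= [+ _]; rewrite !kMP.
  suff -> : (fun j => (u (kM (a j))).1) = a by apply.
  by apply/funext => j; rewrite kMP.
- move=> r a; have := el _ (Rel r (fun j => Var j)) (fun j => u (kM (a j))).
  move=> /(_ (fun i => ex_intro _ _ erefl)) /=.
  by have -> : (fun j => (u (kM (a j))).1) = a by apply/funext => j; rewrite kMP.
Qed.

Fixpoint iclose n : iform L n -> iform L 0 :=
  match n return iform L n -> iform L 0 with
  | 0 => id
  | m.+1 => fun phi => iclose (INot (IEx (INot phi)))
  end.

Lemma isat_iclose K n (phi : iform L n) :
  isat (iclose phi) (@env0 K) <-> forall e : fin n -> K, isat phi e.
Proof.
elim: n phi => [|n IH] phi /=.
  by split=> [H e|H]; [rewrite (env0E e)|exact: H].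
rewrite IH /=; split=> [H e|H e [a]]; last by apply; exact: H.
by rewrite (env_eta e); apply: contrapT => n'; apply: (H (fun i => e (Some i))); exists (e None).
Qed.

(** These closure properties pass to intersections, so [L1] inherits them directly from the
    fragments it is the intersection of. *)
Record logic_closed (F : forall n, set (iform L n)) : Prop := LogicClosed {
  closed_fo : forall n (phi : form L n), F n (fo phi);
  closed_not : forall n (phi : iform L n), F n phi -> F n (INot phi);
  closed_and : forall n (phi psi : iform L n), F n phi -> F n psi -> F n (IAnd phi psi);
  closed_ex : forall n (phi : iform L n.+1), F n.+1 phi -> F n (IEx phi) }.

Definition equiv_in (F : forall n, set (iform L n)) M N n
    (e : fin n -> M) (e' : fin n -> N) : Prop :=
  forall phi, F n phi -> isat phi e <-> isat phi e'.

Section Fragment.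
Variable F : forall n, set (iform L n).
Hypothesis HF : logic_closed F.

Lemma closed_iclose n (phi : iform L n) : F phi -> F (iclose phi).
Proof.
elim: n phi => //= n IH phi Fphi; apply: IH; apply: (closed_not HF).
by apply: (closed_ex HF); exact: (closed_not HF).
Qed.

Lemma equiv_in_same_type M N n (e : fin n -> M) (e' : fin n -> N) :
  equiv_in F e e' -> same_type e e'.
Proof. by move=> ee phi; rewrite -!isat_fo; apply: ee; exact: (closed_fo HF). Qed.

Lemma not_equiv_in M N n (e : fin n -> M) (e' : fin n -> N) : ~ equiv_in F e e' ->
  exists phi, [/\ F phi, isat phi e & ~ isat phi e'].
Proof.
move=> ne; apply: contrapT => nphi; apply: ne => phi Fphi; split=> [H|H].
  by apply: contrapT => H'; apply: nphi; exists phi.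
apply: contrapT => H'; apply: nphi; by exists (INot phi); split=> //=; exact: (closed_not HF).
Qed.

Lemma closed_true n : exists2 phi : iform L n, F phi &
  forall K (e : fin n -> K), isat phi e.
Proof.
pose psi : form L n.+1 := Eq (Var (None : fin n.+1)) (Var (None : fin n.+1)).
exists (fo (Ex psi)); first exact: (closed_fo HF).
by move=> K e; have [a] := carrier_inhabited K; exists a.
Qed.

(** * Categoricity from finitely many types in each product of 1-types *)

Section Categoricity.
Variables M N : structure L.
Hypothesis HMN : forall phi : iform L 0, F phi -> isat (M := M) phi env0 ->
  isat (M := N) phi env0.
Hypothesis Htype : forall K n (e : fin n -> K) (i : fin n), K = M \/ K = N ->
  exists2 phi : iform L n, F phi &
    forall K' (e' : fin n -> K'), isat phi e' <-> same_type (env1 (e i)) (env1 (e' i)).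
Hypothesis Hfin : forall n (e : fin n -> M), exists l : seq (fin n -> M),
  forall e' : fin n -> M, (forall i, same_type (env1 (e i)) (env1 (e' i))) ->
    exists2 t : fin n -> M, List.In t l & equiv_in F e' t.

Lemma type_formula K n (e : fin n -> K) : K = M \/ K = N ->
  exists2 phi : iform L n, F phi &
    forall K' (e' : fin n -> K'), isat phi e' <-> forall i, same_type (env1 (e i)) (env1 (e' i)).
Proof.
move=> KMN; suff [phi Fphi phiP] : exists2 phi : iform L n, F phi &
    forall K' (e' : fin n -> K'), isat phi e' <->
      forall i, List.In i (fin_enum n) -> same_type (env1 (e i)) (env1 (e' i)).
  exists phi => // K' e'; rewrite phiP; split=> H i; last by move=> _; exact: H.
  by apply: H; exact: fin_enumP.
elim: (fin_enum n) => [|i s [phi Fphi phiP]].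
  by have [phi Fphi phiP] := closed_true n; exists phi.
have [psi Fpsi psiP] := Htype e i KMN.
exists (IAnd psi phi); first exact: (closed_and HF).
move=> K' e' /=; rewrite psiP phiP; split=> [[H1 H2] k [<-//|/H2//]|H].
by split=> [|k ks]; apply: H; [left|right].
Qed.

Definition isolates n (theta : iform L n) (e : fin n -> M) : Prop :=
  [/\ F theta, isat theta e & forall e' : fin n -> M, isat theta e' -> equiv_in F e e'].

(** [tau] fixes the 1-types of the coordinates, which leaves finitely many [F]-types by [Hfin];
    [chi] is a conjunction of formulas ruling out those different from the type of [e]. *)
Lemma isolating_formula n (e : fin n -> M) : exists theta, isolates theta e.
Proof.
have [tau Ftau tauP] := type_formula e (or_introl erefl).
have [l lP] := Hfin e.
have [chi [Fchi chie chiP]] : exists chi : iform L n, [/\ F chi, isat chi e &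
    forall t : fin n -> M, List.In t l -> isat chi t -> equiv_in F e t].
  elim: l {lP} => [|t l [chi [Fchi chie chiP]]].
    by have [phi Fphi phiP] := closed_true n; exists phi.
  have [et|/not_equiv_in[psi [Fpsi psie psit]]] := pselect (equiv_in F e t).
    by exists chi; split=> // t' [<-//|/chiP].
  exists (IAnd psi chi); split=> //; first exact: (closed_and HF).
  by move=> t' [<- [/psit]//|t'l [_]]; exact: chiP.
exists (IAnd tau chi); split=> /=; first exact: (closed_and HF).
  by split => //; apply/tauP => i phi.
move=> e' [/tauP/lP[t tl e't] chie'] phi Fphi.
have et := chiP t tl (iffLR (e't _ Fchi) chie').
by rewrite (et _ Fphi) (e't _ Fphi).
Qed.

(** The universal closure of the implication from [theta] to [phi] is a sentence of [F] true in [M],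
    hence in [N]. *)
Lemma isolates_transfer n theta (e : fin n -> M) (e' : fin n -> N) :
  isolates theta e -> isat theta e' -> equiv_in F e e'.
Proof.
move=> [Ftheta _ thetaP] te'.
have imp phi : F phi -> isat phi e -> isat phi e'.
  move=> Fphi phie; have FI : F (INot (IAnd theta (INot phi))).
    by apply: (closed_not HF); apply: (closed_and HF) => //; exact: (closed_not HF).
  have := HMN (closed_iclose FI); rewrite !isat_iclose => H.
  have /= := H _ e'; move=> H'; apply: contrapT => nphi; apply: H' => //.
  by move=> d [td]; apply; apply/(thetaP d td _ Fphi).
move=> phi Fphi; split; first exact: imp.
move=> phie'; apply: contrapT => nphi.
by have := imp _ (closed_not HF Fphi) nphi; apply.
Qed.

Lemma categoricity : countable_structure M -> countable_structure N -> isomorphic M N.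
Proof.
move=> cM cN; apply: (back_and_forth (W := fun l => equiv_in F (left_env l) (right_env l))) => //.
- move=> phi Fphi; rewrite left_env0 right_env0; split; first exact: HMN.
  move=> H; apply: contrapT => H'; by apply: (HMN (closed_not HF Fphi) H').
- move=> l a Wl; have [theta tP] := isolating_formula (scons a (left_env l)).
  have [Ftheta te _] := tP.
  have [b bP] : isat (IEx theta) (right_env l).
    by apply/(Wl (IEx theta)); [exact: (closed_ex HF)|exists a].
  exists b; rewrite left_env_cons right_env_cons; exact: isolates_transfer bP.
- move=> l b Wl.
  (* Some [a0] in [M] has the 1-type of [b], since otherwise the sentence saying that this type is
     omitted would pass from [M] to [N]. *)
  have [a0 a0P] : exists a0 : M, same_type (env1 b) (env1 a0).
    have [tau Ftau tauP] := @Htype N 1 (env1 b) None (or_intror erefl).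
    apply: contrapT => na; have := HMN (closed_not HF (closed_ex HF Ftau)).
    have bE : (env1 b : fin 1 -> N) = scons b env0 by apply/funext => -[[]|].
    move=> H; apply: H => /=; last by exists b; rewrite -bE; apply/tauP.
    by move=> [a /tauP]; have -> : scons a env0 None = a by []; move=> ?; apply: na; exists a.
  pose e0 := scons a0 (left_env l); pose e' := scons b (right_env l).
  have [tau Ftau tauP] := type_formula e0 (or_introl erefl).
  have taue' : isat tau e'.
    apply/tauP => -[i|] phi /=; last by rewrite a0P.
    have := Wl _ (closed_fo HF (fren (fun _ : fin 1 => i) phi)).
    by rewrite !isat_fo !sat_fren.
  have [s sP] := Hfin e0.
  (* [chi] is the disjunction of the isolating formulas of the finitely many representatives. That
     [tau] implies [chi] is true in [M] and passes to [N], so [e'] satisfies one of these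
     formulas. *)
  have [chi [Fchi chiP chiN]] : exists chi : iform L (size l).+1, [/\ F chi,
      forall e : fin _ -> M, (exists2 t : fin _ -> M, List.In t s & equiv_in F e t) -> isat chi e &
      isat chi e' -> exists2 t : fin _ -> M, True & exists2 theta, isolates theta t & isat theta e'].
    elim: s {sP} => [|t s [chi [Fchi chiP chiN]]].
      have [phi Fphi phiP] := closed_true (size l).+1.
      exists (INot phi); split; first exact: (closed_not HF).
        by move=> e [].
      by move=> /(_ (phiP _ _)).
    have [theta tP] := isolating_formula t; have [Ftheta tt tu] := tP.
    exists (INot (IAnd (INot theta) (INot chi))); split.
    + by apply: (closed_not HF); apply: (closed_and HF); exact: (closed_not HF).
    + move=> e [t' [<-|t's] et'] /= [H1 H2].
        by apply: H1; apply/et'.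
      by apply: H2; apply: chiP; exists t'.
    + move=> /= H; have [te'|nte'] := pselect (isat theta e'); first by exists t => //; exists theta.
      by apply: chiN; apply: contrapT => nchi; apply: H.
  have [|t _ [theta tP te']] := chiN _.
    have FI : F (INot (IAnd tau (INot chi))).
      by apply: (closed_not HF); apply: (closed_and HF) => //; exact: (closed_not HF).
    have := HMN (closed_iclose FI); rewrite !isat_iclose => H.
    have /= H' := H _ e'; apply: contrapT => nchi; apply: H' => //.
    by move=> d [/tauP/sP dt]; apply; exact: chiP.
  have [Ftheta _ tu] := tP.
  have [a aP] : isat (IEx theta) (left_env l).
    by apply/(Wl (IEx theta)); [exact: (closed_ex HF)|exists b].
  exists a; rewrite left_env_cons right_env_cons => phi Fphi.
  by rewrite -(tu _ aP)// (isolates_transfer tP te').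
- by move=> l; exact: equiv_in_same_type.
Qed.

End Categoricity.
End Fragment.

Lemma scott_isomorphism M N : countable_structure M -> countable_structure N ->
  (forall phi : iform L 0, isat (M := M) phi env0 -> isat (M := N) phi env0) ->
  isomorphic M N.
Proof.
move=> cM cN MN.
pose equiv K K' n (e : fin n -> K) (e' : fin n -> K') :=
  forall phi, isat phi e -> isat phi e'.
have equiv_sym K K' n (e : fin n -> K) (e' : fin n -> K') : equiv _ _ _ e e' -> equiv _ _ _ e' e.
  move=> ee phi phie; apply: contrapT => nphi; exact: (ee (INot phi) nphi).
have forth K K' n (e : fin n -> K) (e' : fin n -> K') a : countable_structure K' ->
    equiv _ _ _ e e' -> exists b, equiv _ _ _ (scons a e) (scons b e').
  (* If no [b] works, every element of [K'] fails a formula that [a] satisfies; the countable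
     conjunction of these formulas holds at [a] and nowhere in [K']. *)
  move=> cK' ee; apply: contrapT => nb.
  have [en enP] := countable_enum cK' (carrier_inhabited K').
  have [phi phiP] : {phi : nat -> iform L n.+1 & forall k, isat (phi k) (scons a e) /\
      ~ isat (phi k) (scons (en k) e')}.
    apply: (choice (P := fun k phi => isat phi (scons a e) /\ ~ isat phi (scons (en k) e'))).
    move=> k; apply: contrapT => H; apply: nb; exists (en k) => phi phie.
    by apply: contrapT => nphi; apply: H; exists phi.
  have [|b /= bP] := ee (IEx (IBigAnd nat (countableP _) phi)).
    by exists a => k; exact: (phiP k).1.
  by have [k kb] := enP b; apply: (phiP k).2; rewrite kb; exact: bP.
apply: (back_and_forth (W := fun l => equiv M N _ (left_env l) (right_env l))) => //.
- by move=> phi; rewrite left_env0 right_env0; exact: MN.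
- by move=> l a /(forth _ _ _ _ _ a cN)[b ?]; exists b; rewrite left_env_cons right_env_cons.
- move=> l b /equiv_sym/(forth _ _ _ _ _ b cM)[a ?].
  by exists a; apply: equiv_sym; rewrite left_env_cons right_env_cons.
- by move=> l Wl; apply: same_type_le => phi; rewrite -!isat_fo; exact: Wl.
Qed.

End BackAndForth.

(** * Countable models inside the monster model *)

Section Embedding.
Variables (L : language) (T : theory L) (C : structure L).
Hypothesis HT : complete_theory T.
Hypothesis HC : monster_model T C.

Lemma complete_same_type M : model T M -> same_type (@env0 M) (@env0 C).
Proof.
move=> TM; have TC := monster_theory HC; apply: same_type_le => phi.
case: HT => _ /(_ phi) [H _|H] ; first exact: H.
by move=> phiM; have := H _ TM.
Qed.

Lemma embed_in_monster M : model T M -> countable_structure M ->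
  exists j : M -> C, forall n (phi : form L n) (e : fin n -> M), sat phi e <-> sat phi (j \o e).
Proof.
move=> TM cM; apply: (elementary_embedding cM (complete_same_type TM)).
move=> n e e' a ee'; pose s := map e' (fin_enum n).
pose F : set (set C) := [set D | exists phi : form L n.+1,
  sat phi (scons a e) /\ D = (fun x => sat phi (scons x e'))].
have [r rP] : {r : fin n -> fin (size s) & forall i, lenv s (r i) = e' i}.
  apply: (choice (P := fun i k => lenv s k = e' i)) => i; apply: In_lenv.
  by apply/In_map; exists i => //; exact: fin_enumP.
have e'E : e' = lenv s \o r by apply/funext => i /=; rewrite rP.
have [||b bP] := @saturation L T C HC s F.
- move=> _ [phi [_ ->]]; exists (fren (finlift r) phi) => x.
  by rewrite sat_fren scons_finlift -e'E.
- move=> l lF.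
  have [phi [phia phiP]] : exists phi : form L n.+1, sat phi (scons a e) /\
      forall x, sat phi (scons x e') -> forall D, List.In D l -> D x.
    elim: l lF => [|D l IH] lF.
      by exists (Eq (Var (None : fin n.+1)) (Var (None : fin n.+1))).
    have [|phi [phia phiP]] := IH; first by move=> E El; apply: lF; right.
    have [psi [psia DE]] := lF D (or_introl erefl).
    exists (And psi phi); split=> // x /= [psix phix] E [<-|El]; first by rewrite DE.
    exact: phiP.
  have [x xP] : sat (Ex phi) e' by apply/ee'; exists a.
  by exists x; exact: phiP.
- exists b; apply: same_type_le => phi phia; apply: (bP (fun x => sat phi (scons x e'))).
  by exists phi.
Qed.

End Embedding.

(** * Back and forth in a countable model with convex 1-types *)

Section CountableModel.
Variables (L : language) (T : theory L) (C : structure L).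
Hypothesis HC : monster_model T C.
Hypothesis Hcat : almost_aleph0_categorical T.
Variable theta : form L 2.
Local Notation lt := (@theta_lt L C theta).
Hypothesis lt_lin : strict_linear_order lt.
Hypothesis Hwqom : forall D : set C, par_definable D ->
  boolean_combination (@zero_definable L C `|` convex_set lt) D.
Variables (M : structure L) (j : M -> C).
Hypothesis jel : forall n (phi : form L n) (e : fin n -> M), sat phi e <-> sat phi (j \o e).
Implicit Types (s t : seq C).

Local Notation orb := (@orb L C).

Definition image_of (x : C) : Prop := exists m, j m = x.
Local Notation Mem := image_of.

Lemma definable_meets s D z : listin Mem s -> definable_over s D -> D z ->
  exists m, D (j m).
Proof.
move=> Ms [phi phiP] Dz.
have [e eP] : {e : fin (size s) -> M & forall i, j (e i) = lenv s i}.
  by apply: (choice (P := fun i m => j m = lenv s i)) => i; apply: Ms; exact: lenv_In.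
have eE : j \o e = lenv s by exact/funext.
have [m mP] : sat (Ex phi) e by apply/jel; exists z; rewrite eE; exact/phiP.
by exists m; apply/phiP; rewrite -eE -comp_scons; exact/jel.
Qed.

Lemma same_type1_orb (x y : M) :
  same_type (env1 x) (env1 y) <-> orb [::] (j x) (j y).
Proof.
have jE z : j \o env1 z = env1 (j z) by [].
split=> [xy|[f [fi _ fx]] phi].
  have [phi|f fi fP] := homogeneity HC (e := env1 (j x)) (e' := env1 (j y)).
    by rewrite -!jE -!jel.
  by exists f; split => //; exact: (fP None).
rewrite !jel !jE (sat_iso _ (env1 (j x)) fi).
by have -> : f \o env1 (j x) = env1 (j y) by apply/funext => i /=.
Qed.

Hypothesis Hconv : forall m, convex_type theta (j m).

(** A bounded type is isolated, and an elementary submodel meets every nonempty set definable over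
    it. *)
Lemma image_convex_types : convex_types Mem lt.
Proof.
move=> _ s z u v [m <-] Ms yz yu yv bnd.
have ds := bounded_isolated HC Hcat (Hconv m) yz yu yv bnd.
have [m' zm'] := definable_meets Ms ds (orb_refl s z).
by exists (j m') => //; exists m'.
Qed.

(** The back-and-forth system. Since [s] is a closed chain it can be prolonged, and openness of the
    coordinates lets the conjugating map be adjusted when it is. *)
Definition open_conjugate n (e e' : fin n -> M) : Prop :=
  exists s, [/\ closed_chain Mem s, forall i, open_over Mem s (j (e i)) &
    exists f, [/\ isomorphism f, fixes s f & forall i, f (j (e i)) = j (e' i)]].

Lemma open_conjugate_sym n (e e' : fin n -> M) :
  open_conjugate e e' -> open_conjugate e' e.
Proof.
move=> [s [cs os [f [fi fs fe]]]]; exists s; split=> // [i|].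
  by apply: open_orb (os i); exists f.
have [g [gi fK gK]] := isomorphism_inv fi.
by exists g; split=> // [|i]; [exact: fixes_inv fs fK|rewrite -fe fK].
Qed.

Let conv := wqom_convex_orbits HC Hcat lt_lin Hwqom.
Let inv := @lt_invariant L C theta.
Let cvx := image_convex_types.

Lemma open_conjugate_forth n (e e' : fin n -> M) c : open_conjugate e e' ->
  exists c', open_conjugate (scons c e) (scons c' e').
Proof.
move=> [s [cs os [f [fi fs fe]]]].
(* The chain is prolonged until the 1-type of [c] is open, and [f] is corrected to fix the new part
   while keeping the images of [e]. The image of [c] is then realized in the model over these images
   and the chain. *)
have [t [ct ot]] := open_extension lt_lin conv inv cvx (j c) cs.
have [||g [gi gs ge]] := closed_chain_extend lt_lin conv inv cvx
  (b := map (fun i => j (e i)) (fin_enum n)) ct _ _ fi fs.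
- by move=> _ /In_map[i _ <-]; exists (e i).
- by move=> _ /In_map[i _ <-].
have {}ge i : g (j (e i)) = j (e' i).
  rewrite -fe; move: ge; rewrite -!map_comp; elim: (fin_enum n) (fin_enumP i) => //= k l IH.
  by move=> [<-|il] [] // _ /IH; exact.
have Mc : Mem (j c) by exists c.
have oc := ot _ Mc (orb_refl _ _).
have [|_ [c' <-] [h [hi ht hc]]] := oc (map (fun i => j (e' i)) (fin_enum n) ++ (t ++ s))
  _ (@incl_catr _ _ _) (g (j c)) (fixes_orb _ gi gs).
  apply: listin_cat; last exact: closed_chain_listin.
  by move=> _ /In_map[i _ <-]; exists (e' i).
exists c', (t ++ s); split=> //.
  by move=> [i|] //=; apply: open_incl (os i); exact: incl_catr.
exists (h \o g); split; first exact: isomorphism_comp.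
  by move=> x xts /=; rewrite gs// ht//; exact: incl_catr.
move=> [i|] //=; rewrite ge; apply: ht; apply: incl_catl.
by apply/In_map; exists i => //; exact: fin_enumP.
Qed.

Lemma open_conjugate_isat n (phi : iform L n) (e e' : fin n -> M) :
  open_conjugate e e' -> isat phi e <-> isat phi e'.
Proof.
have fosat m (psi : form L m) (d d' : fin m -> M) : open_conjugate d d' -> sat psi d <-> sat psi d'.
  move=> [s [_ _ [f [fi _ fd]]]]; rewrite !jel (sat_iso _ (j \o d) fi).
  by have -> : f \o (j \o d) = j \o d' by exact/funext.
elim: n / phi e e' => [n t u|n r ts|n phi IH|n phi IH psi IH'|n phi IH|n J cJ F IH] e e' ee'.
- exact: (fosat _ (Eq t u)).
- exact: (fosat _ (Rel r ts)).
- by rewrite /= (IH _ _ ee').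
- by rewrite /= (IH _ _ ee') (IH' _ _ ee').
- split=> /= -[c cP].
    have [c' cc'] := open_conjugate_forth c ee'; exists c'; exact/(IH _ _ cc').
  have [c' cc'] := open_conjugate_forth c (open_conjugate_sym ee').
  by exists c'; exact/(IH _ _ cc').
- by split=> /= H i; apply/(IH i _ _ ee'); exact: H.
Qed.

(** A single chain [s] makes all elements of the 1-types involved open. Over [s] there are finitely
    many orbits of such tuples, and conjugate ones satisfy the same infinitary formulas. *)
Lemma finitely_many_classes n (e : fin n -> M) : exists l : seq (fin n -> M),
  forall e' : fin n -> M, (forall i, same_type (env1 (e i)) (env1 (e' i))) ->
    exists2 t : fin n -> M, List.In t l & forall phi, isat phi e' <-> isat phi t.
Proof.
have [s [cs os]] : exists s, closed_chain Mem s /\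
    forall i y, List.In i (fin_enum n) -> Mem y -> orb [::] (j (e i)) y -> open_over Mem s y.
  elim: (fin_enum n) => [|i l [s [cs os]]]; first by exists [::].
  have [t [ct ot]] := open_extension lt_lin conv inv cvx (j (e i)) cs.
  exists (t ++ s); split=> // k y [<-|kl] My ky; first exact: ot.
  apply: open_incl (os k y kl My ky); exact: incl_catr.
have [l lP] := finite_orbits_tuple HC Hcat (j \o e) s.
pose good (e' : fin n -> M) (u : fin n -> C) := [/\ forall i, orb [::] (j (e i)) (u i) &
  exists f, [/\ isomorphism f, fixes s f & forall i, f (j (e' i)) = u i]].
have [l' l'P] : exists l' : seq (fin n -> M), forall e' u, List.In u l -> good e' u ->
    exists2 t : fin n -> M, List.In t l' & good t u.
  elim: l {lP} => [|u l [l' l'P]]; first by exists [::].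
  have [[t tu]|nt] := pselect (exists t : fin n -> M, good t u).
    exists (t :: l') => e' v [<-|vl] ev; first by exists t => //; left.
    by have [t' t'l gt'] := l'P e' v vl ev; exists t' => //; right.
  by exists l' => e' v [<-|vl] ev; [case: nt; exists e'|exact: l'P ev].
exists l' => e' ee'; have [|u [ul eu [f [fi fs fu]]]] := lP (j \o e').
  by move=> i; apply/same_type1_orb.
have [|t tl [_ [g [gi gs gt]]]] := l'P e' u ul; first by split => //; exists f.
exists t => // phi; apply: open_conjugate_isat; exists s; split=> //.
  move=> i; apply: (os i); [exact: fin_enumP|by exists (e' i)|exact/same_type1_orb].
have [h [hi gK hK]] := isomorphism_inv gi.
exists (h \o f); split; first exact: isomorphism_comp.
  by apply: fixes_comp => //; exact: fixes_inv gs gK.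
by move=> i /=; rewrite fu -gt gK.
Qed.

End CountableModel.

(** * The fragment L_1(T) *)

Section L1Fragment.
Variables (L : language) (T : theory L).
Hypothesis HL : countable_language L.

Lemma L1_closed : logic_closed (@L1 L T).
Proof.
split=> [n phi|n phi H|n phi psi H H'|n phi H] F HF cF Ffo Fty.
- exact: Ffo.
- by apply/(fragment_not HF); exact: H.
- by apply/(fragment_and HF); split; [exact: H|exact: H'].
- by apply/(fragment_ex HF); exact: H.
Qed.

Lemma types_of_model (M : structure L) n (e : fin n -> M) : model T M -> types T n (type_of e).
Proof.
move=> TM; split; first by exists M, e.
by move=> phi; exact: EM.
Qed.

Lemma L1_type_formula (K : structure L) n (e : fin n -> K) (i : fin n) : model T K ->
  exists2 phi : iform L n, L1 T phi &
    forall (K' : structure L) (e' : fin n -> K'), isat phi e' <-> same_type (env1 (e i)) (env1 (e' i)).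
Proof.
move=> TK; pose p := type_of (env1 (e i)).
have cp : countable [set: {phi | p phi}] := countable_sig p (countable_formulas 1 HL).
exists (isubst (type_conjunction cp) (fun _ => Var i)).
  move=> F HF cF Ffo Fty; apply: (fragment_subst HF); apply: Fty.
  exact: types_of_model.
move=> K' e'; rewrite isat_isubst; split=> /= H; last first.
  by move=> [phi pphi] /=; apply/isat_fo; exact/H.
by apply: same_type_le => phi pphi; apply/isat_fo; exact: (H (exist _ phi pphi)).
Qed.

(* Without countably many 1-types there is no countable fragment to intersect. *)
Lemma L1_not_small n (phi : iform L n) : ~ countable (types T 1) -> L1 T phi.
Proof.
move=> nc F HF cF Ffo Fty; case: nc.
have cp (p : set (form L 1)) : countable [set: {phi | p phi}].
  exact: countable_sig (countable_formulas 1 HL).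
have /countable_injP[c ci] := cF 1.
apply/countable_injP; exists (fun p => c (type_conjunction (cp p))) => p q.
rewrite !in_setE => pT qT /ci; rewrite !in_setE => /(_ (Fty _ _ _ pT) (Fty _ _ _ qT)) pq.
(* A complete type is recovered from its conjunction: a realization of [p'] satisfies the
   conjunction of [q'], so no formula of [p'] has its negation in [q']. *)
have sub (p' q' : set (form L 1)) : types T 1 p' -> types T 1 q' ->
    type_conjunction (cp p') = type_conjunction (cp q') -> p' `<=` q'.
  move=> [[M [a [_ aP]]] p'c] [_ q'c] E chi p'chi.
  have [//|q'chi] := q'c chi.
  have aq : isat (type_conjunction (cp q')) a.
    by rewrite -E => -[psi p'psi] /=; apply/isat_fo; exact: aP.
  have /isat_fo /= := aq (exist _ (Not chi) q'chi).
  by have := aP _ p'chi.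
by apply/seteqP; split; [apply: sub|apply: sub => //].
Qed.

End L1Fragment.

(** * Categoricity of T_1(M) when the 1-types are convex *)

Section Martin.
Variables (L : language) (T : theory L) (C : structure L).
Hypothesis HL : countable_language L.
Hypothesis HT : complete_theory T.
Hypothesis HC : monster_model T C.
Hypothesis Hcat : almost_aleph0_categorical T.
Variable theta : form L 2.
Hypothesis lt_lin : strict_linear_order (@theta_lt L C theta).
Hypothesis Hwqom : forall D : set C, par_definable D ->
  boolean_combination (@zero_definable L C `|` convex_set (@theta_lt L C theta)) D.
Hypothesis Hconv : countable (types T 1) -> forall y : C, convex_type theta y.

Lemma categorical_of_convex (M : structure L) : model T M -> countable_structure M ->
  T1_aleph0_categorical T M.
Proof.
move=> TM cM N cN NT1.
have MN (phi : iform L 0) : L1 T phi -> isat (M := M) phi env0 -> isat (M := N) phi env0.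
  by move=> H1 H2; apply: NT1.
have iso_sym : isomorphic M N -> isomorphic N M.
  by move=> [h /isomorphism_inv[k [ki _ _]]]; exists k.
apply: iso_sym.
have [small|nsmall] := pselect (countable (types T 1) : Prop); last first.
  apply: scott_isomorphism => // phi; apply: MN; exact: L1_not_small.
have TN : model T N.
  move=> phi Tphi; apply/isat_fo; apply: MN; last by apply/isat_fo; exact: TM.
  exact: (closed_fo (L1_closed T)).
have [j jel] := embed_in_monster HT HC TM cM.
apply: (categoricity (L1_closed T) MN) => //.
- move=> K n e i KMN; apply: L1_type_formula => //.
  by case: KMN => ->.
- move=> n e.
  have [l lP] := finitely_many_classes HC Hcat lt_lin Hwqom jel (fun m => Hconv small (j m)) e.
  by exists l => e' /lP[t tl et]; exists t => // phi _; exact: et.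
Qed.

End Martin.

(** * Isolated types *)

Section Isolated.
Variables (L : language) (T : theory L) (C : structure L).
Hypothesis HC : monster_model T C.
Hypothesis Hcat : almost_aleph0_categorical T.
Implicit Types (s t : seq C) (D : set C).

Local Notation orb := (@orb L C).

Definition isolated s z : Prop := definable_over s (orb s z).

(** Within the 1-type, which contains the definable orbit over [s], the orbit over [t] is cut out by
    some [D]; the two definable sets together isolate it. *)
Lemma isolated_incl s t z : incl s t -> isolated s z -> isolated t z.
Proof.
move=> st iz; have [D Dt DP] := relatively_definable HC Hcat t z.
apply: eq_definable (definable_and (definable_incl st iz) Dt) => w.
split=> [[zw Dw]|zw]; first exact/(DP _ (orb0 zw)).
by split; [exact: orb_incl zw|exact/(DP _ (orb0 zw))].
Qed.

Lemma isolated_trans s y z : isolated s y -> isolated (y :: s) z -> isolated s z.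
Proof.
move=> iy iz; have [R Rs RP] := definable_cons iz.
have := definable_ex (definable2_and (definable2_left iy) (definable2_swap Rs)).
apply: eq_definable => w; split=> [[x [[f [fi fs <-]] Rw]]|[f [fi fs <-]]].
  have [g [gi fK gK]] := isomorphism_inv fi.
  have : orb (y :: s) z (g w).
    by apply/RP; apply/(definable2_fixes (g w) y Rs fi fs); rewrite gK.
  move=> /(orb_incl (@incl_cons _ y s)) zw; rewrite -[w]gK.
  by apply: orb_trans zw _; exact: fixes_orb.
exists (f y); split; first exact: fixes_orb.
by apply/(definable2_fixes z y Rs fi fs); apply/RP; exact: orb_refl.
Qed.

Lemma isolated_In s x : List.In x s -> isolated s x.
Proof.
move=> xs; apply: eq_definable (definable_eq xs) => w.
by split=> [->|/(orb_In xs)//]; exact: orb_refl.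
Qed.

Lemma isolated_image f s z : isomorphism f -> isolated s z -> isolated (map f s) (f z).
Proof.
move=> fi [phi phiP]; have [g [gi fK gK]] := isomorphism_inv fi.
have mgf : map g (map f s) = s by rewrite -map_comp; apply/map_idIn => x _ /=; rewrite fK.
have [r rP] : {r : fin (size s) -> fin (size (map f s)) &
    forall i, lenv (map f s) (r i) = f (lenv s i)}.
  apply: (choice (P := fun i k => lenv (map f s) k = f (lenv s i))) => i.
  by apply: In_lenv; apply/In_map; exists (lenv s i) => //; exact: lenv_In.
have rE : lenv (map f s) \o r = f \o lenv s by apply/funext => i /=; rewrite rP.
exists (fren (finlift r) phi) => x; rewrite sat_fren scons_finlift rE -{2}[x]gK -comp_scons.
rewrite -(sat_iso _ _ fi) -phiP; split=> [/(orb_image gi)|/(orb_image fi)].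
  by rewrite mgf fK.
by rewrite gK.
Qed.

(** Applying the [n]-th iterate to the isolation of [f a] over [a :: s] isolates each iterate over
    the previous one and [s]; transitivity concludes. *)
Lemma isolated_iter s a f : isomorphism f -> fixes s f -> isolated (a :: s) (f a) ->
  forall n, isolated (a :: s) (iter n f a).
Proof.
move=> fi fs ia; elim=> [|n IH]; first by apply: isolated_In; left.
have fin_ : isomorphism (iter n f) /\ fixes s (iter n f).
  elim: n {IH} => [|n [IH1 IH2]] /=; first by split; [exact: isomorphism_id|].
  by split; [exact: isomorphism_comp|move=> x xs /=; rewrite IH2 ?fs].
apply: isolated_trans IH _; rewrite iterSr.
apply: (isolated_incl (s := iter n f a :: s)).
  by apply: incl_consl; [left|move=> x xs; right; right].
have := isolated_image fin_.1 ia; rewrite /=.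
by rewrite (iffRL (map_idIn _ _) fin_.2).
Qed.

(** ** Density of isolated types *)

Section Density.
Hypothesis small : countable (types T 1).

Lemma small_orbits : exists c : nat -> C, forall x, exists k, orb [::] (c k) x.
Proof.
have /countable_injP[code codei] := small; have [x0] := carrier_inhabited C.
have typ (x : C) : type_of (env1 x) \in types T 1.
  rewrite in_setE; split; last by move=> phi; exact: EM.
  by exists C, (env1 x); split => //; exact: monster_theory HC.
have [c cP] : {c : nat -> C & forall k, forall x, code (type_of (env1 x)) = k -> orb [::] (c k) x}.
  apply: (choice (P := fun k y => forall x, code (type_of (env1 x)) = k -> orb [::] y x)) => k.
  have [[y yk]|ny] := pselect (exists y : C, code (type_of (env1 y)) = k); last first.
    by exists x0 => x xk; case: ny; exists x.
  exists y => x xk; have [|f fi fP] := homogeneity HC (e := env1 y) (e' := env1 x).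
    by apply/same_typeP; apply: codei; rewrite ?typ// yk xk.
  by exists f; split => //; exact: (fP None).
by exists c => x; exists (code (type_of (env1 x))); exact: cP.
Qed.

Lemma small_orbits_over s : exists c : nat -> C, forall x, exists k, orb s (c k) x.
Proof.
have [c cP] := small_orbits; have [x0] := carrier_inhabited C.
have [l lP] : {l : nat -> seq C & forall k, forall z, orb [::] (c k) z ->
    exists2 t, List.In t (l k) & orb s z t}.
  apply: (choice (P := fun k l => forall z, orb [::] (c k) z ->
    exists2 t, List.In t l & orb s z t)) => k.
  exact: (finite_orbits HC Hcat).
exists (fun n => if unpickle n is Some (k, i) then nth x0 (l k) i else x0) => x.
have [k ck] := cP x; have [t tl xt] := lP k x ck.
have [i it] : exists i, nth x0 (l k) i = t.
  elim: (l k) tl => //= y l' IH [->|/IH[i <-]]; first by exists 0.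
  by exists i.+1.
by exists (pickle (k, i)); rewrite pickleK it; exact: orb_sym.
Qed.

Lemma isolated_dense s D z : definable_over s D -> D z ->
  exists2 x, D x & isolated s x.
Proof.
move=> Ds Dz; apply: contrapT => nD.
have [c cP] := small_orbits_over s.
(* A decreasing sequence of nonempty definable subsets of [D] is built, step [k] avoiding the orbit
   of [c k]; a point common to all of them would lie in no orbit. The empty history stands for [D]
   itself. *)
pose cur (l : seq (set C)) := if l is E :: _ then E else D.
have [||u uP] := build_sequence
  (P := fun l => [/\ definable_over s (cur l), exists x, cur l x & cur l `<=` D])
  (Q := fun l E => E `<=` cur l /\ forall w, E w -> ~ orb s (c (size l)) w).
- by split=> //; exists z.
- move=> l [Es [x Ex] ED]; move: (cur l) Es Ex ED => E Es Ex ED.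
  have [[w0 Ew0 cw0]|nw] := pselect (exists2 w, E w & orb s (c (size l)) w); last first.
    exists E; split; first by split=> //; exists x.
    by split=> // w Ew cw; apply: nw; exists w.
  have [w1 [Ew1 nw1]] : exists w1, E w1 /\ ~ orb s w1 w0.
    apply: contrapT => H; apply: nD; exists w0; first exact: ED.
    apply: (eq_definable _ Es) => w; split=> [Ew|w0w]; last exact/(definable_orb Es w0w).
    by apply: orb_sym; apply: contrapT => nw; apply: H; exists w.
  have [E' [Es' Ew1' nEw0]] := separation HC nw1.
  exists (fun w => E w /\ E' w); split.
    split; [exact: definable_and|by exists w1|by move=> w [/ED]].
  split=> [w []//|w [_ Ew] cw]; apply: nEw0.
  by apply/(definable_orb Es' _)/Ew; exact: orb_trans (orb_sym cw0) cw.
have sub i k : i <= k -> cur (prefix_of u k) `<=` cur (prefix_of u i).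
  elim: k => [|k IH]; first by rewrite leqn0 => /eqP->.
  rewrite leq_eqVlt => /orP[/eqP->//|]; rewrite ltnS => /IH IHk.
  by move=> x; have [_ [H _]] := uP k; move=> /H /IHk.
have [||x xP] := @saturation L T C HC s [set E | exists k, E = cur (prefix_of u k)].
- by move=> _ [k ->]; have [[]] := uP k.
- move=> l lF; have [k kP] : exists k, forall E, List.In E l -> cur (prefix_of u k) `<=` E.
    elim: l lF => [|E l IH] lF; first by exists 0.
    have [|k kP] := IH; first by move=> E' El; apply: lF; right.
    have [k' E'] := lF E (or_introl erefl).
    exists (maxn k k') => E1 [<-|El]; first by rewrite E'; apply: sub; exact: leq_maxr.
    by apply: subset_trans (kP _ El); apply: sub; exact: leq_maxl.
  by have [[_ [x xk] _] _] := uP k; exists x => E /kP; apply.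
have [k ckx] := cP x.
have ux : cur (prefix_of u k.+1) x by apply: xP; exists k.+1.
by have [_ [_ /(_ _ ux)]] := uP k; rewrite size_prefix_of.
Qed.

End Density.
End Isolated.

(** * Types that are not convex *)

Section NonConvex.
Variables (L : language) (T : theory L) (C : structure L).
Hypothesis HC : monster_model T C.
Hypothesis Hcat : almost_aleph0_categorical T.
Variable theta : form L 2.
Local Notation lt := (@theta_lt L C theta).
Hypothesis lt_lin : strict_linear_order lt.
Hypothesis Hwqom : forall D : set C, par_definable D ->
  boolean_combination (@zero_definable L C `|` convex_set lt) D.
Variable y0 : C.
Hypothesis nonconvex : ~ convex_type theta y0.
Implicit Types (s : seq C) (D : set C).

Local Notation orb := (@orb L C).
Local Notation P := (orb [::] y0).

Let conv := wqom_convex_orbits HC Hcat lt_lin Hwqom.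
Let inv := @lt_invariant L C theta.
Let total x y := order_total lt_lin x y.
Let trans := @order_trans L C lt lt_lin.
Let irr := @order_irr L C lt lt_lin.

Definition between x d y : Prop := (lt x d /\ lt d y) \/ (lt y d /\ lt d x).

Definition locally_isolated x y : Prop :=
  exists2 D, definable_over [::] D /\ (forall z, P z -> D z) &
    forall d, D d -> between x d y -> P d.
Local Notation E := locally_isolated.

Lemma E_refl x : E x x.
Proof.
exists (fun _ => True); first by split => //; exact: definable_true.
by move=> d _ [[xd dx]|[xd dx]]; case: (irr (trans xd dx)).
Qed.

Lemma E_sym x y : E x y -> E y x.
Proof. by move=> [D HD DP]; exists D => // d Dd [H|H]; apply: DP => //; [right|left]. Qed.

Lemma E_trans y x z : P y -> E x y -> E y z -> E x z.
Proof.
move=> Py [D [Ds PD] DP] [D' [Ds' PD'] DP'].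
exists (fun d => D d /\ D' d); first by split; [exact: definable_and|move=> w Pw; split; auto].
move=> d [Dd Dd'] bd; have [dy|->//|yd] := total d y; case: bd => -[r1 r2].
- by apply: DP => //; left.
- by apply: DP' => //; right.
- by apply: DP' => //; left.
- by apply: DP => //; right.
Qed.

Lemma P_image f x : isomorphism f -> P x <-> P (f x).
Proof.
move=> fi; have xf : orb [::] x (f x) by exact: fixes_orb.
by split=> H; apply: orb_trans H _; [|exact: orb_sym].
Qed.

Lemma E_image f x y : isomorphism f -> E x y -> E (f x) (f y).
Proof.
move=> fi [D [Ds PD] DP]; have [g [gi fK gK]] := isomorphism_inv fi.
exists D => // d Dd bd; apply/(P_image _ gi); apply: DP.
  exact/(definable_fixes d Ds gi).
by case: bd => -[/(inv gi) + /(inv gi)]; rewrite !fK => ? ?; [left|right].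
Qed.

Lemma E_imageP f x y : isomorphism f -> E x y <-> E (f x) (f y).
Proof.
move=> fi; split; first exact: E_image.
have [g [gi fK gK]] := isomorphism_inv fi.
by move=> /(E_image gi); rewrite !fK.
Qed.

Lemma E_conj s x z w : List.In x s -> orb s z w -> E x z <-> E x w.
Proof.
by move=> xs [f [fi fs <-]]; rewrite (E_imageP x z fi) (fs x xs).
Qed.

Lemma E_convex x y z : E x z -> lt x y -> lt y z -> E x y /\ E y z.
Proof.
move=> [D HD DP] xy yz; split; exists D => // d Dd [[r1 r2]|[r1 r2]]; apply: DP => //.
- by left; split => //; exact: trans yz.
- by case: (irr (trans (trans xy r1) r2)).
- by left; split => //; exact: trans r1.
- by case: (irr (trans (trans yz r1) r2)).
Qed.

Lemma E_lt x y x' y' : P x -> P y -> P x' -> P y' -> lt x y -> ~ E x y ->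
  E x x' -> E y y' -> lt x' y'.
Proof.
move=> Px Py Px' Py' xy nE Exx' Eyy'.
have nE' : ~ E x' y' by move=> H; apply: nE; apply: E_trans (E_trans Px' Exx' H) (E_sym Eyy').
have [//|x'y'|y'x'] := total x' y'; first by case: nE'; rewrite x'y'; exact: E_refl.
have [yx'|yx'|x'y] := total y x'.
- by case: nE; have [] := E_convex Exx' xy yx'.
- by case: nE; rewrite yx'.
- by case: nE'; apply: E_sym; have [] := E_convex (E_sym Eyy') y'x' x'y.
Qed.

(** If all pairs were equivalent, each of the finitely many 2-types of pairs in the 1-type would
    supply a formula, and the conjunction of these formulas would show the 1-type to be convex. *)
Lemma E_not_total : exists x y, [/\ P x, P y & ~ E x y].
Proof.
apply: contrapT => H; apply: nonconvex.
have tot x y : P x -> P y -> E x y by move=> Px Py; apply: contrapT => n; apply: H; exists x, y.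
have [l lP] := finite_orbits_tuple HC Hcat (env2 y0 y0) [::].
have [D [Ds PD] DP] : exists2 D, definable_over [::] D /\ (forall z, P z -> D z) &
    forall t : fin 2 -> C, List.In t l -> P (t None) -> P (t (Some None)) ->
      forall d, D d -> between (t None) d (t (Some None)) -> P d.
  elim: l {lP} => [|t l [D [Ds PD] DP]].
    by exists (fun _ => True) => //; split => //; exact: definable_true.
  have [[P0 P1]|nP] := pselect (P (t None) /\ P (t (Some None))); last first.
    by exists D => // t' [<- P0 P1|]; [case: nP|exact: DP].
  have [D' [Ds' PD'] DP'] := tot _ _ P0 P1.
  exists (fun d => D d /\ D' d); first by split; [exact: definable_and|move=> w Pw; split; auto].
  by move=> t' [<- _ _ d [_ /DP']|t'l P0' P1' d [Dd _]]; [exact|exact: DP].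
exists D => // u d v Pu Pv ud dv Dd.
have [|t [tl tP [f [fi _ ft]]]] := lP (env2 u v).
  by case=> [i|]; [exact: Pv|exact: Pu].
have := ft None; have := ft (Some None) => /= f1 f0.
apply/(P_image _ fi); apply: (DP t tl); rewrite -?f1 -?f0.
- exact/(P_image u fi).
- exact/(P_image v fi).
- exact/(definable_fixes d Ds fi).
- by left; split; exact: inv.
Qed.

(** If one class were cofinal in the type, all would be, by homogeneity; classes being convex, there
    would be only one. *)
Lemma E_bounded x : P x -> exists2 v, P v & forall x', P x' -> E x x' -> lt x' v.
Proof.
move=> Px; apply: contrapT => nb; have [a [b [Pa Pb nE]]] := E_not_total.
have cof y v : P y -> P v -> exists x', [/\ P x', E y x' & ~ lt x' v].
  move=> Py Pv; apply: contrapT => H; apply: nb.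
  have [f [fi _ fy]] : orb [::] y x := orb_trans (orb_sym Py) Px.
  exists (f v); first exact/(P_image v fi).
  have [g [gi fK gK]] := isomorphism_inv fi.
  move=> x' Px' Exx'; rewrite -[x']gK; apply: inv fi _; apply: contrapT => n; apply: H.
  by exists (g x'); split; [exact/(P_image x' gi)|rewrite -[y]fK fy; exact: E_image|].
have Elt c d : P c -> P d -> lt c d -> E c d.
  move=> Pc Pd cd; have [x' [Px' Ecx' nx'd]] := cof c d Pc Pd.
  have [//|<-//|dx'] := total x' d.
  by have [] := E_convex Ecx' cd dx'.
apply: nE; have [ab|->|ba] := total a b; [exact: Elt|exact: E_refl|].
by apply: E_sym; exact: Elt.
Qed.

(** The convex hull of the orbit minus the orbit is definable over [s], and by convexity of orbits
    it contains no element of the 1-type; by compactness some formula of the 1-type avoids it. *)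
Lemma isolated_E s z w : P z -> isolated s z -> orb s z w -> E z w.
Proof.
move=> Pz iz zw.
pose hull x := exists o, exists o', [/\ orb s z o, orb s z o', lt o x & lt x o'].
have lt2 : definable2_over s lt := definable2_form s theta.
have hullE x : hull x <-> (exists o, orb s z o /\ lt o x) /\ (exists o', orb s z o' /\ lt x o').
  by split=> [[o [o' [? ? ? ?]]]|[[o [? ?]] [o' [? ?]]]]; [split; [exists o|exists o']|exists o, o'].
have hulld : definable_over s hull.
  suff : definable_over s (fun x => (exists o, orb s z o /\ lt o x) /\ (exists o', orb s z o' /\ lt x o')).
    by apply: eq_definable => x; rewrite hullE.
  apply: definable_and; apply: definable_ex; apply: definable2_and; try exact: definable2_left.
    by [].
  exact: definable2_swap.
pose F : set (set C) := [set D | (D = fun x => hull x /\ ~ orb s z x) \/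
  (definable_over [::] D /\ forall x, P x -> D x)].
have [[x xF]|nF] := pselect (exists x, forall D, F D -> D x).
  have [[o [o' [zo zo' ox xo']]] nzx] 
    := xF (fun x => hull x /\ ~ orb s z x) (or_introl erefl).
  have Px : P x.
    apply: contrapT => /(separation HC)[D [Ds Dy Dx]]; apply: Dx; apply: xF; right.
    by split=> // u /(definable_orb Ds) [H _]; exact: H.
  case: nzx; apply: (orb_trans zo); apply: conv ox xo'.
    exact: orb_trans (orb_sym zo) zo'.
  apply: orb_trans Px; apply: orb_sym; exact: orb_trans Pz (orb0 zo).
have [l lF lP] : exists2 l : seq (set C), (forall D, List.In D l -> F D) &
    forall x, ~ forall D, List.In D l -> D x.
  apply: contrapT => H; apply: nF; apply: (saturation HC (s := s)).
    move=> D [->|[Ds _]]; last by apply: definable_incl Ds.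
    by apply: definable_and => //; exact: definable_not.
  move=> l lF; apply: contrapT => H'; apply: H; exists l => // x xP.
  by apply: H'; exists x.
have [D0 [Ds0 PD0] D0P] : exists2 D0, definable_over [::] D0 /\ (forall x, P x -> D0 x) &
    forall x, D0 x -> hull x -> orb s z x.
  have [D0 HD0 D0P] : exists2 D0, definable_over [::] D0 /\ (forall x, P x -> D0 x) &
      forall x, D0 x -> hull x /\ ~ orb s z x -> forall D, List.In D l -> D x.
    elim: l lF {lP} => [|D l IH] lF.
      by exists (fun _ => True) => //; split=> //; exact: definable_true.
    have [|D0 [Ds0 PD0] D0P] := IH; first by move=> D' Dl; apply: lF; right.
    have [->|[Ds PD]] := lF D (or_introl erefl).
      by exists D0 => // x Dx bx D' [<-//|]; exact: D0P.
    exists (fun x => D0 x /\ D x).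
      by split; [exact: definable_and|move=> x Px; split; auto].
    by move=> x [D0x Dx] bx D' [<-//|]; exact: D0P.
  by exists D0 => // x D0x hx; apply: contrapT => nzx; apply: (lP x (D0P x D0x _)).
exists D0 => // d D0d bd; apply: orb_trans Pz (orb0 (D0P d D0d _)).
by case: bd => -[r1 r2]; [exists z, w|exists w, z]; split => //; exact: orb_refl.
Qed.

Lemma iterate_E s a b : P a -> orb s a b -> isolated (a :: s) b -> E a b.
Proof.
move=> Pa [f [fi fs <-]] ib.
have iso := isolated_iter HC Hcat fi fs ib.
have itfi n : isomorphism (iter n f).
  by elim: n => [|n IH] /=; [exact: isomorphism_id|exact: isomorphism_comp].
have Pit n : P (iter n f a) by apply/(P_image a (itfi n)).
have mono (r : C -> C -> Prop) : strict_linear_order r -> invariant_order r -> r a (f a) ->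
    forall m n, m < n -> r (iter m f a) (iter n f a).
  move=> rl ri ra m; elim=> // n IH; rewrite ltnS leq_eqVlt.
  have st : r (iter n f a) (iter n.+1 f a) by rewrite iterSr; exact: ri.
  by move=> /orP[/eqP->//|/IH H]; exact: (order_trans rl H st).
have [l lP] := finite_orbits HC Hcat (a :: s) a.
(* The iterates are isolated over [a :: s] and meet finitely many orbits, so two of them are
   conjugate and hence equivalent. Convexity makes the [m]-th and the next one equivalent, and these
   are carried back to [a] and [f a]. *)
have [|m [n [y [mn Rm Rn]]]] := pigeonhole (R := fun x y => orb (a :: s) x y) (l := l) (u := fun n => iter n f a).
  by move=> n; apply: lP; exact: orb_trans (orb_sym Pa) (Pit n).
have Emn : E (iter m f a) (iter n f a).
  apply: isolated_E (Pit m) (iso m) _; exact: orb_trans Rm (orb_sym Rn).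
apply/(E_imageP a (f a) (itfi m)); rewrite -iterSr.
have [mE|nmn] := eqVneq m.+1 n; first by rewrite mE.
have mn' : m.+1 < n by rewrite ltn_neqAle nmn.
have [ra|faE|ra] := total a (f a).
- have mono' := mono _ lt_lin inv ra.
  by have [] := E_convex Emn (mono' _ _ (ltnSn m)) (mono' _ _ mn').
- by rewrite iterSr -faE; exact: E_refl.
- have fi' : invariant_order (fun x y => lt y x) by move=> g ? ? gi; exact: inv.
  have mono' := mono _ (strict_linear_order_flip lt_lin) fi' ra.
  have [_ H] := E_convex (E_sym Emn) (mono' _ _ mn') (mono' _ _ (ltnSn m)).
  exact: E_sym.
Qed.

(** ** Generic sequences *)

(* A Morley sequence of the right end of the type, the latest element first. *)
Fixpoint generic l : Prop :=
  if l is a :: l' then [/\ P a, cofinal_orbit lt l' a & generic l'] else True.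

Lemma generic_P l c : generic l -> List.In c l -> P c.
Proof. by elim: l => //= a l IH [Pa _ gl] [<-//|]; exact: IH. Qed.

(** Otherwise each of the finitely many orbits over [s] in the type is bounded, and one element of
    the type would lie above all of them, itself included. *)
Lemma cofinal_exists s : exists2 a, P a & cofinal_orbit lt s a.
Proof.
apply: contrapT => H; have [l lP] := finite_orbits HC Hcat s y0.
have bd t : P t -> exists2 v, P v & forall w, orb s t w -> lt w v.
  move=> Pt; apply: contrapT => nv; apply: H; exists t => // v tv.
  apply: contrapT => nw; apply: nv; exists v; first exact: orb_trans tv.
  by move=> w tw; apply: contrapT => nwv; apply: nw; exists w.
have [v Pv vP] : exists2 v, P v & forall t, List.In t l -> P t -> forall w, orb s t w -> lt w v.
  elim: l {lP} => [|t l [v Pv vP]]; first by exists y0 => //; exact: orb_refl.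
  have [Pt|nPt] := pselect (P t); last by exists v => // t' [<-//|/vP].
  have [u Pu uP] := bd t Pt.
  have [uv|uv|vu] := total u v.
  - exists v => // t' [<- _ w /uP wu|]; [exact: trans uv|exact: vP].
  - by exists v => // t' [<- _ w /uP|]; [rewrite uv|exact: vP].
  - exists u => // t' [<- _|t'l Pt' w wt']; first exact: uP.
    by apply: trans vu; exact: (vP t').
have [t tl vt] := lP v Pv.
apply: (irr (vP t tl _ v (orb_sym vt))); exact: orb_trans Pv (orb0 vt).
Qed.

Lemma generic_extend l : generic l -> exists a, generic (a :: l).
Proof. by move=> gl; have [a Pa ca] := cofinal_exists l; exists a. Qed.

Lemma generic_exists n : exists2 l, size l = n & generic l.
Proof.
elim: n => [|n [l <- gl]]; first by exists [::].
by have [a ga] := generic_extend gl; exists (a :: l).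
Qed.

Lemma cofinal_image f s a : isomorphism f -> cofinal_orbit lt s a ->
  cofinal_orbit lt (map f s) (f a).
Proof.
move=> fi cof v fav; have [g [gi fK gK]] := isomorphism_inv fi.
have [|w aw nw] := cof (g v).
  by have := orb_image gi fav; rewrite fK.
exists (f w); first exact: orb_image.
by move=> /(inv gi); rewrite fK.
Qed.

Lemma generic_image f l : isomorphism f -> generic l -> generic (map f l).
Proof.
move=> fi; elim: l => //= a l IH [Pa ca /IH gl].
by split => //; [exact/(P_image a fi)|exact: cofinal_image].
Qed.

(** At each step there is only one cofinal orbit, so the conjugating map extends. *)
Lemma generic_conj l l' : generic l -> generic l' -> size l = size l' ->
  exists2 f, isomorphism f & map f l = l'.
Proof.
elim: l l' => [|a l IH] [|a' l'] //=; first by exists id => //; exact: isomorphism_id.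
move=> [Pa ca gl] [Pa' ca' gl'] [] /(IH _ gl gl') [f fi fl].
have [g [gi gs ga]] : orb l' (f a) a'.
  apply: (cofinal_unique lt_lin conv) => //; first by rewrite -fl; exact: cofinal_image.
  by apply: orb_trans Pa'; apply: orb_sym; apply/(P_image a fi).
exists (g \o f); first exact: isomorphism_comp.
by rewrite /= ga map_comp fl; congr cons; apply/map_idIn.
Qed.

Lemma generic_remove l1 x l2 : generic (l1 ++ x :: l2) -> generic (l1 ++ l2).
Proof.
elim: l1 => [[]//|a l1 IH] /= [Pa ca /IH gl]; split => //.
apply: cofinal_incl ca; apply: incl_cat2 => //; exact: incl_cons.
Qed.

(** A generic sequence with one more element, deprived of its element in the right position, is
    conjugate to the given one; the conjugating map carries the removed element into the gap. *)
Lemma generic_insert l1 l2 : generic (l1 ++ l2) -> exists x, generic (l1 ++ x :: l2).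
Proof.
move=> gl; have [l sl gl'] := generic_exists (size (l1 ++ l2)).+1.
pose u := take (size l1) l; have su : size u = size l1.
  by rewrite size_takel// sl size_cat leqW// leq_addr.
have [x [v [lE sv]]] : exists x v, l = u ++ x :: v /\ size v = size l2.
  have : size (drop (size l1) l) = (size l2).+1.
    by rewrite size_drop sl size_cat -addnS addKn.
  case E : (drop (size l1) l) => [//|x v] [sv]; exists x, v; split => //.
  by rewrite -E cat_take_drop.
have guv : generic (u ++ v) by apply: (@generic_remove u x); rewrite -lE.
have [|f fi] := generic_conj guv gl; first by rewrite !size_cat su sv.
rewrite map_cat => /cat_inj cE; have [|fu fv] := cE; first by rewrite size_map.
exists (f x); have := generic_image fi gl'; by rewrite lE map_cat /= fu fv.
Qed.

(** The orbit of [a] over [l] is cofinal, whereas the class of [c] is bounded and invariant over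
    [l]. Were [c] above [a], it would lie in the orbit of [a] over [l], although it is itself one of
    the parameters. *)
Lemma generic_head a l c : generic (a :: l) -> List.In c l -> lt c a /\ ~ E c a.
Proof.
move=> [Pa ca gl] cl; have Pc := generic_P gl cl.
have nE : ~ E c a.
  move=> Eca; have [v Pv vP] := E_bounded Pc.
  have [|w aw nwv] := ca v; first exact: orb_trans (orb_sym Pa) Pv.
  apply: nwv; apply: vP; first exact: orb_trans Pa (orb0 aw).
  exact/(E_conj cl aw).
split=> //; have [//|E0|ac] := total c a; first by case: nE; rewrite E0; exact: E_refl.
case: nE; have /orb_sym /(orb_In cl) -> : orb l a c; last exact: E_refl.
apply: (cofinal_final lt_lin conv ca (orb_refl _ _)) ac.
exact: orb_trans (orb_sym Pa) Pc.
Qed.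

(** If [b] were not below [a] it would lie in the cofinal orbit of [a]; but an isolated orbit stays
    inside one class of [E], which is bounded. *)
Lemma generic_bound a l b : generic (a :: l) -> P b -> isolated l b -> lt b a.
Proof.
move=> [Pa ca gl] Pb ib; apply: contrapT => nba.
have ab : orb l a b.
  have [//|->|ab] := total b a; first exact: orb_refl.
  apply: (cofinal_final lt_lin conv ca (orb_refl _ _)) ab.
  exact: orb_trans (orb_sym Pa) Pb.
have [v Pv vP] := E_bounded Pb.
have [|w aw nwv] := ca v; first exact: orb_trans (orb_sym Pa) Pv.
have bw : orb l b w := orb_trans (orb_sym ab) aw.
apply: nwv; apply: vP; first exact: orb_trans Pb (orb0 bw).
exact: isolated_E bw.
Qed.

(* A generic element inserted in the gap around [b] is conjugate to its
   neighbours, hence so is [b], by convexity. *)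
Lemma generic_gap l1 m1 m2 l2 b : generic (l1 ++ m1 :: m2 :: l2) -> lt m2 b -> lt b m1 ->
  P b -> isolated (l1 ++ m1 :: m2 :: l2) b -> E m2 b \/ E m1 b.
Proof.
move=> g m2b bm1 Pb ib.
have [x gx] : exists x, generic (l1 ++ m1 :: x :: m2 :: l2).
  have [|x] := @generic_insert (l1 ++ [:: m1]) (m2 :: l2); first by rewrite -catA.
  by rewrite -catA; exists x.
have gx1 : generic (l1 ++ m1 :: x :: l2).
  have := @generic_remove (l1 ++ [:: m1; x]) m2 l2; rewrite -!catA; exact.
have gx2 := generic_remove gx.
have c1 : orb (l1 ++ m1 :: l2) m2 x.
  have [|f fi] := generic_conj g gx1; first by rewrite !size_cat.
  rewrite map_cat => /cat_inj cE; have [|fl1 [fm1 fm2 fl2]] := cE; first by rewrite size_map.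
  exists f; split=> //; apply/map_idIn; by rewrite map_cat /= fl1 fm1 fl2.
have c2 : orb (l1 ++ m2 :: l2) m1 x.
  have [|f fi] := generic_conj g gx2; first by rewrite !size_cat.
  rewrite map_cat => /cat_inj cE; have [|fl1 [fm1 fm2 fl2]] := cE; first by rewrite size_map.
  exists f; split=> //; apply/map_idIn; by rewrite map_cat /= fl1 fm2 fl2.
have Pm c : List.In c (m1 :: m2 :: l2) -> P c.
  by move=> cm; apply: generic_P g _; apply: incl_catr.
have Pm1 : P m1 by apply: Pm; left.
have Pm2 : P m2 by apply: Pm; right; left.
have [bx|bx] : orb (l1 ++ m1 :: l2) m2 b \/ orb (l1 ++ m2 :: l2) m1 b.
  have [bx|->|xb] := total b x; [left|by left|right].
    by apply: conv c1 _ m2b bx; exact: orb_trans (orb_sym Pm2) Pb.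
  apply: (orb_trans c2); apply: conv (orb_sym c2) _ xb bm1.
  exact: orb_trans (orb0 (orb_sym c2)) (orb_trans (orb_sym Pm1) Pb).
- left; apply: iterate_E Pm2 bx _; apply: (isolated_incl HC Hcat _ ib).
  move=> y /In_cat[yl1|[<-|[<-|yl2]]].
  + by right; apply/In_cat; left.
  + by right; apply/In_cat; right; left.
  + by left.
  + by right; apply/In_cat; right; right.
- right; apply: iterate_E Pm1 bx _; apply: (isolated_incl HC Hcat _ ib).
  move=> y /In_cat[yl1|[<-|[<-|yl2]]].
  + by right; apply/In_cat; left.
  + by left.
  + by right; apply/In_cat; right; left.
  + by right; apply/In_cat; right; right.
Qed.

Lemma generic_cover a l b : generic (a :: l) -> P b -> isolated l b ->
  (exists2 c, List.In c l & ~ lt b c) -> exists2 c, List.In c (a :: l) & E c b.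
Proof.
move=> g Pb ib; have ba := generic_bound g Pb ib.
have {ib} : isolated (a :: l) b by apply: (isolated_incl HC Hcat _ ib); exact: incl_cons.
(* Walk down the sequence while [b] is below the next element; [l1] collects the elements passed and
   [b] stays below the current [a]. The gap that contains [b] is left to [generic_gap]. *)
move: g; rewrite -[a :: l]/([::] ++ a :: l); elim: l [::] a ba => [|m l IH] l1 a ba g ib [c].
  by [].
move=> cl nbc; have [bm|nbm] := pselect (lt b m).
  have [|||d dl Edb] := IH (l1 ++ [:: a]) m bm; rewrite -?catA//.
    by case: cl => [mc|cl]; [case: nbc; rewrite -mc|exists c].
  by exists d => //; move: dl; rewrite -catA.
have [//|bm|mb] := total b m.
  by exists m; [apply: incl_catr; right; left|rewrite bm; exact: E_refl].
case: (generic_gap g mb ba Pb ib) => [Emb|Eab].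
  by exists m => //; apply: incl_catr; right; left.
by exists a => //; apply: incl_catr; left.
Qed.

End NonConvex.

(** * Atomic models over a sequence *)

Section TarskiVaught.
Variables (L : language) (C : structure L) (A : set C).
Hypothesis A0 : exists x, A x.
Hypothesis TV : forall s (D : set C) z, (forall x, List.In x s -> A x) ->
  definable_over s D -> D z -> exists2 m, A m & D m.

(** The Tarski-Vaught condition for the singleton of the value gives closure under the functions. *)
Let A_fun (f : funsym L) (a : fin (farity f) -> {x | A x}) :
  A (finterp C f (fun i => sval (a i))).
Proof.
pose e i := sval (a i); pose s := map e (fin_enum (farity f)).
have [r rP] : {r : fin (farity f) -> fin (size s) & forall i, lenv s (r i) = e i}.
  apply: (choice (P := fun i k => lenv s k = e i)) => i; apply: In_lenv.
  by apply/In_map; exists i => //; exact: fin_enumP.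
have [||m Am <-] := TV (s := s) (D := fun x => x = finterp C f e) _ _ erefl => //.
  by move=> _ /In_map[i _ <-]; exact: svalP.
exists (Eq (Var (None : fin (size s).+1)) (App f (fun j => Var (Some (r j) : fin (size s).+1)))).
by move=> x /=; have -> : (fun j => lenv s (r j)) = e by exact/funext.
Qed.

Definition substructure : structure L :=
  @Structure L {x | A x}
    (match A0 with ex_intro x Ax => inhabits (exist _ x Ax) end)
    (fun f a => exist _ _ (A_fun a))
    (fun r a => rinterp C r (fun i => sval (a i))).

Definition subval (x : substructure) : C := sval x.

Lemma substructure_elementary n (phi : form L n) (e : fin n -> substructure) :
  sat phi e <-> sat phi (subval \o e).
Proof.
have tE m (t : term L m) (d : fin m -> substructure) :
    subval (teval d t) = teval (subval \o d) t.
  elim: t => //= f ts IH; congr (finterp C f _); apply/funext => j; exact: IH.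
elim: n / phi e => [n t u|n r ts|n phi IH|n phi IH psi IH'|n phi IH] e /=.
- rewrite -!tE; split=> [->//|]; move: (teval e t) (teval e u) => [x Ax] [y Ay] /= xy.
  by move: Ay; rewrite -[y]xy => Ay; congr exist; exact: Prop_irrelevance.
- have -> : (fun i => sval (teval e (ts i))) = (fun j => teval (subval \o e) (ts j)).
    by apply/funext => i; exact: tE.
  by [].
- by rewrite IH.
- by rewrite IH IH'.
- split=> -[a aP]; first by exists (subval a); rewrite -comp_scons -IH.
  pose s := map (subval \o e) (fin_enum n).
  have [r rP] : {r : fin n -> fin (size s) & forall i, lenv s (r i) = subval (e i)}.
    apply: (choice (P := fun i k => lenv s k = subval (e i))) => i; apply: In_lenv.
    by apply/In_map; exists i => //; exact: fin_enumP.
  have rE : lenv s \o r = subval \o e by exact/funext.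
  have [||m Am mP] := TV (s := s) (D := fun x => sat phi (scons x (subval \o e))) _ _ aP.
  + by move=> _ /In_map[i _ <-]; exact: svalP.
  + by exists (fren (finlift r) phi) => x; rewrite sat_fren scons_finlift rE.
  + by exists (exist _ m Am); rewrite IH comp_scons.
Qed.

End TarskiVaught.

Section Atomic.
Variables (L : language) (T : theory L) (C : structure L).
Hypothesis HL : countable_language L.
Hypothesis HC : monster_model T C.
Hypothesis Hcat : almost_aleph0_categorical T.
Hypothesis small : countable (types T 1).
Implicit Types (s : seq C) (D : set C).

Local Notation orb := (@orb L C).

Lemma definable_enum : exists dn : seq C -> nat -> set C,
  (forall s n, definable_over s (dn s n)) /\
  forall s D, definable_over s D -> exists n, dn s n = D.
Proof.
have [dn dnP] : {dn : seq C -> nat -> set C & forall s, (forall n, definable_over s (dn s n)) /\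
    forall D, definable_over s D -> exists n, dn s n = D}.
  apply: (choice (P := fun s dn => (forall n, definable_over s (dn n)) /\
    forall D, definable_over s D -> exists n, dn n = D)) => s.
  have [|en enP] := countable_enum (countable_formulas (size s).+1 HL).
    by constructor; exact: (Eq (Var (None : fin (size s).+1)) (Var (None : fin (size s).+1))).
  exists (fun n x => sat (en n) (scons x (lenv s))); split=> [n|D [phi phiP]].
    by exists (en n).
  by have [n nE] := enP phi; exists n; apply/funext => x; apply/propext; rewrite nE phiP.
by exists dn; split=> s; have [] := dnP s.
Qed.

(* A type over a finite set has finitely many extensions to a larger one, so
   isolated types stay isolated when further elements of the sequence come in. *)
Lemma atomic_sequence (X : nat -> C) : exists c : nat -> C,
  [/\ forall k, exists i, c i = X k,
      forall s D z, (forall x, List.In x s -> exists i, c i = x) ->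
        definable_over s D -> D z -> exists i, D (c i) &
      forall i, exists k, isolated (prefix_of X k) (c i)].
Proof.
have [dn [dnd dnP]] := definable_enum.
(* At stage [2 k], where [k] codes [(i, j, m)], the task is to meet the [j]-th set definable over
   the first [i] elements; [m] makes every task recur at arbitrarily late stages. As the newest
   element comes first, [drop (size l - i) l] consists of the first [i] ones. Odd stages insert the
   members of [X]. *)
pose task (l : seq C) : set C := if (unpickle (size l)./2 : option (nat * nat * nat)) is Some (i, j, _)
  then dn (drop (size l - i) l) j else setT.
have [//||u uP] := build_sequence (P := fun _ => True) (Q := fun l x =>
  if odd (size l) then x = X (size l)./2
  else isolated l x /\ ((exists z, task l z) -> task l x)).
  move=> l _; case: (odd _); first by exists (X (size l)./2).
  have [[z zP]|nz] := pselect (exists z, task l z); last first.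
    have [x0] := carrier_inhabited C.
    have [x _ ix] := isolated_dense HC Hcat small (definable_true l) (I : (fun _ => True) x0).
    by exists x.
  have dt : definable_over l (task l).
    rewrite /task; case: unpickle => [[[i j] m]|]; last exact: definable_true.
    apply: definable_incl (dnd _ j) => x xd.
    suff : List.In x (take (size l - i) l ++ drop (size l - i) l) by rewrite cat_take_drop.
    by apply/In_cat; right.
  by have [x tx ix] := isolated_dense HC Hcat small dt zP; exists x.
have Qu k : if odd k then u k = X k./2 else isolated (prefix_of u k) (u k) /\
    ((exists z, task (prefix_of u k) z) -> task (prefix_of u k) (u k)).
  by have [_] := uP k; rewrite size_prefix_of.
have taskE (i j m : nat) : i <= pickle (i, j, m) ->
    task (prefix_of u (pickle (i, j, m)).*2) = dn (prefix_of u i) j.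
  move=> ik; have pK : unpickle (pickle (i, j, m)) = Some (i, j, m) by exact: pickleK.
  rewrite /task size_prefix_of doubleK; move: (pickle _) ik pK => k ik ->.
  by rewrite prefix_of_drop// -addnn (leq_trans ik)// leq_addr.
(* Parameters from [u] are traded for parameters from [X]: elements of odd stages belong to [X], and
   those of even stages are isolated over earlier ones. *)
have inX k s z : isolated (prefix_of u k ++ s) z -> isolated (prefix_of X k ++ s) z.
  elim: k s z => [//|k IH] s z /= iz.
  have XS t : incl (prefix_of X k ++ t) (X k :: prefix_of X k ++ t) by exact: incl_cons.
  have := Qu k; case: ifP => ok.
    move=> uX; apply: (isolated_incl HC Hcat (s := prefix_of X k ++ u k :: s)); last first.
      apply: IH; apply: (isolated_incl HC Hcat _ iz).
      move=> x [<-|/In_cat[xk|xs]]; apply/In_cat; [right; left|left|right; right] => //.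
    move=> x /In_cat[xk|[<-|xs]].
    - by right; apply/In_cat; left.
    - change (List.In (u k) (prefix_of X k.+1 ++ s)); apply/In_cat; left.
      by apply/In_prefix_of; exists k./2 => //; rewrite ltnS leq_half_double leqW// -addnn leq_addl.
    - by right; apply/In_cat; right.
  move=> [iu _]; apply: (isolated_incl HC Hcat (XS s)); apply: IH.
  apply: isolated_trans (isolated_incl HC Hcat _ iu) iz; exact: incl_catl.
exists u; split.
- by move=> k; exists k.*2.+1; have := Qu k.*2.+1; rewrite /= odd_double/= uphalf_double.
- move=> s D z su Ds Dz.
  have [n sn] : exists n, incl s (prefix_of u n).
    elim: s su {Ds} => [|x s IH] su; first by exists 0.
    have [|n sn] := IH; first by move=> y ys; apply: su; right.
    have [i ix] := su x (or_introl erefl).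
    exists (maxn i.+1 n) => y [<-|/sn/In_prefix_of[k kn <-]]; apply/In_prefix_of.
      by exists i => //; exact: leq_maxl.
    by exists k => //; apply: leq_trans kn (leq_maxr _ _).
  have [j jD] := dnP _ _ (definable_incl sn Ds).
  have [|m nm] := @injective_unbounded (fun m : nat => pickle (n, j, m)) n.
    by move=> m m' /(pcan_inj pickleK) [].
  exists (pickle (n, j, m)).*2; have := Qu (pickle (n, j, m)).*2.
  by rewrite odd_double taskE// jD => -[_]; apply; exists z.
- move=> i; exists i.+1; rewrite -[prefix_of _ _]cats0; apply: inX.
  by apply: (isolated_In); left.
Qed.

End Atomic.

(** * Coding sets of natural numbers by linear orders *)

(* The blocks, indexed by the first coordinate, have in turn order type
   omega, n + 1 and omega^*. *)
Definition prec (x y : nat * nat) : bool :=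
  (x.1 < y.1) || ((x.1 == y.1) && 
    (if x.1 %% 3 == 2 then y.2 < x.2 else x.2 < y.2)).

Lemma precE m i n j : prec (m, i) (n, j) =
  (m < n) || ((m == n) && ((m %% 3 == 2) && (j < i) || (m %% 3 != 2) && (i < j))).
Proof. by rewrite /prec /=; case: (_ == 2); rewrite ?andbF ?orbF. Qed.

(** Blocks of type omega and omega^* are always present and keep the finite blocks apart; block
    [3 n + 1] has [n + 1] elements and is present just when [S n] holds. *)
Definition coded (S : set nat) (x : nat * nat) : Prop :=
  x.1 %% 3 = 1 -> S (x.1 %/ 3) /\ x.2 <= x.1 %/ 3.

Lemma prec_irr : irreflexive prec.
Proof. by move=> x; rewrite /prec !ltnn eqxx; case: ifP. Qed.

Lemma prec_trans : transitive prec.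
Proof.
by move=> [b j] [a i] [c k]; rewrite !precE; lia.
Qed.

Lemma prec_total x y : [\/ prec x y, x = y | prec y x].
Proof.
move: x y => [a i] [b j]; rewrite /prec /=; have [ab|ab|<-] := ltngtP a b => /=.
- by constructor 1.
- by constructor 3.
have [ij|ij|<-] := ltngtP i j; last by constructor 2.
- by case: ifP => _; [constructor 3|constructor 1].
- by case: ifP => _; [constructor 1|constructor 3].
Qed.

Lemma coded_min S x : coded S x -> x = (0, 0) \/ prec (0, 0) x.
Proof.
move: x => [[|m] [|i]] _; [by left|by right|by right|by right].
Qed.

Lemma coded_unbounded S x : exists2 y, coded S y & prec x y.
Proof. by exists (x.1.+1 * 3, 0); [rewrite /coded /=; lia|rewrite /prec /=; lia]. Qed.

(** The finite condensation of the order coded by [S]; its finite classes are the finite blocks. *)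
Definition near S x y : Prop := exists l : seq (nat * nat), forall z, coded S z ->
  (prec x z && prec z y) || (prec y z && prec z x) -> z \in l.

Lemma near_block S m i j : near S (m, i) (m, j).
Proof.
exists [seq (m, k) | k <- iota 0 (maxn i j)] => -[a k] _; rewrite /prec /= => H.
have [am kij] : a = m /\ k < maxn i j.
  by move: H; have [am|am|->] := ltngtP a m => //=; case: ifP; lia.
by rewrite am; apply/mapP; exists k; rewrite // mem_iota.
Qed.

Lemma block_infinite (m c : nat) (l : seq (nat * nat)) : exists2 k, c <= k & (m, k) \notin l.
Proof.
apply: contrapT => H.
have sub : {subset [seq (m, k) | k <- iota c (size l).+1] <= l}.
  move=> _ /mapP[k + ->]; rewrite mem_iota => /andP[ck _].
  by apply: contrapT => /negP kl; apply: H; exists k.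
have un : uniq [seq (m, k) | k <- iota c (size l).+1].
  by rewrite map_inj_uniq ?iota_uniq// => i j [].
by have := uniq_leq_size un sub; rewrite size_map size_iota ltnn.
Qed.

Lemma near_finite_block S x y : near S x y -> x.1 %% 3 = 1 -> y.1 = x.1.
Proof.
move: x y => [m i] [b j] [l lP] /= m3.
have [bm|mb|//] := ltngtP b m.
(* The block before a finite one has type omega and the block after it has type omega^*, so
   infinitely many elements separate a finite block from all others. *)
- have [k jk /negP[]] := block_infinite m.-1 j.+1 l; apply: lP; rewrite /coded /=.
    by lia.
  by rewrite !precE; lia.
- have [k jk /negP[]] := block_infinite m.+1 j.+1 l; apply: lP; rewrite /coded /=.
    by lia.
  by rewrite !precE; lia.
Qed.

(** Membership in [S] in terms of the order alone: a condensation class with [n + 1] elements. *)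
Definition has_block S n : Prop := exists x l, [/\ coded S x, uniq l, size l = n.+1 &
  forall y, coded S y /\ near S x y <-> y \in l].

Lemma has_blockP S n : has_block S n <-> S n.
Proof.
have blockE m y : S (m %/ 3) -> m %% 3 = 1 -> (forall i, coded S y /\ near S (m, i) y <->
    y \in [seq (m, k) | k <- iota 0 (m %/ 3).+1]).
  move=> Sm m3 i; split.
    move: y => [a k] [cy /near_finite_block/(_ m3) am]; rewrite /= in am; subst a.
    by have [_ km] := cy m3; apply/mapP; exists k; rewrite // mem_iota.
  by move=> /mapP[k + ->]; rewrite mem_iota => /andP[_ kn]; split=> //; exact: near_block.
have blocku m k : uniq [seq (m, j) | j <- iota 0 k] by rewrite map_inj_uniq ?iota_uniq// => i j [].
split=> [[[m i] [l [cx ul sl lP]]]|Sn]; last first.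
  have n3 : (n * 3 + 1) %/ 3 = n by lia.
  have n1 : (n * 3 + 1) %% 3 = 1 by lia.
  exists (n * 3 + 1, 0), [seq (n * 3 + 1, k) | k <- iota 0 n.+1].
  split; rewrite ?size_map ?size_iota//; first by move=> _; rewrite /= n3.
  by move=> y; have := blockE (n * 3 + 1) y; rewrite n3 => /(_ Sn n1 0).
have [m3|/eqP m3] := eqVneq (m %% 3) 1; last first.
  have [k _ /negP[]] := block_infinite m 0 l; apply/lP; split; last exact: near_block.
  by move=> /= /m3.
have [/= Sm _] := cx m3.
suff /perm_size : perm_eq l [seq (m, k) | k <- iota 0 (m %/ 3).+1].
  by rewrite sl size_map size_iota => -[->].
apply: uniq_perm => // y; apply/idP/idP => [/lP|] /(blockE m y Sm m3 i)//.
by move=> /lP.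
Qed.

Lemma coded_transfer S S' (phi : nat * nat -> nat * nat) :
  (forall x, coded S x -> coded S' (phi x)) ->
  (forall x y, coded S x -> coded S y -> prec x y -> prec (phi x) (phi y)) ->
  (forall y, coded S' y -> exists2 x, coded S x & phi x = y) ->
  S `<=` S'.
Proof.
move=> phiS phi_lt phi_surj n /has_blockP[x [l [cx ul sl lP]]]; apply/has_blockP.
have phi_ltE y z : coded S y -> coded S z -> prec (phi y) (phi z) = prec y z.
  move=> cy cz; apply/idP/idP; last exact: phi_lt.
  move=> pyz; have [//|yz|zy] := prec_total y z; first by rewrite yz prec_irr in pyz.
  by have := prec_trans pyz (phi_lt _ _ cz cy zy); rewrite prec_irr.
have phi_inj y z : coded S y -> coded S z -> phi y = phi z -> y = z.
  move=> cy cz yz; have [pyz|//|pzy] := prec_total y z.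
    by have := phi_lt _ _ cy cz pyz; rewrite yz prec_irr.
  by have := phi_lt _ _ cz cy pzy; rewrite yz prec_irr.
have [psi psiP] : {psi : nat * nat -> nat * nat &
    forall y, coded S' y -> coded S (psi y) /\ phi (psi y) = y}.
  apply: (choice (P := fun y x => coded S' y -> coded S x /\ phi x = y)) => y.
  by have [/phi_surj[z cz zy]|nc] := pselect (coded S' y); [exists z|exists y].
have phiK y : coded S y -> psi (phi y) = y.
  by move=> cy; have [c1 c2] := psiP _ (phiS _ cy); exact: phi_inj.
have lc y : y \in l -> coded S y by move=> /lP[].
exists (phi x), (map phi l); split; rewrite ?size_map//.
- exact: phiS.
- by rewrite map_inj_in_uniq// => y z /lc cy /lc cz; exact: phi_inj.
move=> y; split=> [[cy [k kP]]|/mapP[z /lP[cz [k kP]] ->]].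
  have [cpy py] := psiP _ cy; rewrite -py; apply/map_f/lP; split => //.
  exists (map psi k) => z cz.
  rewrite -(phi_ltE x z)// -(phi_ltE z (psi y))// -(phi_ltE (psi y) z)// -(phi_ltE z x)// py => /(kP _ (phiS _ cz)).
  by move=> /(map_f psi); rewrite phiK.
split; first exact: phiS.
exists (map phi k) => w cw; have [cpw <-] := psiP _ cw; rewrite !phi_ltE//.
by move=> /(kP _ cpw) /(map_f phi).
Qed.

(** * Many models *)

(* As in Koenig's theorem: if every fibre of [code] were mapped to fewer than
   continuum many classes, a diagonal set would escape. *)
Lemma card_le_of_coding (U : Type) (A : set U) (F : set nat -> U) (code : set nat -> nat) :
  (forall S, A (F S)) -> (forall S S', F S = F S' -> code S = code S' -> S = S') ->
  [set: set nat] #<= A.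
Proof.
move=> AF inj.
(* For given [X] and [k] at most one [S] has [F S = X] and [code S = k]; [g k X] reads off its
   [k]-th column. *)
pose g (k : nat) X : set nat :=
  [set n : nat | exists S : set nat, [/\ F S = X, code S = k & S (pickle (k, n))]].
have [[k gk]|H] := pselect (exists k, forall B, exists2 X, A X & g k X = B).
  have -> : [set: set nat] = g k @` A by apply/seteqP; split=> // B _; exact: gk.
  exact: card_image_le.
have [B BP] : {B : nat -> set nat & forall k X, A X -> g k X <> B k}.
  apply: (choice (P := fun k B => forall X, A X -> g k X <> B)) => k.
  apply: contrapT => nB; apply: H; exists k => B.
  apply: contrapT => nX; apply: nB; exists B => X AX gB; apply: nX; by exists X.
(* The diagonal set: its [k]-th column [B k] is missed by [g k], in particular for [k = code S]. *)
pose S : set nat := [set m | exists k n : nat, m = pickle (k, n) /\ B k n].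
have SE (k n : nat) : S (pickle (k, n)) <-> B k n.
  split=> [[k' [n' [/(pcan_inj pickleK)[-> ->]]]]//|Bkn]; by exists k, n.
case: (BP (code S) (F S) (AF S)); apply/seteqP; split=> n.
  by move=> [S' [/inj e /e ->]] /SE.
by move=> /SE Sn; exists S.
Qed.

Definition decreasing : seq (nat * nat) -> bool := pairwise (fun x y => prec y x).

Lemma decreasing_sorted q : decreasing q = sorted (fun x y => prec y x) q.
Proof. by rewrite sorted_pairwise// => y x z xy yz; exact: prec_trans yz xy. Qed.

Lemma decreasing_eq q q' : decreasing q -> decreasing q' -> q =i q' -> q = q'.
Proof.
rewrite !decreasing_sorted; apply: irr_sorted_eq; last by move=> x; exact: prec_irr.
by move=> y x z xy yz; exact: prec_trans yz xy.
Qed.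

Lemma decreasing_insert x q : decreasing q -> x \notin q -> exists q1 q2,
  [/\ q = q1 ++ q2, decreasing (q1 ++ x :: q2) & q1 ++ x :: q2 =i x :: q].
Proof.
move=> dq xq; pose q1 := [seq y <- q | prec x y]; pose q2 := [seq y <- q | prec y x].
have d1 : decreasing q1 by apply: subseq_pairwise dq; exact: filter_subseq.
have d2 : decreasing q2 by apply: subseq_pairwise dq; exact: filter_subseq.
have qmem : q1 ++ q2 =i q.
  move=> y; rewrite mem_cat !mem_filter -andb_orl; case yq : (y \in q); rewrite ?andbF//.
  by have [->|yx|->] := prec_total x y; rewrite ?orbT//; rewrite yx yq in xq.
exists q1, q2; split.
- apply: decreasing_eq => //; rewrite /decreasing pairwise_cat; apply/and3P; split=> //.
  apply/allrelP => y z; rewrite !mem_filter => /andP[xy _] /andP[zx _].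
  exact: prec_trans zx xy.
- rewrite /decreasing pairwise_cat; apply/and3P; split=> //.
    apply/allrelP => y z; rewrite inE !mem_filter => /andP[xy _] /orP[/eqP->//|/andP[zx _]].
    exact: prec_trans zx xy.
  by rewrite pairwise_cons; apply/andP; split=> //; apply/allP => y; rewrite mem_filter => /andP[].
- by move=> y; rewrite mem_cat !inE orbCA -mem_cat qmem.
Qed.

Lemma decreasing_enum (l : seq (nat * nat)) : exists2 q, decreasing q & q =i l.
Proof.
elim: l => [|x l [q dq ql]]; first by exists [::].
have [xq|xq] := boolP (x \in q).
  exists q => // y; rewrite inE -ql; by case: eqP => // ->.
have [q1 [q2 [_ d m]]] := decreasing_insert dq xq.
by exists (q1 ++ x :: q2) => // y; rewrite m !inE ql.
Qed.

(** * Models coding sets of natural numbers *)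

Section Models.
Variables (L : language) (T : theory L) (C : structure L).
Hypothesis HL : countable_language L.
Hypothesis HC : monster_model T C.
Hypothesis Hcat : almost_aleph0_categorical T.
Variable theta : form L 2.
Local Notation lt := (@theta_lt L C theta).
Hypothesis lt_lin : strict_linear_order lt.
Hypothesis Hwqom : forall D : set C, par_definable D ->
  boolean_combination (@zero_definable L C `|` convex_set lt) D.
Variable y0 : C.
Hypothesis nonconvex : ~ convex_type theta y0.
Hypothesis small : countable (types T 1).
Implicit Types (s : seq C) (D : set C).

Local Notation orb := (@orb L C).
Local Notation P := (orb [::] y0).
Local Notation E := (locally_isolated theta y0).
Local Notation generic := (generic theta y0).

Lemma generic_subseq (I : eqType) (a : I -> C) q q' : subseq q q' ->
  generic (map a q') -> generic (map a q).
Proof.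
elim: q' q => [|y q' IH] [|x q] //=; case: eqP => [->|_] qq' [Pa ca g].
  split=> //; last exact: IH.
  apply: cofinal_incl ca => _ /In_map[z /mem_In zq <-]; apply/In_map; exists z => //.
  by apply/mem_In; exact: (mem_subseq qq').
exact: (IH (x :: q)) g.
Qed.

(** Pairs are treated in the order of their codes; each new one is placed in its gap among the
    earlier ones by [generic_insert]. *)
Lemma generic_family : exists a : nat * nat -> C, forall q, decreasing q -> generic (map a q).
Proof.
(* The element for [x] is added when the list has length [pickle x], and later elements come before
   it. Stages whose number codes no pair add the filler [y0]. *)
pose val (l : seq C) (x : nat * nat) := nth y0 l (size l - (pickle x).+1).
have val_cons c l x : pickle x < size l -> val (c :: l) x = val l x.
  by move=> xl; rewrite /val /= subSS -(subnSK xl).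
pose Pl l := exists q, [/\ decreasing q, forall x, (x \in q) = (pickle x < size l) &
  generic (map (val l) q)].
have [||u uP] := build_sequence (P := Pl) (Q := fun _ _ => True).
- by exists [::].
- move=> l [q [dq ql gq]].
  have [[x xl]|nx] := pselect (exists x : nat * nat, pickle x = size l); last first.
    exists y0; split=> //; exists q; split=> // [x|].
      rewrite ql /= ltnS [in RHS]leq_eqVlt; case: eqP => // xl; by case: nx; exists x.
    by move: gq; congr generic; apply/eq_in_map => x; rewrite ql => /(val_cons y0) ->.
  have [|q1 [q2 [qE d m]]] := decreasing_insert (x := x) dq.
    by rewrite ql xl ltnn.
  have [|c gc] := @generic_insert _ _ _ HC Hcat _ lt_lin Hwqom y0 (map (val l) q1) (map (val l) q2).
    by rewrite -map_cat -qE.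
  exists c; split=> //; exists (q1 ++ x :: q2); split=> // [y|].
    rewrite m inE ql /= [in RHS]ltnS [in RHS]leq_eqVlt -xl; congr (_ || _).
    by apply/eqP/eqP => [->//|/(pcan_inj pickleK)].
  have vx : val (c :: l) x = c by rewrite /val /= xl subnn.
  have vE q' : {subset q' <= q} -> map (val (c :: l)) q' = map (val l) q'.
    by move=> qq'; apply/eq_in_map => y /qq'; rewrite ql; exact: val_cons.
  rewrite map_cat /= vx !vE// => y yq; rewrite qE mem_cat yq ?orbT//.
exists (fun x => u (pickle x)) => q dq.
have [n qn] : exists n, forall x, x \in q -> pickle x < n.
  elim: q {dq} => [|x q [n IH]]; first by exists 0.
  exists (maxn (pickle x).+1 n) => y; rewrite inE => /orP[/eqP->|/IH yn].
    exact: leq_maxl.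
  exact: leq_trans yn (leq_maxr _ _).
have [[q0 [dq0 q0n g0]] _] := uP n; rewrite size_prefix_of in q0n.
have -> : map (fun x => u (pickle x)) q = map (val (prefix_of u n)) q.
  by apply/eq_in_map => x /qn xn; rewrite /val size_prefix_of nth_prefix_of.
apply: generic_subseq g0.
have -> : q = [seq x <- q0 | x \in q]; last exact: filter_subseq.
apply: decreasing_eq => //; first by apply: subseq_pairwise dq0; exact: filter_subseq.
by move=> x; rewrite mem_filter q0n; case xq : (x \in q) => //; rewrite qn.
Qed.

Let inv := @lt_invariant L C theta.
Let trans := @order_trans L C lt lt_lin.
Let irr := @order_irr L C lt lt_lin.

Section Family.
Variable a : nat * nat -> C.
Hypothesis a_generic : forall q, decreasing q -> generic (map a q).

Lemma family_P x : P (a x).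
Proof. by have [] := a_generic (q := [:: x]) isT. Qed.

Lemma family_lt x y : prec x y -> lt (a x) (a y) /\ ~ E (a x) (a y).
Proof.
move=> xy; have := a_generic (q := [:: y; x]); rewrite /decreasing /= xy => /(_ isT) g.
by apply: (generic_head HC Hcat lt_lin Hwqom nonconvex g); left.
Qed.

Lemma family_inj x y : E (a x) (a y) -> x = y.
Proof.
move=> Exy; have [/family_lt[_ []//]|//|/family_lt[_ []]] := prec_total x y.
exact: E_sym.
Qed.

Lemma family_ltP x y : lt (a x) (a y) -> prec x y.
Proof.
move=> xy; have [//|xE|/family_lt[yx _]] := prec_total x y.
  by move: xy; rewrite xE => /irr.
by case: (irr (trans xy yx)).
Qed.

Lemma family_cover (S : set nat) (l : seq (nat * nat)) b : (forall x, x \in l -> coded S x) ->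
  P b -> isolated (map a l) b -> ~ lt b (a (0, 0)) -> exists2 x, coded S x & E (a x) b.
Proof.
move=> lS Pb ib nb; have [q dq ql] := decreasing_enum ((0, 0) :: l).
have qS x : x \in q -> coded S x by rewrite ql inE => /orP[/eqP->|/lS].
(* [generic_cover] asks for a member of the sequence above all the parameters, and the coded order
   has no greatest element. The least one, [(0, 0)], was adjoined as a lower bound for [b]. *)
have [y yS yq] : exists2 y, coded S y & forall x, x \in q -> prec x y.
  case: q dq {ql qS} => [|x q]; first by exists (0, 0).
  move=> /andP[/allP xq _]; have [y yS xy] := coded_unbounded S x; exists y => // z.
  by rewrite inE => /orP[/eqP->//|/xq zx]; exact: prec_trans zx xy.
have g : generic (a y :: map a q).
  apply: (a_generic (q := y :: q)); rewrite /decreasing pairwise_cons; apply/andP; split=> //.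
  exact/allP.
have [||c + Ecb] := generic_cover HC Hcat lt_lin Hwqom nonconvex g Pb.
- apply: (isolated_incl HC Hcat _ ib) => _ /In_map[x /mem_In xl <-].
  by apply/In_map; exists x => //; apply/mem_In; rewrite ql inE xl orbT.
- exists (a (0, 0)) => //; apply/In_map; exists (0, 0) => //.
  by apply/mem_In; rewrite ql mem_head.
rewrite -map_cons => /In_map[x /mem_In + xc]; rewrite inE => xq.
by exists x; [case/orP: xq => [/eqP->|/qS]|rewrite xc].
Qed.

(** The trace of the coded order in the model: its points are the classes of [E] among the
    realizations of the type not below [u]. *)
Record codes (S : set nat) (M : structure L) (j : M -> C) (u : M) : Prop := Codes {
  codes_elementary : forall n (phi : form L n) (e : fin n -> M), sat phi e <-> sat phi (j \o e);
  codes_min : j u = a (0, 0);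
  codes_range : forall x, coded S x -> exists m, j m = a x;
  codes_cover : forall m, P (j m) -> ~ lt (j m) (a (0, 0)) -> exists2 x, coded S x & E (a x) (j m) }.

Lemma codes_exists S : exists (M : structure L) (j : M -> C) (u : M),
  [/\ model T M, countable_structure M & codes S j u].
Proof.
have c0 : coded S (0, 0) by [].
(* An enumeration of the coded members of the family; the least one is repeated where the index
   codes none of them. *)
pose X k := if unpickle k is Some x then (if pselect (coded S x) then a x else a (0, 0))
  else a (0, 0).
have XE k : exists2 x, coded S x & X k = a x.
  by rewrite /X; case: unpickle => [x|]; [case: pselect => cx; [exists x|exists (0, 0)]|exists (0, 0)].
have aX x : coded S x -> exists k, X k = a x.
  by move=> cx; exists (pickle x); rewrite /X pickleK; case: pselect.
have [c [cX TV iso]] := atomic_sequence HL HC Hcat small X.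
pose A : set C := [set x | exists i, c i = x].
have cA i : A (c i) by exists i.
have TVA s D z : (forall x, List.In x s -> A x) -> definable_over s D -> D z -> exists2 m, A m & D m.
  by move=> sA Ds Dz; have [i Di] := TV s D z sA Ds Dz; exists (c i).
pose M := substructure (ex_intro A _ (cA 0)) TVA.
pose j : M -> C := @subval L C A (ex_intro A _ (cA 0)) TVA.
have elem n (phi : form L n) (e : fin n -> M) : sat phi e <-> sat phi (j \o e).
  exact: substructure_elementary.
have jinj : injective j by move=> [x Ax] [y Ay] /= xy; exact: eq_exist.
have jA x : A x -> exists m, j m = x by move=> Ax; exists (exist _ x Ax).
have ja x : coded S x -> exists m, j m = a x.
  by move=> /aX[k <-]; apply: jA; exact: cX.
have [u ju] := ja _ c0.
exists M, j, u; split.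
- move=> phi Tphi; apply/elem; have -> : j \o env0 = env0 by apply/funext.
  exact: (HC.1 phi).
- apply/countable_codeP.
  have [f fP] : {f : M -> nat & forall m, c (f m) = j m}.
    by apply: (choice (P := fun m i => c i = j m)) => -[x Ax].
  by exists f => m m' fm; apply: jinj; rewrite -!fP fm.
split=> // -[x [i ix]] Px nx.
have [k ik] := iso i.
have [l lS lX] : exists2 l : seq (nat * nat), (forall x, x \in l -> coded S x) &
    prefix_of X k = map a l.
  elim: k {ik} => [|k [l lS lX]]; first by exists [::].
  have [y cy Xy] := XE k; exists (y :: l); last by rewrite /= Xy lX.
  by move=> z; rewrite inE => /orP[/eqP->//|/lS].
rewrite lX ix in ik; exact: family_cover lS Px ik nx.
Qed.

(** The isomorphism respects the 1-type, the order and [E], and, as it matches [u] with [u'], the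
    part not below the first element. So it induces an isomorphism between the orders of classes, to
    which [coded_transfer] applies. *)
Lemma codes_sub S S' (M M' : structure L) (j : M -> C) (j' : M' -> C) u u' (h : M -> M') :
  codes S j u -> codes S' j' u' -> isomorphism h -> h u = u' -> S `<=` S'.
Proof.
move=> cM cM' hi hu.
(* By homogeneity, [h] agrees with an automorphism of the monster model on any two elements; this
   transports [lt] and [E]. *)
have pair (m m' : M) : exists f, [/\ isomorphism f, f (j m) = j' (h m) & f (j m') = j' (h m')].
  have [|f fi fP] := homogeneity HC (e := j \o env2 m m') (e' := j' \o (h \o env2 m m')).
    move=> phi; rewrite -(codes_elementary cM) (sat_iso _ _ hi); exact: codes_elementary cM' _ _ _.
  by exists f; split=> //; [exact: (fP None)|exact: (fP (Some None))].
have low m : (P (j m) <-> P (j' (h m))) /\ (lt (j m) (a (0, 0)) <-> lt (j' (h m)) (a (0, 0))).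
  have [f [fi fm]] := pair m u; rewrite hu (codes_min cM) (codes_min cM') => fa.
  split; first by rewrite -fm; exact: P_image.
  have [g [gi fK gK]] := isomorphism_inv fi.
  by split=> [/(inv fi)|/(inv gi)]; [rewrite fm fa|rewrite -fm -{1}fa !fK].
have min S1 x : coded S1 x -> ~ lt (a x) (a (0, 0)).
  by move=> /coded_min[->|/family_lt[H _]]; [exact: irr|move=> /(trans H)/irr].
have [phi phiP] : {phi : nat * nat -> nat * nat & forall x, coded S x ->
    coded S' (phi x) /\ exists2 m, j m = a x & E (a (phi x)) (j' (h m))}.
  apply: (choice (P := fun x y => coded S x ->
    coded S' y /\ exists2 m, j m = a x & E (a y) (j' (h m)))) => x.
  have [cx|nc] := pselect (coded S x); last by exists x.
  have [m jm] := codes_range cM cx; have [Pm ltm] := low m.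
  have [||y cy Ey] := codes_cover cM' (m := h m).
  - by apply/Pm; rewrite jm; exact: family_P.
  - by move=> /ltm; rewrite jm; exact: min cx.
  by exists y => _; split=> //; exists m.
apply: (coded_transfer (phi := phi)).
- by move=> x /phiP[].
- move=> x y /phiP[_ [m jm Em]] /phiP[_ [m' jm' Em']] /family_lt; rewrite -jm -jm' => -[l nE].
  have [f [fi fm fm']] := pair m m'; apply: family_ltP.
  have Pm : P (j' (h m)) by apply/(low m).1; rewrite jm; exact: family_P.
  have Pm' : P (j' (h m')) by apply/(low m').1; rewrite jm'; exact: family_P.
  apply: (E_lt lt_lin Pm Pm'); try exact: family_P; try exact: E_sym.
    by rewrite -fm -fm'; exact: inv.
  by rewrite -fm -fm' => H; apply: nE; exact/(E_imageP theta y0 (j m) (j m') fi).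
- move=> y cy; have [m' jm'] := codes_range cM' cy.
  have [[k hK kK] _ _] := hi; have [Pm ltm] := low (k m'); rewrite kK jm' in Pm ltm.
  have [||x cx Ex] := codes_cover cM (m := k m').
  - by apply/Pm; exact: family_P.
  - by move=> /ltm; exact: min cy.
  exists x => //; have [_ [m jm Em]] := phiP x cx; apply: family_inj.
  have [f [fi fm fm']] := pair m (k m'); rewrite kK jm' in fm'.
  apply: (E_trans lt_lin _ Em); first by apply/(low m).1; rewrite jm; exact: family_P.
  by rewrite -fm -fm'; apply: (E_image fi); rewrite jm.
Qed.

End Family.

Lemma many_models : [set: set nat] #<= countable_model_classes T.
Proof.
have [a a_generic] := generic_family.
have [D DP] : {D : set nat -> {M : structure L & ((M -> C) * M)%type} & forall S,
    [/\ model T (projT1 (D S)), countable_structure (projT1 (D S)) &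
      codes a S (projT2 (D S)).1 (projT2 (D S)).2]}.
  apply: (choice (P := fun S (d : {M : structure L & ((M -> C) * M)%type}) =>
    [/\ model T (projT1 d), countable_structure (projT1 d) &
      codes a S (projT2 d).1 (projT2 d).2])) => S.
  by have [M [j [u H]]] := codes_exists a_generic S; exists (existT _ M (j, u)).
pose F S := [set N | countable_structure N /\ isomorphic (projT1 (D S)) N].
(* A representative is fixed in every isomorphism class, with an enumeration [cd]. The code of [S]
   is the number of the image of the distinguished point in the representative. *)
have [r rP] : {r : set (structure L) -> structure L & forall X, (exists N, X N) -> X (r X)}.
  apply: (choice (P := fun X N => (exists N, X N) -> X N)) => X.
  by have [[N XN]|nX] := pselect (exists N, X N); [exists N|exists C].
have rF S : F S (r (F S)).
  apply: rP; exists (projT1 (D S)); have [_ cM _] := DP S; split=> //.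
  by exists id; exact: isomorphism_id.
have [cd cdP] : exists cd : forall X, r X -> nat, forall X, countable_structure (r X) -> injective (cd X).
  pose cd X : r X -> nat := match pselect (countable_structure (r X)) with
    | left cX => projT1 (cid ((countable_codeP (r X)).1 cX)) | right _ => fun _ => 0 end.
  exists cd => X cX; rewrite /cd; case: pselect => // cX'.
  by case: cid.
have [h hP] : exists h : forall S, projT1 (D S) -> r (F S), forall S, isomorphism (h S).
  exists (fun S => projT1 (cid (rF S).2)) => S; by case: cid.
apply: (@card_le_of_coding _ _ F (fun S => cd (F S) (h S (projT2 (D S)).2))) => [S|S S'].
  by have [TM cM _] := DP S; exists (projT1 (D S)).
suff sub S1 S2 : F S1 = F S2 -> cd (F S1) (h S1 (projT2 (D S1)).2) = cd (F S2) (h S2 (projT2 (D S2)).2) ->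
    S1 `<=` S2.
  by move=> FE cE; apply/seteqP; split; apply: sub.
have [[_ _ c1] [_ _ c2]] := (DP S1, DP S2).
(* Both models are isomorphic to the same representative and their distinguished points have the
   same image there, so the composite isomorphism matches these points. *)
move: (h S1) (h S2) (hP S1) (hP S2) => h1 h2 hi1 hi2 FE.
move: h1 hi1; rewrite FE => h1 hi1 /(cdP _ (rF S2).1) uE.
have [k [ki hK _]] := isomorphism_inv hi2.
apply: (codes_sub a_generic c1 c2 (h := k \o h1)); first exact: isomorphism_comp.
by rewrite /= uE hK.
Qed.

End Models.

Theorem theorem2 (L : language) (T : theory L) (C : structure L)
    (HL : countable_language L)
    (HT : complete_theory T)
    (HC : monster_model T C)
    (Hcat : almost_aleph0_categorical T)
    (Hwqom : weakly_quasi_o_minimal C)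
    (HI : card_lt (countable_model_classes T) [set: set nat]%classic) :
  forall M : structure L, model T M -> countable_structure M ->
    T1_aleph0_categorical T M.
Proof.
have [theta [lt_lin wqom]] := Hwqom.
apply: (categorical_of_convex HL HT HC Hcat lt_lin wqom) => small y.
by apply: contrapT => ny; have [_] := HI; apply; exact: (many_models HL HC Hcat lt_lin wqom ny small).
Qed.
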